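(* Consider an episodic linear-mixture MDP and the Privacy-Preserving UCRL-VTR algorithm, both as described in the context, run for $K$ episodes with failure parameter $p\in(0,1)$ and perturbations $B^1_{k,h},B^2_{k,h},g^1_{k,h},g^2_{k,h}$. Assume that the following three conditions hold simultaneously with probability at least $1-\frac{p}{3}$: (1) there exist two sequences of non-negative reals $(\Upsilon^k_{low})_k,(\Upsilon^k_{high})_k$ such that, for all $k$ and all $h\in[H]$, all eigenvalues of $B_{k,h}$ lie in $[\Upsilon^k_{low},\Upsilon^k_{high}]$; (2) there exists a sequence of non-negative reals $(C_k)_k$ such that $\|g_{k,h}\|_2\le C_k$ for all $k$ and all $h\in[H]$; (3) $(\beta_k)_k$ is a non-decreasing sequence satisfying, for all $k$, \[\beta_k\ \ge\ \frac{(\lambda+\Upsilon^k_{high})C_w+C_k}{\sqrt{\lambda+\Upsilon^k_{low}}}+\sqrt{2H^2\log\Big(\frac{3H(1+KH)^{d/2}}{p}\Big)}.\] Then, with probability at least $1-p$, the regret of the algorithm satisfies \[R(K)=\widetilde O\Big(\big(H d^{1/2}\beta_K+H^{3/2}\big)K^{1/2}\Big),\] where $\widetilde O$ hides polylogarithmic factors in $1/p$, $H$, $K$.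
   Context: Episodic MDP: horizon $H$, measurable state space $\mathcal S$, finite action set $\mathcal A$, known deterministic rewards $r_h:\mathcal S\times\mathcal A\to[0,1]$, unknown transition kernels $p_h$, $h\in[H]=\{1,\dots,H\}$. For a deterministic policy $\pi=(\pi_1,\dots,\pi_H)$, $Q^\pi_h(s,a)=r_h(s,a)+\mathbb E_\pi[\sum_{i=h+1}^H r_i(s_i,a_i)]$, $V^\pi_h(s)=Q^\pi_h(s,\pi_h(s))$, and $V^\star_h=\sup_\pi V^\pi_h$. In each episode $k=1,\dots,K$ a user with initial state $s^k_1$ executes the policy $\pi_k$ chosen by the algorithm; the regret is $R(K)=\sum_{k=1}^K V^\star_1(s^k_1)-V^{\pi_k}_1(s^k_1)$. Linear-mixture assumption: there is a known feature map $\phi:\mathcal S\times\mathcal A\times\mathcal S\to\mathbb R^d$ and unknown $w_h\in\mathbb R^d$ with $\|w_h\|_2\le C_w$ such that $p_h(s'|s,a)=\phi(s'|s,a)^\top w_h$; for any $v:\mathcal S\to\mathbb R$ write $\phi_v(s,a)=\int_{\mathcal S}\phi(s'|s,a)v(s')\,ds'$ (assumed computable), and $\|\phi_v(s,a)\|_2\le 1$ whenever $v$ takes values in $[0,1]$. Privacy-Preserving UCRL-VTR: set $\lambda=H^2$, $\widetilde\Lambda_{1,h}=\lambda I_d$, $\widetilde u_{1,h}=0$, $\widetilde w_{1,h}=0$ for all $h$. In episode $k$, with $\widetilde V_{k,H+1}\equiv0$, define for $h=H,\dots,1$: $\widetilde Q_{k,h}(s,a)=\min\{H,\ r_h(s,a)+\langle\phi_{\widetilde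 V_{k,h+1}}(s,a),\widetilde w_{k,h}\rangle+\beta_k\|\phi_{\widetilde V_{k,h+1}}(s,a)\|_{\widetilde\Lambda_{k,h}^{-1}}\}$ and $\widetilde V_{k,h}(s)=\max_a\widetilde Q_{k,h}(s,a)$ (where $\|x\|_M=\sqrt{x^\top Mx}$); the user plays $a^k_h=\arg\max_a\widetilde Q_{k,h}(s^k_h,a)$. Let $X_{k,h}=\phi_{\widetilde V_{k,h+1}}(s^k_h,a^k_h)$ and $y_{k,h}=\widetilde V_{k,h+1}(s^k_{h+1})$; the user sends $X_{k,h}X_{k,h}^\top+B^1_{k,h}$ and $X_{k,h}y_{k,h}+g^1_{k,h}$ for all $h$. The server sets $B_{k+1,h}=\sum_{i\le k}B^1_{i,h}+B^2_{k,h}$, $g_{k+1,h}=\sum_{i\le k}g^1_{i,h}+g^2_{k,h}$, $\widetilde\Lambda_{k+1,h}=\lambda I_d+\sum_{i\le k}X_{i,h}X_{i,h}^\top+B_{k+1,h}$, $\widetilde u_{k+1,h}=\sum_{i\le k}X_{i,h}y_{i,h}+g_{k+1,h}$, $\widetilde w_{k+1,h}=\widetilde\Lambda_{k+1,h}^{-1}\widetilde u_{k+1,h}$. The perturbations $B^1,B^2$ (random $d\times d$ matrices) and $g^1,g^2$ (random vectors in $\mathbb R^d$) are generated by the algorithm/users; $\beta_k$ are input confidence widths.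
   Formalization: The perturbation matrices B^1, B^2 are additionally assumed symmetric; without this, a large nilpotent B_{k,h} (all eigenvalues 0) meets conditions (1)-(3) while the bonus norm with the inverse of Λ̃_{k,h} becomes the square root of a negative number. *)

(* Defs.v *)
From HB Require Import structures.
From mathcomp Require Import all_boot all_order all_algebra.
From mathcomp Require Import all_classical all_reals all_analysis.
Set Implicit Arguments. Unset Strict Implicit. Unset Printing Implicit Defensive.
Import Order.TTheory GRing.Theory Num.Theory.
Local Open Scope classical_set_scope.
Local Open Scope ring_scope.

Section LinAlg.
Context {R : realType} {d : nat}.
Definition dotv (x y : 'cV[R]_d) : R := (x^T *m y) 0 0.
Definition norm2 (x : 'cV[R]_d) : R := Num.sqrt (dotv x x).
Definition mxnorm (M : 'M[R]_d) (x : 'cV[R]_d) : R :=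
  Num.sqrt ((x^T *m M *m x) 0 0).
End LinAlg.

Section MDP.
Context {R : realType} {dS : measure_display} {S : measurableType dS}
  (mu : {measure set S -> \bar R}) {A : finType} {d : nat}.
(* phi s a s' is the feature vector phi(s' | s, a) *)
Variable phi : S -> A -> S -> 'cV[R]_d.

Definition phi_v (v : S -> R) (s : S) (a : A) : 'cV[R]_d :=
  \col_i Rintegral mu setT (fun s' => phi s a s' i 0 * v s').

Definition trans_dens (wh : 'cV[R]_d) (s : S) (a : A) (s' : S) : R :=
  dotv (phi s a s') wh.

Definition trans_prob (wh : 'cV[R]_d) (s : S) (a : A) (B : set S) : \bar R :=
  (\int[mu]_(s' in B) (trans_dens wh s a s')%:E)%E.

Variables (H : nat) (r : nat -> S -> A -> R) (w : nat -> 'cV[R]_d).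

Fixpoint Vpi_aux (pi : nat -> S -> A) (n h : nat) : S -> R :=
  match n with
  | 0 => fun _ => 0
  | n'.+1 => fun s => r h s (pi h s) +
      Rintegral mu setT
        (fun s' => trans_dens (w h) s (pi h s) s' * Vpi_aux pi n' h.+1 s')
  end.

Definition Vpi (pi : nat -> S -> A) (h : nat) : S -> R := Vpi_aux pi (H.+1 - h) h.

Definition measurable_policy (pi : nat -> S -> A) : Prop :=
  forall (h : nat) (a : A), measurable (pi h @^-1` [set a]).

Definition Vstar (h : nat) (s : S) : R :=
  sup [set Vpi pi h s | pi in measurable_policy].

Section Algorithm.
Variables (lam : R) (beta : nat -> R) (a0 : A).
Variables (st : nat -> nat -> S) (B1 B2 : nat -> nat -> 'M[R]_d)
          (g1 g2 : nat -> nat -> 'cV[R]_d).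

(* B_{k,h} = sum_{i <= k-1} B^1_{i,h} + B^2_{k-1,h} for k >= 2, and B_{1,h} = 0
   (so that Lambda_{1,h} = lam I) *)
Definition Bpert (k h : nat) : 'M[R]_d :=
  if k is k'.+2 then \sum_(1 <= i < k'.+2) B1 i h + B2 k'.+1 h else 0.
Definition gpert (k h : nat) : 'cV[R]_d :=
  if k is k'.+2 then \sum_(1 <= i < k'.+2) g1 i h + g2 k'.+1 h else 0.

Definition Qtil (Lam : 'M[R]_d) (wt : 'cV[R]_d) (b : R) (h : nat)
  (Vnext : S -> R) (s : S) (a : A) : R :=
  Num.min H%:R (r h s a + dotv (phi_v Vnext s a) wt
                + b * mxnorm (invmx Lam) (phi_v Vnext s a)).

Fixpoint Vtil_aux (Lam : nat -> 'M[R]_d) (wt : nat -> 'cV[R]_d) (b : R)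
  (n h : nat) : S -> R :=
  match n with
  | 0 => fun _ => 0
  | n'.+1 => fun s =>
      \big[Num.max/Qtil (Lam h) (wt h) b h (Vtil_aux Lam wt b n' h.+1) s a0]_(a : A)
        Qtil (Lam h) (wt h) b h (Vtil_aux Lam wt b n' h.+1) s a
  end.
Definition Vtil Lam wt b (h : nat) : S -> R := Vtil_aux Lam wt b (H.+1 - h) h.

Definition greedy Lam wt b (h : nat) (s : S) : A :=
  odflt a0 [pick a | [forall a' : A,
      Qtil (Lam h) (wt h) b h (Vtil Lam wt b h.+1) s a'
      <= Qtil (Lam h) (wt h) b h (Vtil Lam wt b h.+1) s a]].

Definition Lam_of (pre : nat -> 'M[R]_d * 'cV[R]_d) (k h : nat) : 'M[R]_d :=
  lam%:M + (pre h).1 + Bpert k h.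
Definition w_of (pre : nat -> 'M[R]_d * 'cV[R]_d) (k h : nat) : 'cV[R]_d :=
  invmx (Lam_of pre k h) *m ((pre h).2 + gpert k h).
Definition V_of pre (k : nat) := Vtil (Lam_of pre k) (w_of pre k) (beta k).
Definition pol_of pre (k : nat) := greedy (Lam_of pre k) (w_of pre k) (beta k).

Fixpoint acc (n : nat) : nat -> 'M[R]_d * 'cV[R]_d :=
  match n with
  | 0 => fun _ => (0, 0)
  | n'.+1 => fun h =>
      let pre := acc n' in
      let X := phi_v (V_of pre n'.+1 h.+1) (st n'.+1 h)
                     (pol_of pre n'.+1 h (st n'.+1 h)) in
      let y := V_of pre n'.+1 h.+1 (st n'.+1 h.+1) in
      ((pre h).1 + X *m X^T, (pre h).2 + y *: X)
  end.

(* quantities of episode k >= 1 *)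
Definition Lamt (k h : nat) : 'M[R]_d := Lam_of (acc k.-1) k h.
Definition wtil (k h : nat) : 'cV[R]_d := w_of (acc k.-1) k h.
Definition policy (k : nat) : nat -> S -> A := pol_of (acc k.-1) k.
Definition action (k h : nat) : A := policy k h (st k h).

Definition regret (K : nat) : R :=
  \sum_(1 <= k < K.+1) (Vstar 1 (st k 1) - Vpi (policy k) 1 (st k 1)).
End Algorithm.
End MDP.

Section Process.
Context {R : realType} {dS : measure_display} {S : measurableType dS}
  {d : nat} {dO : measure_display} {Omega : measurableType dO}.
Variables (H : nat) (s : nat -> nat -> Omega -> S)
  (B1 B2 : nat -> nat -> Omega -> 'M[R]_d) (g1 g2 : nat -> nat -> Omega -> 'cV[R]_d).

(* generators of the history sigma-algebra F_{k,h} just before the transition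
   from s^k_h to s^k_{h+1}: all states s^i_j of previous episodes i < k and
   s^k_1, ..., s^k_h of the current episode, and all perturbations
   B^1_{i,j}, B^2_{i,j}, g^1_{i,j}, g^2_{i,j} of previous episodes i < k *)
Definition history (k h : nat) : set (set Omega) :=
  [set E | exists (i j : nat) (Bs : set S), measurable Bs /\
     (1 <= i)%N /\ (1 <= j <= H.+1)%N /\ ((i < k)%N \/ (i = k /\ (j <= h)%N)) /\
     E = s i j @^-1` Bs]
  `|` [set E | exists (i j : nat) (x y : 'I_d) (Br : set R), measurable Br /\
     (1 <= i < k)%N /\ (1 <= j <= H)%N /\
     (E = (fun o => B1 i j o x y) @^-1` Br \/ E = (fun o => B2 i j o x y) @^-1` Br)]
  `|` [set E | exists (i j : nat) (x : 'I_d) (Br : set R), measurable Br /\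
     (1 <= i < k)%N /\ (1 <= j <= H)%N /\
     (E = (fun o => g1 i j o x 0) @^-1` Br \/ E = (fun o => g2 i j o x 0) @^-1` Br)].
End Process.

(* Main.v *)
(* Optimism for a regression with perturbed covariance [Lam + B] and targets [u + g].
   The noise process [S_k] of the value regression is controlled by the process
   [sqrt (det (lam I) / det Lam_k) * exp (|S_k|^2_{Lam_k^-1} / (2 H^2))].
   It is shown to be a supermartingale directly, by a rank-one update
   (Sherman-Morrison and the matrix determinant lemma) and Hoeffding's argument in one
   dimension, so that no Gaussian mixture is integrated.  Ville's inequality bounds it
   for all episodes at once; on that event the eigenvalue and norm bounds on the
   perturbations put [w_h] in the ellipsoid of radius [beta_k] around its estimate, and
   the estimated values dominate the optimal ones.  The regret then
   telescopes into twice the sum of the bonuses, bounded by the elliptical potential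
   [sum_k |X_k|^2 <= 2 log (det Lam_K / det (lam I))], plus a martingale with increments
   bounded by [2 H], bounded by the Azuma-Hoeffding method.

   Before the confidence event is known to hold the estimated values may be negative, which
   would ruin every boundedness argument.  The supermartingales are therefore built from
   the values truncated at [0], and an induction on the episode shows that
   truncation changes nothing on the good event. *)
Require Import Defs.
From HB Require Import structures.
From mathcomp Require Import all_boot all_order all_algebra.
From mathcomp Require Import all_classical all_reals all_analysis.
From mathcomp Require Import measurable_realfun ring lra complex.
Set Implicit Arguments. Unset Strict Implicit. Unset Printing Implicit Defensive.
Import Order.TTheory GRing.Theory Num.Theory numFieldNormedType.Exports.
Local Open Scope classical_set_scope.
Local Open Scope ring_scope.

(** * Positive definite forms *)

Section QuadraticForms.
Context {R : realType} {d : nat}.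
Implicit Types (x y z u : 'cV[R]_d) (M N : 'M[R]_d).

(** No conditional expectation is ever formed. The history sigma-algebra is put on [Omega] as a
    second measurable structure, the identity into it is the conditioning variable, and every drift
    inequality is an inequality of integrals over a history event. The price is measurability of the
    whole algorithm in its past data, which is proved over an abstract parameter space and used for
    both structures. The perturbations enter the probabilistic part only through the history: the
    policy of episode [k] depends on perturbations of earlier episodes alone. Elsewhere only their
    symmetry and the bounds on spectrum and norm matter. The choice [lam = H^2] makes every feature
    satisfy [|X|^2 <= lam]. Hence [|X|^2] in the inverse Gram norm is at most 1, the logarithm bound
    applies without clipping, and [n] episodes multiply the determinant by at most [(1 + n)^d]. The
    failure probability is split into three shares [p / 3]: the assumed conditions, the martingale
    of gaps, and the noise. The last share is divided among the [H] stages, so Ville's level is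
    [3 H / p], which is the factor in the logarithm of the width. *)

Definition qf M x : R := dotv x (M *m x).

Lemma dotvE x y : dotv x y = \sum_i x i 0 * y i 0.
Proof. by rewrite /dotv mxE; apply: eq_bigr => i _; rewrite mxE. Qed.

Lemma dotvC x y : dotv x y = dotv y x.
Proof. by rewrite !dotvE; apply: eq_bigr => i _; rewrite mulrC. Qed.

Lemma dotvDl x y z : dotv (x + y) z = dotv x z + dotv y z.
Proof. by rewrite /dotv linearD mulmxDl mxE. Qed.

Lemma dotvDr x y z : dotv x (y + z) = dotv x y + dotv x z.
Proof. by rewrite /dotv mulmxDr mxE. Qed.

Lemma dotvZl a x y : dotv (a *: x) y = a * dotv x y.
Proof. by rewrite /dotv linearZ /= -scalemxAl mxE. Qed.

Lemma dotvZr a x y : dotv x (a *: y) = a * dotv x y.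
Proof. by rewrite /dotv -scalemxAr mxE. Qed.

Lemma dotvNr x y : dotv x (- y) = - dotv x y.
Proof. by rewrite -scaleN1r dotvZr mulN1r. Qed.

Lemma dotv_mulmxr M x y : dotv x (M *m y) = dotv (M^T *m x) y.
Proof. by rewrite /dotv trmx_mul trmxK mulmxA. Qed.

Lemma dotv_outer u x y z : dotv x ((y *m z^T) *m u) = dotv x y * dotv z u.
Proof.
rewrite /dotv -mulmxA mulmxA [x^T *m y]mx11_scalar mul_scalar_mx mxE.
by rewrite -mx11_scalar.
Qed.

Lemma outer_mulmx x y z : (x *m y^T) *m z = dotv y z *: x.
Proof. by rewrite -mulmxA [y^T *m z]mx11_scalar mul_mx_scalar. Qed.

Lemma dotv_ge0 x : 0 <= dotv x x.
Proof. by rewrite dotvE; apply: sumr_ge0 => i _; rewrite -expr2 sqr_ge0. Qed.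

Lemma dotv_gt0 x : x != 0 -> 0 < dotv x x.
Proof.
move=> x0; rewrite lt0r dotv_ge0 andbT; apply: contra x0 => /eqP h.
apply/eqP/colP => i; rewrite mxE.
move: h; rewrite dotvE => /psumr_eq0P h.
have /eqP := h (fun i _ => sqr_ge0 (x i 0)) i isT.
by rewrite mulf_eq0 orbb => /eqP.
Qed.

Lemma norm2_ge0 x : 0 <= norm2 x. Proof. exact: sqrtr_ge0. Qed.

Lemma norm2_sq x : norm2 x ^+ 2 = dotv x x.
Proof. by rewrite /norm2 sqr_sqrtr// dotv_ge0. Qed.

Lemma mxnormE M x : mxnorm M x = Num.sqrt (qf M x).
Proof. by rewrite /mxnorm /qf /dotv mulmxA. Qed.

Lemma mxnorm_ge0 M x : 0 <= mxnorm M x. Proof. exact: sqrtr_ge0. Qed.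

Lemma qfD M x y : M^T = M -> qf M (x + y) = qf M x + 2 * dotv x (M *m y) + qf M y.
Proof.
move=> Ms; rewrite /qf mulmxDr !dotvDl !dotvDr.
by rewrite [dotv y (M *m x)]dotv_mulmxr Ms [dotv (M *m y) x]dotvC; ring.
Qed.

Lemma qfZ M a x : qf M (a *: x) = a ^+ 2 * qf M x.
Proof. by rewrite /qf -scalemxAr dotvZl dotvZr mulrA expr2. Qed.

Lemma qfN M x : qf M (- x) = qf M x.
Proof. by rewrite -scaleN1r qfZ sqrrN expr1n mul1r. Qed.

Lemma qf_addmx M N x : qf (M + N) x = qf M x + qf N x.
Proof. by rewrite /qf mulmxDl dotvDr. Qed.

Lemma qf_scalar (a : R) x : qf a%:M x = a * dotv x x.
Proof. by rewrite /qf mul_scalar_mx dotvZr. Qed.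

Lemma qf_outer x y : qf (x *m x^T) y = dotv x y ^+ 2.
Proof. by rewrite /qf dotv_outer dotvC -expr2. Qed.

Definition posdef M := M^T = M /\ forall x, x != 0 -> 0 < qf M x.

(** The quadratic polynomial [t -> qf M (x + t *: y)] is nonnegative. Semidefiniteness is allowed,
    so its leading coefficient [qf M y] may vanish. *)
Lemma qf_psd_CS M x y : M^T = M -> (forall z, 0 <= qf M z) ->
  dotv x (M *m y) ^+ 2 <= qf M x * qf M y.
Proof.
move=> Ms Mp; set b := dotv _ _.
have h t : 0 <= qf M x + 2 * t * b + t ^+ 2 * qf M y.
  have := Mp (x + t *: y); rewrite qfD// qfZ -scalemxAr dotvZr -/b.
  by rewrite mulrA.
have := Mp y; rewrite le0r => /orP[/eqP y0|y0].
  rewrite y0 mulr0; have [->|b0] := eqVneq b 0; first by rewrite expr0n.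
  (* With [qf M y = 0] the polynomial is affine; a nonzero slope would let it take the value [-1] at
     this point. *)
  have := h (- (qf M x + 1) / (2 * b)); rewrite y0 mulr0 addr0.
  have -> : 2 * (- (qf M x + 1) / (2 * b)) * b = - (qf M x + 1) by field.
  by rewrite subr_ge0 leNgt ltrDl ltr01.
(* The minimiser of the polynomial. *)
have := h (- b / qf M y).
have -> : qf M x + 2 * (- b / qf M y) * b + (- b / qf M y) ^+ 2 * qf M y
  = qf M x - b ^+ 2 / qf M y by field; rewrite gt_eqF.
by rewrite subr_ge0 ler_pdivrMr.
Qed.

Lemma posdef_ge0 M x : posdef M -> 0 <= qf M x.
Proof.
move=> [_ Mp]; have [->|x0] := eqVneq x 0; last exact/ltW/Mp.
by rewrite /qf mulmx0 /dotv mulmx0 mxE.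
Qed.

Lemma posdef_unitmx M : posdef M -> M \in unitmx.
Proof.
move=> [Ms Mp]; rewrite -row_free_unit; apply: inj_row_free => v vM.
apply: contraTeq isT => v0.
have := Mp v^T; rewrite trmx_eq0 => /(_ v0).
by rewrite /qf dotv_mulmxr Ms -Ms -trmx_mul vM trmx0 /dotv trmx0 mul0mx mxE ltxx.
Qed.

Lemma trmx_invmx M : M^T = M -> (invmx M)^T = invmx M.
Proof. by move=> Ms; rewrite trmx_inv Ms. Qed.

Lemma qf_invmx M x : posdef M -> qf (invmx M) x = qf M (invmx M *m x).
Proof.
move=> Mp; rewrite /qf mulKVmx ?posdef_unitmx//.
by rewrite dotvC.
Qed.

Lemma qf_invmx_ge0 M x : posdef M -> 0 <= qf (invmx M) x.
Proof. by move=> Mp; rewrite qf_invmx// posdef_ge0. Qed.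

Lemma dotv_CS M x y : posdef M -> dotv x y ^+ 2 <= qf (invmx M) x * qf M y.
Proof.
move=> Mp; have Ms := Mp.1.
rewrite qf_invmx//.
have -> : dotv x y = dotv (invmx M *m x) (M *m y).
  by rewrite dotv_mulmxr Ms mulKVmx ?posdef_unitmx.
by apply: qf_psd_CS => // z; exact: posdef_ge0.
Qed.

(* [x^T M^-1 x = u^T M u >= u^T N u] for [u = M^-1 x]; conclude by Cauchy-Schwarz for [N] *)
Lemma qf_invmx_anti M N x : posdef N -> M^T = M -> (forall y, qf N y <= qf M y) ->
  qf (invmx M) x <= qf (invmx N) x.
Proof.
move=> Np Ms NM.
have Mp : posdef M.
  by split=> // y y0; apply: lt_le_trans (NM y); exact: Np.2.
have := qf_invmx_ge0 x Mp; rewrite le0r => /orP[/eqP->|gt0].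
  exact: qf_invmx_ge0.
have := dotv_CS x (invmx M *m x) Np.
rewrite -/(qf (invmx M) x) => h.
have h2 : qf N (invmx M *m x) <= qf (invmx M) x by rewrite qf_invmx.
rewrite -(ler_pM2r gt0) -expr2; apply: le_trans h _.
by apply: ler_wpM2l => //; exact: qf_invmx_ge0.
Qed.

Lemma posdef_scalar (a : R) : 0 < a -> posdef a%:M.
Proof.
move=> a0; split; first by rewrite tr_scalar_mx.
by move=> x x0; rewrite qf_scalar mulr_gt0// dotv_gt0.
Qed.

Lemma posdef_ge M N : posdef N -> M^T = M -> (forall y, qf N y <= qf M y) -> posdef M.
Proof. by move=> Np Ms NM; split=> // y y0; apply: lt_le_trans (NM y); exact: Np.2. Qed.

Lemma qf_invmx_scalar (a : R) x : 0 < a -> qf (invmx a%:M) x = dotv x x / a.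
Proof.
move=> a0; rewrite /qf.
have -> : invmx a%:M *m x = a^-1 *: x.
  have au : (a%:M : 'M[R]_d) \in unitmx by rewrite posdef_unitmx//; exact: posdef_scalar.
  apply: (can_inj (mulKmx au)).
  by rewrite mulKVmx// mul_scalar_mx scalerA mulfV ?scale1r// gt_eqF.
by rewrite dotvZr mulrC.
Qed.

Lemma qf_invmx_le (a : R) M x : 0 < a -> M^T = M -> (forall y, a * dotv y y <= qf M y) ->
  qf (invmx M) x <= dotv x x / a.
Proof.
move=> a0 Ms h; rewrite -qf_invmx_scalar//; apply: qf_invmx_anti => //.
  exact: posdef_scalar.
by move=> y; rewrite qf_scalar.
Qed.

Lemma mxnorm_invmxD_le M x y : posdef M ->
  mxnorm (invmx M) (x + y) <= mxnorm (invmx M) x + mxnorm (invmx M) y.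
Proof.
move=> Mp.
have Mis : (invmx M)^T = invmx M by rewrite trmx_invmx//; exact: Mp.1.
have Mi z : 0 <= qf (invmx M) z by exact: qf_invmx_ge0.
rewrite -(@ler_pXn2r _ 2%N) ?nnegrE ?addr_ge0 ?mxnorm_ge0//.
rewrite sqrrD !mxnormE !sqr_sqrtr// qfD//.
rewrite -sqrtrM// lerD2r lerD2l mulr_natl lerMn2r /=.
by apply: le_trans (ler_norm _) _; rewrite -sqrtr_sqr ler_sqrt ?mulr_ge0// qf_psd_CS.
Qed.

Lemma mxnormN M x : mxnorm M (- x) = mxnorm M x.
Proof. by rewrite !mxnormE qfN. Qed.

Lemma posdef_outer M x : posdef M -> posdef (M + x *m x^T).
Proof.
move=> Mp; apply: (@posdef_ge _ M) => //.
  by rewrite linearD /= trmx_mul trmxK Mp.1.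
by move=> y; rewrite qf_addmx qf_outer lerDl sqr_ge0.
Qed.

(** The vector receives the increment [a *: x] along the same direction as the matrix update. The
    form then changes by a function of the scalars [a], [q], [s] only, which is what reduces the
    supermartingale property to one dimension. *)
Lemma Sherman_Morrison M x z (a : R) (q := qf (invmx M) x) (s := dotv z (invmx M *m x)) :
  posdef M ->
  qf (invmx (M + x *m x^T)) (z + a *: x) =
  qf (invmx M) z + (2 * a * s + a ^+ 2 * q - s ^+ 2) / (1 + q).
Proof.
move=> Mp; have Mu := posdef_unitmx Mp.
have Mis : (invmx M)^T = invmx M by rewrite trmx_invmx//; exact: Mp.1.
have q0 : 0 <= q by exact: qf_invmx_ge0.
have q1 : 1 + q != 0 by rewrite gt_eqF// ltr_wpDr.
set y := z + a *: x.
pose t := dotv x (invmx M *m y) / (1 + q).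
have yE : dotv x (invmx M *m y) = s + a * q.
  by rewrite /y mulmxDr dotvDr -scalemxAr dotvZr dotv_mulmxr Mis dotvC.
have uE : invmx (M + x *m x^T) *m y = invmx M *m y - t *: (invmx M *m x).
  have Nu := posdef_unitmx (posdef_outer x Mp).
  apply: (can_inj (mulKmx Nu)); rewrite mulKVmx//.
  rewrite mulmxBr mulmxDl mulKVmx// outer_mulmx -scalemxAr mulmxDl mulKVmx//.
  rewrite outer_mulmx -/(qf (invmx M) x) -/q.
  have -> : dotv x (invmx M *m y) = t * (1 + q) by rewrite /t mulfVK.
  by rewrite mulrDr mulr1 scalerDl scalerDr scalerA addrK.
rewrite {1}/qf uE dotvDr dotvNr dotvZr.
have -> : dotv y (invmx M *m x) = s + a * q.
  by rewrite /y dotvDl dotvZl.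
rewrite -/(qf (invmx M) y) /t yE /y qfD// qfZ -scalemxAr dotvZr -/q -/s.
by field.
Qed.

(** Two unipotent block factors carry a block triangular matrix with corner [1 + u v^T] to one with
    the 1 x 1 corner [1 + v^T u]; taking determinants identifies the two corners. *)
Lemma det_rank1 (u v : 'cV[R]_d) : \det (1%:M + u *m v^T) = 1 + dotv v u.
Proof.
have E : block_mx 1%:M 0 v^T 1%:M *m block_mx (1%:M + u *m v^T) u 0 1%:M
   *m block_mx 1%:M 0 (- v^T) 1%:M = block_mx 1%:M u 0 (1%:M + v^T *m u).
  rewrite !mulmx_block !mul1mx !mul0mx !mulmx0 !mulmx1 !add0r !addr0.
  rewrite mulmxN addrK mulmxDr mulmx1 mulmxN mulmxDl mul1mx -mulmxA.
  by rewrite [v^T + _]addrC subrr addrC.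
have := congr1 determinant E.
rewrite !det_mulmx !det_lblock !det_ublock !det1 !mulr1 !mul1r => ->.
by rewrite [in LHS](mx11_scalar (v^T *m u)) -raddfD det_scalar1.
Qed.

Lemma det_outer M x : posdef M ->
  \det (M + x *m x^T) = \det M * (1 + qf (invmx M) x).
Proof.
move=> Mp; have Mu := posdef_unitmx Mp.
have -> : M + x *m x^T = M *m (1%:M + (invmx M *m x) *m x^T).
  by rewrite mulmxDr mulmx1 !mulmxA mulmxV// mul1mx.
by rewrite det_mulmx det_rank1.
Qed.

End QuadraticForms.

(** * Spectral theorem for real symmetric matrices, by complexification *)

Section Spectral.
Context {R : realType} {d : nat}.
Implicit Types (x : 'cV[R]_d) (B : 'M[R]_d).
Local Open Scope sesquilinear_scope.

(* [c x i] is the squared modulus of the [i]-th coordinate of [x] in a unitary eigenbasis over [R[i]] *)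
Lemma symmetric_spectral B : B^T = B ->
  exists (a : 'I_d -> R) (c : 'cV[R]_d -> 'I_d -> R),
  [/\ forall i, eigenvalue B (a i),
      forall x i, 0 <= c x i,
      forall x, dotv x x = \sum_i c x i,
      forall x, qf B x = \sum_i a i * c x i &
      (forall x, dotv (B *m x) (B *m x) = \sum_i a i ^+ 2 * c x i) /\
      \det B = \prod_i a i].
Proof.
move=> Bs.
pose rc : {rmorphism R -> R[i]} := real_complex R.
pose BC := map_mx rc B.
have conjrc (y : R) : (rc y)^* = rc y by rewrite /rc /= conj_Creal// complex_real.
have BCh : BC \is hermsymmx.
  apply: realsym_hermsym.
    apply/is_hermitianmxP; rewrite expr0 scale1r; apply/matrixP => i j.
    by rewrite !mxE /= -[in LHS]Bs mxE.
  by apply/mxOverP => i j; rewrite mxE complex_real.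
have /orthomx_spectralP BE := hermitian_normalmx BCh.
have Dr := hermitian_spectral_diag_real BCh.
set P := spectralmx BC in BE; set D := spectral_diag BC in BE Dr.
have Pu : P \is unitarymx by exact: spectral_unitarymx.
have PU : P \in unitmx by exact: spectral_unit.
have iP : invmx P = P^t* by exact: invmx_unitary.
have /fin_all_exists [a aE] : forall i, exists a : R, D 0 i = rc a.
  move=> i; have /mxOverP/(_ 0 i) := Dr => /complex_realP[a ->]; by exists a.
pose zv x := P *m map_mx rc x.
have cx x i : exists c : R, 0 <= c /\ (zv x i 0)^* * zv x i 0 = rc c.
  have h : 0 <= (zv x i 0)^* * zv x i 0 by rewrite mulrC -normCK exprn_ge0.
  have /complex_realP[c cE] : (zv x i 0)^* * zv x i 0 \is Num.real by exact: ger0_real.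
  by exists c; split; [rewrite cE lecR in h|].
pose c x i := xget 0 [set c : R | 0 <= c /\ (zv x i 0)^* * zv x i 0 = rc c].
have cP x i : 0 <= c x i /\ (zv x i 0)^* * zv x i 0 = rc (c x i).
  by rewrite /c; case: xgetP => [y -> //|h]; have [c0 hc] := cx x i; case: (h c0).
exists a, c.
have dC (x y : 'cV[R]_d) : rc (dotv x y) = ((map_mx rc x)^t* *m map_mx rc y) 0 0.
  rewrite dotvE rmorph_sum mxE; apply: eq_bigr => i _.
  by rewrite rmorphM !mxE conjrc.
have tz x : (map_mx rc x)^t* *m P^t* = (zv x)^t*.
  by rewrite /zv trmx_mul map_mxM.
have tE (y : 'cV[R[i]]_d) i : (y^t*) 0 i = (y i 0)^* by rewrite !mxE.
have diagz (y : 'cV[R[i]]_d) i : (diag_mx D *m y) i 0 = rc (a i) * y i 0.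
  by rewrite mul_diag_mx mxE aE.
split.
(* The rows of [P] are left eigenvectors over [R[i]]. Being an eigenvalue does not depend on the
   field, so each real diagonal entry is an eigenvalue of [B] itself. *)
- move=> i; rewrite -(eigenvalue_map rc); apply/eigenvalueP.
  exists (row i P); last first.
    apply/eqP => h; have : row i P *m invmx P = 0 by rewrite h mul0mx.
    rewrite -row_mul mulmxV// => /rowP/(_ i); rewrite !mxE eqxx => /eqP.
    by rewrite oner_eq0.
  rewrite -/BC BE -row_mul !mulmxA mulmxV// mul1mx.
  by rewrite row_mul row_diag_mx -scalemxAl -rowE aE.
- by move=> x i; have [] := cP x i.
- move=> x; apply: (@complexI R); rewrite dC rmorph_sum /=.
  have -> : map_mx rc x = P^t* *m zv x by rewrite /zv mulmxA -iP mulVmx// mul1mx.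
  rewrite trmx_mul map_mxM trmxCK -mulmxA.
  rewrite -iP mulKVmx//.
  rewrite mxE; apply: eq_bigr => i _; rewrite tE.
  by have [_ ->] := cP x i.
- move=> x; apply: (@complexI R); rewrite /qf dC rmorph_sum /=.
  rewrite map_mxM -/BC BE iP !mulmxA tz -!mulmxA -/(zv x) mxE.
  apply: eq_bigr => i _; rewrite diagz tE rmorphM /=.
  by have [_ <-] := cP x i; rewrite mulrCA.
- split.
    move=> x; apply: (@complexI R); rewrite dC rmorph_sum /=.
    rewrite map_mxM -/BC BE iP -!mulmxA -/(zv x) trmx_mul map_mxM trmxCK.
    rewrite -mulmxA -iP mulKVmx// mxE.
    apply: eq_bigr => i _; rewrite tE diagz rmorphM /= conjrc.
    rewrite [RHS](rmorphM rc) (rmorphXn rc).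
    by have [_ <-] := cP x i; rewrite expr2 mulrACA.
  apply: (@complexI R); rewrite -[real_complex_def _ _]/(rc _) -det_map_mx -/BC BE.
  rewrite !det_mulmx mulrAC -det_mulmx mulVmx// det1 mul1r det_diag rmorph_prod.
  by apply: eq_bigr => i _; rewrite aE.
Qed.

End Spectral.

Section SpectralBounds.
Context {R : realType} {d : nat}.
Implicit Types (x : 'cV[R]_d) (B M : 'M[R]_d).

Lemma qf_ge_eigenvalue B lo hi x : B^T = B ->
  (forall e, eigenvalue B e -> lo <= e <= hi) -> lo * dotv x x <= qf B x.
Proof.
move=> Bs h; have [a [c [ea c0 dE qE _]]] := symmetric_spectral Bs.
rewrite dE qE mulr_sumr; apply: ler_sum => i _; apply: ler_wpM2r => //.
by have /andP[] := h _ (ea i).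
Qed.

Lemma norm2_mul_le_eigenvalue B lo hi x : B^T = B -> 0 <= lo -> 0 <= hi ->
  (forall e, eigenvalue B e -> lo <= e <= hi) -> norm2 (B *m x) <= hi * norm2 x.
Proof.
move=> Bs lo0 hi0 h; have [a [c [ea c0 dE _ [qE _]]]] := symmetric_spectral Bs.
rewrite -(@ler_pXn2r _ 2%N) ?nnegrE ?mulr_ge0 ?norm2_ge0//.
rewrite exprMn !norm2_sq qE dE mulr_sumr; apply: ler_sum => i _.
apply: ler_wpM2r => //; have /andP[la ha] := h _ (ea i).
by rewrite ler_pXn2r ?nnegrE// (le_trans lo0).
Qed.

(** Every factor of the determinant is the Rayleigh quotient of some real vector, so bounds on the
    form pass to each factor and then to the determinant. *)
Lemma posdef_spectrum M : posdef M ->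
  exists2 a : 'I_d -> R, \det M = \prod_i a i &
  forall i, exists2 v, v != 0 & qf M v = a i * dotv v v.
Proof.
move=> Mp; have [a [_ [ea _ _ _ [_ aE]]]] := symmetric_spectral Mp.1.
exists a => // i; have /eigenvalueP[v vE v0] := ea i.
exists v^T; first by rewrite trmx_eq0.
by rewrite /qf -[M]Mp.1 -trmx_mul vE linearZ /= dotvZr.
Qed.

Lemma det_posdef_gt0 M : posdef M -> 0 < \det M.
Proof.
move=> Mp; have [a -> ha] := posdef_spectrum Mp.
apply: prodr_gt0 => i _; have [v v0 qE] := ha i.
by have := Mp.2 _ v0; rewrite qE pmulr_lgt0// dotv_gt0.
Qed.

Lemma det_posdef_le M (c : R) : posdef M -> (forall x, qf M x <= c * dotv x x) ->
  \det M <= c ^+ d.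
Proof.
move=> Mp Mc; have [a -> ha] := posdef_spectrum Mp.
have -> : c ^+ d = \prod_(i < d) c by rewrite prodr_const card_ord.
apply: ler_prod => i _; have [v v0 qE] := ha i; have vv := dotv_gt0 v0.
apply/andP; split; first by have := Mp.2 _ v0; rewrite qE pmulr_lgt0// => /ltW.
by have := Mc v; rewrite qE ler_pM2r.
Qed.

End SpectralBounds.

(** * Scalar inequalities *)

Section ScalarBounds.
Context {R : realType}.
Implicit Types (q u x : R).

(** This is [1 - t <= exp (- t)] at [t = q / (1 + q)], where [1 - t] is [1 / (1 + q)]. It serves
    both the supermartingale and the elliptical potential. *)
Lemma expR_div1D_le q : 0 <= q -> expR (q / (1 + q)) <= 1 + q.
Proof.
move=> q0; have q1 : 0 < 1 + q by lra.
rewrite -lef_pV2 ?posrE ?expR_gt0// -expRN.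
apply: le_trans (expR_ge1Dx _); have {1}-> : (1 + q)^-1 = 1 - q / (1 + q) by field; rewrite gt_eqF.
exact: lexx.
Qed.

Lemma ln1D_ge q : 0 <= q <= 1 -> q <= 2 * ln (1 + q).
Proof.
move=> /andP[q0 q1]; have q2 : 0 < 1 + q by lra.
have : q / (1 + q) <= ln (1 + q).
  by rewrite -[leLHS]expRK ler_ln ?posrE ?expR_gt0// expR_div1D_le.
have : q / 2 <= q / (1 + q) by rewrite ler_wpM2l// lef_pV2 ?posrE; lra.
lra.
Qed.

(** Convexity from tangents: the tangent at [u * x] lies below the exponential at [u] and at [- u],
    and the weights average these two points to [u * x], which cancels the slope. *)
Lemma expR_le_chord u x : -1 <= x <= 1 ->
  expR (u * x) <= (1 + x) / 2 * expR u + (1 - x) / 2 * expR (- u).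
Proof.
move=> /andP[x1 x2].
have tangent y : expR (u * x) * (1 + (y - u * x)) <= expR y.
  have {2}-> : y = u * x + (y - u * x) by ring.
  by rewrite expRD ler_pM2l ?expR_gt0// expR_ge1Dx.
have h1 := tangent u; have h2 := tangent (- u).
have p1 : 0 <= (1 + x) / 2 by lra.
have p2 : 0 <= (1 - x) / 2 by lra.
have := lerD (ler_wpM2l p1 h1) (ler_wpM2l p2 h2); apply: le_trans.
by rewrite le_eqVlt; apply/orP; left; apply/eqP; field.
Qed.

(** Compares the series of [cosh u] and [exp (u^2 / 2)] term by term. *)
Lemma expn2_fact_le (j : nat) : (2 ^ j * j`! <= (j.*2)`!)%N.
Proof.
elim: j => // j IH.
rewrite doubleS !factS expnS.
have -> : (2 * 2 ^ j * (j.+1 * j`!) = (j.+1).*2 * (2 ^ j * j`!))%N.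
  by rewrite -muln2; ring.
by rewrite doubleS; apply: leq_mul => //; exact/(leq_trans IH)/leq_pmull.
Qed.

Lemma cosh_le u : (expR u + expR (- u)) / 2 <= expR (u ^+ 2 / 2).
Proof.
rewrite ler_pdivrMr// mulrC.
have cE (y : R) : (series (exp_coeff y) @ \oo --> expR y)%classic.
  exact: is_cvg_series_exp_coeff.
have cu : ((fun n => series (exp_coeff u) n + series (exp_coeff (- u)) n) @ \oo
    --> expR u + expR (- u))%classic by exact: cvgD (cE u) (cE (- u)).
rewrite -(cvg_lim (@Rhausdorff R) cu).
apply: limr_le; first by apply/cvg_ex; eexists; exact: cu.
near=> N => /=.
pose t k := exp_coeff u k + exp_coeff (- u) k.
have tE (k : nat) : t k = (1 + (-1) ^+ k) * u ^+ k / k`!%:R.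
  by rewrite /t /exp_coeff /= [in LHS]exprNn -mulrDl -{1}[u ^+ k]mul1r -mulrDl.
have t0 k : 0 <= t k.
  rewrite tE; apply: divr_ge0 => //; rewrite -signr_odd.
  have [ok|ek] := boolP (odd k); first by rewrite expr1 subrr mul0r.
  apply: mulr_ge0; first by rewrite expr0; lra.
  by apply: real_exprn_even_ge0; rewrite ?num_real// .
have -> : series (exp_coeff u) N + series (exp_coeff (- u)) N = \sum_(0 <= k < N) t k.
  by rewrite /series /= -big_split.
(* Odd terms vanish and the even term [2 j] is at most twice the term [j] of the series of
   [exp (u^2 / 2)], so [n.*2] terms on the left are matched with [n] on the right. *)
have dbl n : \sum_(0 <= k < n.*2) t k <= 2 * \sum_(0 <= j < n) exp_coeff (u ^+ 2 / 2) j.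
  elim: n => [|n IH]; first by rewrite !big_geq// mulr0.
  rewrite doubleS !big_nat_recr//= mulrDr -addrA lerD//.
  have -> : t n.*2.+1 = 0 by rewrite tE -signr_odd /= odd_double /= expr1 subrr !mul0r.
  have -> : t n.*2 = 2 * u ^+ n.*2 / (n.*2)`!%:R by rewrite tE -signr_odd odd_double.
  rewrite addr0.
  rewrite -mulrA ler_wpM2l// /exp_coeff /= -mul2n exprM expr_div_n.
  rewrite -mulrA ler_wpM2l ?(exprn_ge0 _ (sqr_ge0 u))//.
  rewrite -invfM lef_pV2 ?posrE ?mulr_gt0 ?exprn_gt0 ?ltr0n ?fact_gt0//.
  by rewrite -natrX -natrM ler_nat mul2n expn2_fact_le.
(* Terms are nonnegative, so the partial sum may be extended to the even length [N.*2]. *)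
apply: (@le_trans _ _ (\sum_(0 <= k < N.*2) t k)).
  rewrite (@big_cat_nat _ _ _ N 0 N.*2)//= ?lerDl ?sumr_ge0// .
  by rewrite -addnn leq_addr.
apply: le_trans (dbl N) _; rewrite ler_wpM2l//.
have nd : nondecreasing_seq (series (exp_coeff (u ^+ 2 / 2))).
  by apply: nondecreasing_series => k _ _; apply: exp_coeff_ge0; rewrite divr_ge0 ?sqr_ge0.
exact: (nondecreasing_cvgn_le nd (is_cvg_series_exp_coeff _) N).
Unshelve. all: by end_near.
Qed.

End ScalarBounds.

(** * Conditional laws *)

Section Density.
Local Open Scope ereal_scope.
Context d (T : measurableType d) (R : realType) (nu : {measure set T -> \bar R}).
Variable g : T -> R.
Hypotheses (mg : measurable_fun setT g) (g0 : forall x, (0 <= g x)%R).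

Lemma density_measure_exists :
  exists m : {measure set T -> \bar R}, forall A, m A = \int[nu]_(x in A) (g x)%:E.
Proof.
pose m A := \int[nu]_(x in A) (g x)%:E.
have m_0 : m set0 = 0 by rewrite /m integral_set0.
have m_ge0 A : 0 <= m A by apply: integral_ge0 => x _; rewrite lee_fin.
have m_sigma : semi_sigma_additive m.
  move=> F mF tF mUF; rewrite /m ge0_integral_bigcup//; last first.
  - by move=> x _; rewrite lee_fin.
  - by apply/measurable_EFinP; exact: measurable_funTS.
  apply: is_cvg_ereal_nneg_natsum_cond => n _ _.
  by apply: integral_ge0 => x _; rewrite lee_fin.
pose mm : {measure set T -> \bar R} := HB.pack m
  (isMeasure.Build _ _ _ m m_0 m_ge0 m_sigma).
by exists mm.
Qed.

Import HBNNSimple.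

(** Simple functions first, then monotone convergence on both sides along the same approximating
    sequence. *)
Lemma integral_density (m : {measure set T -> \bar R}) (f : T -> \bar R) :
  (forall A, measurable A -> m A = \int[nu]_(x in A) (g x)%:E) ->
  measurable_fun setT f -> (forall x, 0 <= f x) ->
  \int[m]_x f x = \int[nu]_x (f x * (g x)%:E).
Proof.
move=> mE mf f0.
have mge : measurable_fun setT (EFin \o g) by exact/measurable_EFinP.
pose h := nnsfun_approx measurableT mf.
have -> : \int[m]_x f x = lim (\int[m]_x (EFin \o h n) x @[n --> \oo]).
  have fE x : f x = lim ((EFin \o h n) x @[n --> \oo]).
    by apply/esym/cvg_lim => //; exact: cvg_nnsfun_approx.
  under eq_integral => x _ do rewrite fE.
  apply: monotone_convergence => //.
  - by move=> n; exact/measurable_EFinP.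
  - by move=> n x _; rewrite lee_fin.
  - by move=> x _ a b ab; rewrite lee_fin; exact/lefP/nd_nnsfun_approx.
have -> : \int[nu]_x (f x * (g x)%:E) =
    lim (\int[nu]_x ((EFin \o h n) \* (EFin \o g)) x @[n --> \oo]).
  have fg x : f x * (g x)%:E = lim (((EFin \o h n) \* (EFin \o g)) x @[n --> \oo]).
    by apply/esym/cvg_lim => //; apply: cvgeZr => //; exact: cvg_nnsfun_approx.
  under eq_integral => x _ do rewrite fg.
  apply: monotone_convergence => //.
  - by move=> n; apply: emeasurable_funM => //; exact/measurable_EFinP.
  - by move=> n x _ /=; rewrite mule_ge0 ?lee_fin.
  - by move=> x _ a b ab/=; rewrite lee_wpmul2r ?lee_fin//; exact/lefP/nd_nnsfun_approx.
suff suf n : \int[nu]_x ((EFin \o h n) x * (g x)%:E) = \int[m]_x (EFin \o h n) x.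
  by under [in RHS]eq_fun do rewrite suf.
transitivity (\int[m]_x
   (\sum_(y \in range (h n)) (y * \1_(h n @^-1` [set y]) x)%:E)); last first.
  by apply: eq_integral => t tE; rewrite /= fimfunE -fsumEFin.
have indich k r : measurable_fun setT (fun x => (r * \1_(h k @^-1` [set r]) x)%:E).
  by apply: (measurable_comp measurableT) => //; exact: measurable_funM.
rewrite ge0_integral_fsum//; last by move=> k y Ey; exact: nnfun_muleindic_ge0.
transitivity (\int[nu]_x (\sum_(y \in range (h n))
    (y * \1_(h n @^-1` [set y]) x)%:E * (g x)%:E)).
  under [RHS]eq_integral => x xE.
    rewrite -ge0_mule_fsuml => [|y]; last exact: nnfun_muleindic_ge0.
    rewrite fsumEFin // -(fimfunE _ x); over.
  by [].
rewrite ge0_integral_fsum//; last 2 first.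
  - by move=> y; apply: emeasurable_funM.
  - by move=> k y Ey; apply: mule_ge0; [exact: nnfun_muleindic_ge0|rewrite lee_fin].
apply: eq_fsbigr => r rhn.
under [RHS]eq_integral do rewrite EFinM.
rewrite integralZl_indic_nnsfun => //.
under eq_integral do rewrite EFinM -muleA.
rewrite ge0_integralZl//.
- under eq_integral do rewrite muleC.
  rewrite (eq_integral ((EFin \o g) \_ (h n @^-1` [set r]))); last first.
    by move=> x xE; rewrite epatch_indic.
  by rewrite -integral_mkcond -mE// integral_indic// setIT.
- by apply: emeasurable_funM => //; exact/measurable_EFinP.
- by move=> t Et; rewrite mule_ge0 ?lee_fin.
- by move: rhn; rewrite inE => -[t _ <-]; rewrite lee_fin.
Qed.

End Density.

(** Tonelli's theorem wants sigma-finiteness bundled with the measure, while the MDP has a plain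
    measure with a hypothesis; integrals are moved to this copy and back. *)
Lemma sigma_finite_measure_exists d (T : measurableType d) (R : realType)
    (mu : {measure set T -> \bar R}) : sigma_finite setT mu ->
  exists m : {sigma_finite_measure set T -> \bar R}, forall A, m A = mu A.
Proof.
move=> sf.
pose H2 := isSFinite.Build _ _ _ _ (sfinite_measure_sigma_finite sf).
pose H3 := isSigmaFinite.Build _ _ _ _ sf.
pose m := HB.pack_for (SigmaFiniteMeasure.type T R) (Measure.sort mu) H2 H3.
by exists m.
Qed.

Section ConditionalLaw.
Local Open Scope ereal_scope.
Context dO (Omega : measurableType dO) (R : realType) (P : probability Omega R).
Context dT (T : measurableType dT) dS (S : measurableType dS).
Variables (mu : {measure set S -> \bar R}) (musf : sigma_finite setT mu).
Variables (X : Omega -> T) (Y : Omega -> S) (rho : T * S -> R).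
Hypotheses (mX : measurable_fun setT X) (mY : measurable_fun setT Y).
Hypotheses (mrho : measurable_fun setT rho) (rho0 : forall z, (0 <= rho z)%R).
Hypothesis XY_law : forall E B, measurable E -> measurable B ->
  P (X @^-1` E `&` Y @^-1` B) =
  \int[P]_(o in X @^-1` E) \int[mu]_(x in B) (rho (X o, x))%:E.

(** The law of [(X, Y)] and the image under [h] of the measure with density [rho \o h] for [P] times
    [mu] are finite and agree on rectangles, by [XY_law] and Tonelli. Rectangles are closed under
    intersection and generate the product sigma-algebra, so the two measures coincide. *)
Lemma integral_conditional_law (f : T * S -> \bar R) :
  measurable_fun setT f -> (forall z, 0 <= f z) ->
  \int[P]_o f (X o, Y o) = \int[P]_o \int[mu]_x (f (X o, x) * (rho (X o, x))%:E).
Proof.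
move=> mf f0.
have [mus musE] := sigma_finite_measure_exists musf.
have intE (D : set S) (F : S -> \bar R) : \int[mu]_(x in D) F x = \int[mus]_(x in D) F x.
  by apply: eq_measure_integral => A _ _; exact/esym/musE.
pose h (z : Omega * S) : T * S := (X z.1, z.2).
have mh : measurable_fun setT h.
  apply: measurable_fun_pair; last exact: measurable_snd.
  by apply: measurableT_comp mX _; exact: measurable_fst.
pose XY o := (X o, Y o).
have mXY : measurable_fun setT XY by exact: measurable_fun_pair.
have mrh : measurable_fun setT (rho \o h) by apply: measurableT_comp.
have [m mE] := @density_measure_exists _ _ _ (P \x mus) (rho \o h) mrh (fun z => rho0 _).
pose mfXY : {mfun Omega >-> (T * S)%type} := HB.pack XY (isMeasurableFun.Build _ _ _ _ _ mXY).
pose mfh : {mfun (Omega * S)%type >-> (T * S)%type} := HB.pack h (isMeasurableFun.Build _ _ _ _ _ mh).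
have QE A : measurable A -> pushforward P mfXY A = pushforward m mfh A.
  apply: (@measure_unique _ R (T * S)%type
   [set A `*` B | A in measurable & B in measurable] (fun _ => setT)
   _ _ _ _ (pushforward P mfXY) (pushforward m mfh)) => //.
  - exact: measurable_prod_measurableType.
  - move=> _ _ [A1 mA1 [A2 mA2 <-]] [B1 mB1 [B2 mB2 <-]].
    exists (A1 `&` B1); first exact: measurableI.
    exists (A2 `&` B2); first exact: measurableI.
    by rewrite setXI.
  - by move=> _; exists setT => //; exists setT => //; rewrite setXTT.
  - by rewrite bigcup_const.
  - move=> _ [E mE' [B mB <-]]; rewrite /pushforward.
    rewrite [LHS](_ : _ = P (X @^-1` E `&` Y @^-1` B))//.
    rewrite [RHS](_ : _ = m ((X @^-1` E) `*` B))//.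
    rewrite XY_law// mE.
    have mXE : measurable (X @^-1` E) by rewrite -[X in measurable X]setTI; exact: mX.
    have mR : measurable (X @^-1` E `*` B) by exact: measurableX.
    rewrite [RHS]integral_mkcond fubini_tonelli1; last 2 first.
    - apply: (measurable_restrictT _ mR).1; apply: measurable_funTS.
      exact/measurable_EFinP.
    - by move=> z; rewrite /patch; case: ifP => // _; rewrite lee_fin; exact: rho0.
    rewrite [LHS]integral_mkcond; apply: eq_integral => o _.
    rewrite /fubini_F /patch; case: ifPn => oE.
      transitivity (\int[mus]_x ((fun x => (rho (X o, x))%:E) \_ B) x).
        by rewrite -integral_mkcond -intE.
      apply: eq_integral => x _; rewrite /patch; congr (if _ then _ else _).
      by apply/idP/idP; rewrite !inE /=; [split => //; rewrite inE in oE|case].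
    rewrite integral0_eq// => x _; rewrite ifF//; apply/negbTE/negP.
    by move=> /set_mem[/= h1 _]; move/negP: oE; apply; exact/mem_set.
  - move=> _; rewrite [ltLHS](_ : _ = P setT); last by congr (P _).
    by rewrite probability_setT ltry.
have pf (F : T * S -> \bar R) : measurable_fun setT F -> (forall z, 0 <= F z) ->
    \int[P]_o F (XY o) = \int[m]_z F (h z).
  move=> mF F0.
  transitivity (\int[pushforward P mfXY]_z F z).
    by rewrite ge0_integral_pushforward// preimage_setT.
  transitivity (\int[pushforward m mfh]_z F z).
    by apply: eq_measure_integral => A mA _; exact: QE.
  by rewrite ge0_integral_pushforward// preimage_setT.
rewrite (pf f)//.
have -> : \int[m]_z f (h z) = \int[P \x mus]_z (f (h z) * (rho (h z))%:E).
  exact: (@integral_density _ _ _ (P \x mus) (rho \o h) mrh (fun z => rho0 _) m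
    (f \o h) (fun A _ => mE A) (measurableT_comp mf mh) (fun z => f0 _)).
rewrite fubini_tonelli1; last 2 first.
- apply: emeasurable_funM; first exact: (measurableT_comp mf mh).
  exact/measurable_EFinP.
- by move=> z; rewrite mule_ge0// lee_fin.
by apply: eq_integral => o _; rewrite intE.
Qed.

End ConditionalLaw.

(** * Measurability *)

Section MatrixMeasurability.
Context {R : realType} {dT : measure_display} {T : measurableType dT}.

Definition measurable_mx {m n} (M : T -> 'M[R]_(m, n)) : Prop :=
  forall i j, measurable_fun setT (fun t => M t i j).

Lemma measurable_mx_cst m n (M : 'M[R]_(m, n)) : measurable_mx (fun=> M).
Proof. by move=> i j; exact: measurable_cst. Qed.

Lemma measurable_mxD m n (M N : T -> 'M[R]_(m, n)) :
  measurable_mx M -> measurable_mx N -> measurable_mx (fun t => M t + N t).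
Proof.
move=> mM mN i j; under eq_fun do rewrite mxE; exact: measurable_funD.
Qed.

Lemma measurable_mx_sum (I : Type) (s : seq I) m n (M : I -> T -> 'M[R]_(m, n)) :
  (forall i, measurable_mx (M i)) -> measurable_mx (fun t => \sum_(i <- s) M i t).
Proof.
move=> mM i j; under eq_fun do rewrite summxE.
by apply: measurable_sum => k; exact: mM.
Qed.

Lemma measurable_mx_tr m n (M : T -> 'M[R]_(m, n)) :
  measurable_mx M -> measurable_mx (fun t => (M t)^T).
Proof. by move=> mM i j; under eq_fun do rewrite mxE; exact: mM. Qed.

Lemma measurable_mxM m n p (M : T -> 'M[R]_(m, n)) (N : T -> 'M[R]_(n, p)) :
  measurable_mx M -> measurable_mx N -> measurable_mx (fun t => M t *m N t).
Proof.
move=> mM mN i j; under eq_fun do rewrite mxE.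
by apply: measurable_sum => k; exact: measurable_funM.
Qed.

Lemma measurable_mxZ m n (a : T -> R) (M : T -> 'M[R]_(m, n)) :
  measurable_fun setT a -> measurable_mx M -> measurable_mx (fun t => a t *: M t).
Proof.
move=> ma mM i j; under eq_fun do rewrite mxE; exact: measurable_funM.
Qed.

Lemma measurable_det n (M : T -> 'M[R]_n) :
  measurable_mx M -> measurable_fun setT (fun t => \det (M t)).
Proof.
move=> mM; rewrite /determinant; apply: measurable_sum => s.
by apply: measurable_funM => //; apply: measurable_prod => i _; exact: mM.
Qed.

(** The inverse is discontinuous at 0, so it is written piecewise through [expR] and [ln]. *)
Lemma measurable_invr : measurable_fun setT (GRing.inv : R -> R).
Proof.
have -> : (GRing.inv : R -> R) = (fun x => if x == 0 then 0 else
    if 0 < x then expR (- ln x) else - expR (- ln (- x))).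
  apply/funext => x; case: eqP => [->|/eqP x0]; first by rewrite invr0.
  case: ifPn => [xp|]; first by rewrite expRN lnK.
  rewrite -leNgt le_eqVlt (negbTE x0) /= => xn.
  by rewrite expRN lnK ?posrE ?oppr_gt0// invrN opprK.
apply: measurable_fun_ifT => //.
  by apply: measurable_fun_eqr.
apply: measurable_fun_ifT => //; first exact: measurable_fun_ltr.
  apply: measurableT_comp; first exact: measurable_expR.
  by apply: measurableT_comp => //; exact: measurable_ln.
apply: measurableT_comp => //.
apply: measurableT_comp; first exact: measurable_expR.
apply: measurableT_comp => //; apply: measurableT_comp => //; exact: measurable_ln.
Qed.

Lemma measurable_funV (f : T -> R) :
  measurable_fun setT f -> measurable_fun setT (fun t => (f t)^-1).
Proof. by move=> mf; exact: measurableT_comp measurable_invr mf. Qed.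

Lemma measurable_sqrtr (f : T -> R) :
  measurable_fun setT f -> measurable_fun setT (fun t => Num.sqrt (f t)).
Proof.
move=> mf; apply: (measurableT_comp _ mf).
by apply: nondecreasing_measurable => // x y *; exact: ler_wsqrtr.
Qed.

Lemma measurable_invmx n (M : T -> 'M[R]_n) :
  measurable_mx M -> measurable_mx (fun t => invmx (M t)).
Proof.
move=> mM i j; have mdet := measurable_det mM.
(* Off the singular matrices this is the cofactor formula; on a singular matrix [invmx] returns the
   matrix itself. *)
have -> : (fun t => invmx (M t) i j) = (fun t => if \det (M t) == 0 then M t i j
    else (\det (M t))^-1 * cofactor (M t) j i).
  apply/funext => t; rewrite /invmx unitmxE unitfE; case: eqP => //= _.
  by rewrite !mxE.
apply: measurable_fun_ifT => //; first exact: measurable_fun_eqr.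
apply: measurable_funM; first exact: measurable_funV.
rewrite /cofactor; apply: measurable_funM => //; apply: measurable_det => k l.
by under eq_fun do rewrite !mxE; exact: mM.
Qed.

Lemma measurable_dotv n (x y : T -> 'cV[R]_n) : measurable_mx x -> measurable_mx y ->
  measurable_fun setT (fun t => dotv (x t) (y t)).
Proof.
by move=> mx my; apply: measurable_mxM => //; exact: measurable_mx_tr.
Qed.

Lemma measurable_qf n (M : T -> 'M[R]_n) (x : T -> 'cV[R]_n) :
  measurable_mx M -> measurable_mx x -> measurable_fun setT (fun t => qf (M t) (x t)).
Proof. by move=> mM mx; apply: measurable_dotv => //; exact: measurable_mxM. Qed.

Lemma measurable_mxnorm n (M : T -> 'M[R]_n) (x : T -> 'cV[R]_n) :
  measurable_mx M -> measurable_mx x -> measurable_fun setT (fun t => mxnorm (M t) (x t)).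
Proof.
move=> mM mx; under eq_fun do rewrite mxnormE.
by apply: measurable_sqrtr; exact: measurable_qf.
Qed.

End MatrixMeasurability.

Lemma measurable_mx_comp (R : realType) d1 d2 (T1 : measurableType d1)
    (T2 : measurableType d2) m n (M : T2 -> 'M[R]_(m, n)) (f : T1 -> T2) :
  measurable_fun setT f -> measurable_mx M -> measurable_mx (M \o f).
Proof. by move=> mf mM i j; exact: (measurableT_comp (mM i j) mf). Qed.

Section FiniteValued.
Context {R : realType} {dT : measure_display} {T : measurableType dT} {A : finType}.

(** The finite type [A] carries no sigma-algebra; measurability is asked fibre by fibre, as in
    [measurable_policy]. *)
Definition measurable_fibers (f : T -> A) : Prop :=
  forall a, measurable (f @^-1` [set a]).

Lemma measurable_fun_fibers (f : T -> A) (g : A -> T -> R) : measurable_fibers f ->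
  (forall a, measurable_fun setT (g a)) -> measurable_fun setT (fun t => g (f t) t).
Proof.
move=> mf mg.
have -> : (fun t => g (f t) t) = (fun t => \sum_(a : A) \1_(f @^-1` [set a]) t * g a t).
  apply/funext => t; rewrite (bigD1 (f t))//= indicE mem_set// mul1r big1 ?addr0//.
  move=> a af; rewrite indicE memNset ?mul0r//= => /esym/eqP.
  by rewrite (negbTE af).
by apply: measurable_sum => a; apply: measurable_funM => //; exact: measurable_indic.
Qed.

(** The picked element is a function of the set of all actions that satisfy the predicate. There are
    finitely many such sets, and each is cut out by finitely many measurable conditions, so
    tie-breaking is measurable. *)
Lemma measurable_fibers_pick (a0 : A) (p : T -> pred A) :
  (forall a, measurable [set t | p t a]) ->
  measurable_fibers (fun t => odflt a0 [pick a | p t a]).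
Proof.
move=> mp a.
have -> : (fun t => odflt a0 [pick a | p t a]) @^-1` [set a] =
    \bigcup_(B in [set B : {set A} | odflt a0 [pick a | a \in B] = a])
      \bigcap_(b in [set: A]) [set t | p t b = (b \in B)].
  apply/seteqP; split => t /=.
    move=> tE; exists [set b | p t b]%SET => [/=|b _ /=]; last by rewrite inE.
    by rewrite -tE; congr (odflt _ _); apply: eq_pick => b; rewrite inE.
  move=> [B /= BE tB]; rewrite -BE; congr (odflt _ _); apply: eq_pick => b.
  exact: (tB b).
apply: fin_bigcup_measurable => // B _.
apply: fin_bigcap_measurable => // b _.
case: (b \in B); first exact: mp.
have -> : [set t | p t b = false] = ~` [set t | p t b].
  by apply/seteqP; split => t /=; [move=> -> | move/negP/negbTE].
exact: measurableC.
Qed.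

Lemma measurable_bigmaxr (x0 : T -> R) (Q : A -> T -> R) : measurable_fun setT x0 ->
  (forall a, measurable_fun setT (Q a)) ->
  measurable_fun setT (fun t => \big[Num.max/x0 t]_(a : A) Q a t).
Proof.
move=> m0 mQ; elim: (index_enum A) => [|a s IH].
  by under eq_fun do rewrite big_nil.
under eq_fun do rewrite big_cons; exact: measurable_maxr.
Qed.

End FiniteValued.

Section ParametrizedIntegral.
Context {R : realType} {dS : measure_display} {S : measurableType dS}
  (mu : {measure set S -> \bar R}) (musf : sigma_finite setT mu).

(** Tonelli treats the positive and negative parts separately, and [Rintegral] is [fine] of their
    difference, so sections that fail to be integrable are covered as well. *)
Lemma measurable_Rintegral_param dT (T : measurableType dT) (f : T * S -> R) :
  measurable_fun setT f ->
  measurable_fun setT (fun t => Rintegral mu setT (fun x => f (t, x))).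
Proof.
move=> mf; have [mus musE] := sigma_finite_measure_exists musf.
have mfe : measurable_fun setT (EFin \o f) by exact/measurable_EFinP.
have -> : (fun t => Rintegral mu setT (fun x => f (t, x))) =
   fine \o (fun t => fubini_F mus ((EFin \o f)^\+)%E t - fubini_F mus ((EFin \o f)^\-)%E t)%E.
  apply/funext => t /=; rewrite /Rintegral; congr fine.
  transitivity (\int[mus]_x (f (t, x))%:E)%E.
    by apply: eq_measure_integral => B _ _; exact/esym/musE.
  rewrite [LHS]integralE /fubini_F.
  congr (_ - _)%E; apply: eq_integral => x _; first by rewrite !funeposE.
  by rewrite !funenegE.
apply: measurableT_comp; first exact: fine_measurable.
apply: emeasurable_funB.
- by apply: measurable_fun_fubini_tonelli_F => //; exact: measurable_funepos.
- by apply: measurable_fun_fubini_tonelli_F => //; exact: measurable_funeneg.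
Qed.

End ParametrizedIntegral.

Section AlgorithmMeasurability.
Context {R : realType} {dS : measure_display} {S : measurableType dS}
  (mu : {measure set S -> \bar R}) (musf : sigma_finite setT mu) {A : finType} {d : nat}.
Variables (phi : S -> A -> S -> 'cV[R]_d) (H : nat) (r : nat -> S -> A -> R).
Hypothesis mr : forall h a, measurable_fun setT (fun x => r h x a).
Hypothesis mphi : forall a i, measurable_fun setT (fun x : S * S => phi x.1 a x.2 i 0).

(** An estimated value function depends on the past, here the parameter [t], and is both integrated
    over states and evaluated at a random state; measurability of each section would not suffice. *)
Definition jointly_measurable {dT} {T : measurableType dT} (V : T -> S -> R) : Prop :=
  measurable_fun setT (fun z : T * S => V z.1 z.2).

Lemma jointly_measurable_comp d1 (T1 : measurableType d1) d2 (T2 : measurableType d2)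
    (V : T2 -> S -> R) (f : T1 -> T2) : measurable_fun setT f ->
  jointly_measurable V -> jointly_measurable (V \o f).
Proof.
move=> mf mV.
have mh : measurable_fun setT (fun z : T1 * S => (f z.1, z.2)).
  apply: measurable_fun_pair; last exact: measurable_snd.
  exact: (measurableT_comp mf measurable_fst).
exact: (measurableT_comp mV mh).
Qed.

Lemma jointly_measurable_diag dT (T : measurableType dT) (V : T -> S -> R) (xs : T -> S) :
  jointly_measurable V -> measurable_fun setT xs ->
  measurable_fun setT (fun t => V t (xs t)).
Proof.
move=> mV mxs.
have mh : measurable_fun setT (fun t : T => (t, xs t)) by exact: measurable_fun_pair.
exact: (measurableT_comp mV mh).
Qed.

Lemma jointly_measurable_section dT (T : measurableType dT) (V : T -> S -> R) t :
  jointly_measurable V -> measurable_fun setT (V t).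
Proof. by move=> mV; exact: (measurableT_comp mV (pair1_measurable t)). Qed.

Section Param.
Context dT (T : measurableType dT).
Variables (xs : T -> S) (V : T -> S -> R).
Hypotheses (mxs : measurable_fun setT xs) (mV : jointly_measurable V).

Let mxs1 : measurable_fun setT (fun z : T * S => (xs z.1, z.2)).
Proof.
apply: measurable_fun_pair; last exact: measurable_snd.
exact: (measurableT_comp mxs measurable_fst).
Qed.

Lemma measurable_phi_v a : measurable_mx (fun t => phi_v mu phi (V t) (xs t) a).
Proof.
move=> i j; under eq_fun do rewrite mxE.
apply: (measurable_Rintegral_param musf (f := fun z => phi (xs z.1) a z.2 i 0 * V z.1 z.2)).
apply: measurable_funM => //.
exact: (measurableT_comp (mphi a i) mxs1).
Qed.

Lemma measurable_trans_dens wh a :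
  measurable_fun setT (fun z : T * S => trans_dens phi wh (xs z.1) a z.2).
Proof.
apply: measurable_dotv; last exact: measurable_mx_cst.
move=> i j; rewrite (ord1 j); exact: (measurableT_comp (mphi a i) mxs1).
Qed.

Lemma measurable_Qtil (Lam : T -> 'M[R]_d) (wt : T -> 'cV[R]_d) b h a :
  measurable_mx Lam -> measurable_mx wt ->
  measurable_fun setT (fun t => Qtil mu phi H r (Lam t) (wt t) b h (V t) (xs t) a).
Proof.
move=> mL mw; apply: measurable_minr; first exact: measurable_cst.
apply: measurable_funD.
  apply: measurable_funD; first exact: (measurableT_comp (mr h a) mxs).
  by apply: measurable_dotv => //; exact: measurable_phi_v.
apply: measurable_funM; first exact: measurable_cst.
by apply: measurable_mxnorm; [exact: measurable_invmx|exact: measurable_phi_v].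
Qed.

End Param.

Lemma jointly_measurable_Vtil_aux dT (T : measurableType dT) (a0 : A)
    (Lam : T -> nat -> 'M[R]_d) (wt : T -> nat -> 'cV[R]_d) b n h :
  (forall j, (h <= j < h + n)%N -> measurable_mx (Lam^~ j)) ->
  (forall j, (h <= j < h + n)%N -> measurable_mx (wt^~ j)) ->
  jointly_measurable (fun t => Vtil_aux mu phi H r a0 (Lam t) (wt t) b n h).
Proof.
elim: n h => [|n IH] h mL mw; first exact: measurable_cst.
have mV : jointly_measurable (fun t => Vtil_aux mu phi H r a0 (Lam t) (wt t) b n h.+1).
  by apply: IH => j /andP[hj jn]; [apply: mL|apply: mw]; rewrite (ltnW hj) addnS -addSn.
have mQ a : measurable_fun setT (fun z : T * S => Qtil mu phi H r (Lam z.1 h) (wt z.1 h) b h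
    (Vtil_aux mu phi H r a0 (Lam z.1) (wt z.1) b n h.+1) z.2 a).
  have hh : (h <= h < h + n.+1)%N by rewrite leqnn -addSnnS leq_addr.
  apply: (@measurable_Qtil _ (T * S)%type snd
    (fun z => Vtil_aux mu phi H r a0 (Lam z.1) (wt z.1) b n h.+1)).
  - exact: measurable_snd.
  - exact: (jointly_measurable_comp measurable_fst mV).
  - exact: (measurable_mx_comp measurable_fst (mL h hh)).
  - exact: (measurable_mx_comp measurable_fst (mw h hh)).
exact: measurable_bigmaxr.
Qed.

Lemma measurable_fibers_greedy dT (T : measurableType dT) (a0 : A)
    (Lam : T -> nat -> 'M[R]_d) (wt : T -> nat -> 'cV[R]_d) b h :
  (forall j, (h <= j <= H)%N -> measurable_mx (Lam^~ j)) ->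
  (forall j, (h <= j <= H)%N -> measurable_mx (wt^~ j)) -> (h <= H)%N ->
  measurable_fibers (fun z : T * S => greedy mu phi H r a0 (Lam z.1) (wt z.1) b h z.2).
Proof.
move=> mL mw hH; rewrite /greedy; apply: measurable_fibers_pick => a.
have mV : jointly_measurable (fun t => Vtil mu phi H r a0 (Lam t) (wt t) b h.+1).
  by apply: jointly_measurable_Vtil_aux => j; rewrite subSS addSn subnKC// ltnS =>
    /andP[hj jH]; [apply: mL|apply: mw]; rewrite jH (ltnW hj).
have mQ a' : measurable_fun setT (fun z : T * S => Qtil mu phi H r (Lam z.1 h) (wt z.1 h) b h
    (Vtil mu phi H r a0 (Lam z.1) (wt z.1) b h.+1) z.2 a').
  have hh : (h <= h <= H)%N by rewrite leqnn.
  apply: (@measurable_Qtil _ (T * S)%type snd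
    (fun z => Vtil mu phi H r a0 (Lam z.1) (wt z.1) b h.+1)).
  - exact: measurable_snd.
  - exact: (jointly_measurable_comp measurable_fst mV).
  - exact: (measurable_mx_comp measurable_fst (mL h hh)).
  - exact: (measurable_mx_comp measurable_fst (mw h hh)).
rewrite (_ : [set _ | _] = \bigcap_(a' in [set: A]) [set z : T * S |
    Qtil mu phi H r (Lam z.1 h) (wt z.1 h) b h
      (Vtil mu phi H r a0 (Lam z.1) (wt z.1) b h.+1) z.2 a' <=
    Qtil mu phi H r (Lam z.1 h) (wt z.1 h) b h
      (Vtil mu phi H r a0 (Lam z.1) (wt z.1) b h.+1) z.2 a]); last first.
  apply/seteqP; split => z /=; first by move=> /forallP h1 a' _; exact: h1.
  by move=> h1; apply/forallP => a'; exact: h1.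
apply: fin_bigcap_measurable => // a' _.
have := measurable_fun_ler (mQ a') (mQ a) measurableT (Y := [set true]) I.
by rewrite setTI.
Qed.

Lemma jointly_measurable_Vpi_aux dT (T : measurableType dT) (w : nat -> 'cV[R]_d)
    (pi : T -> nat -> S -> A) n h :
  (forall j, (h <= j < h + n)%N -> measurable_fibers (fun z : T * S => pi z.1 j z.2)) ->
  jointly_measurable (fun t => Vpi_aux mu phi r w (pi t) n h).
Proof.
elim: n h => [|n IH] h mpi; first exact: measurable_cst.
have mV : jointly_measurable (fun t => Vpi_aux mu phi r w (pi t) n h.+1).
  by apply: IH => j /andP[hj jn]; apply: mpi; rewrite (ltnW hj) addnS -addSn.
have hh : (h <= h < h + n.+1)%N by rewrite leqnn -addSnnS leq_addr.
have := @measurable_fun_fibers R _ (T * S)%type A (fun z => pi z.1 h z.2)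
  (fun a z => r h z.2 a + Rintegral mu setT (fun s' => trans_dens phi (w h) z.2 a s' *
     Vpi_aux mu phi r w (pi z.1) n h.+1 s')) (mpi h hh).
apply => a; apply: measurable_funD.
  exact: (measurableT_comp (mr h a) measurable_snd).
apply: (measurable_Rintegral_param musf (f := fun z : (T * S) * S =>
  trans_dens phi (w h) z.1.2 a z.2 * Vpi_aux mu phi r w (pi z.1.1) n h.+1 z.2)).
apply: measurable_funM.
  exact: (@measurable_trans_dens _ (T * S)%type snd).
exact: (jointly_measurable_comp measurable_fst mV).
Qed.

End AlgorithmMeasurability.

Lemma ler_norm_bounds (R : realDomainType) (a b c : R) :
  a <= c <= b -> `|c| <= `|a| + `|b|.
Proof.
move=> /andP[ac cb]; have := ler_norm b; have := ler_norm (- a).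
have := normr_ge0 a; have := normr_ge0 b.
by rewrite normrN ler_norml => ? ? ? ?; apply/andP; split; lra.
Qed.

(** * Supermartingales *)

Section ProbabilityDensity.
Context {R : realType} {dS : measure_display} {S : measurableType dS}
  (mu : {measure set S -> \bar R}).
Variable rho : S -> R.
Hypotheses (mrho : measurable_fun setT rho) (rho0 : forall x, 0 <= rho x).
Hypothesis rho1 : (\int[mu]_x (rho x)%:E = 1)%E.
Implicit Types (v : S -> R).

Definition mean v : R := Rintegral mu setT (fun x => rho x * v x).

Lemma density_integrable : mu.-integrable setT (EFin \o rho).
Proof.
apply/integrableP; split; first exact/measurable_EFinP.
under eq_integral => x _ do rewrite /= ger0_norm//.
by rewrite rho1 ltry.
Qed.

Lemma density_mul_integrable v c : measurable_fun setT v -> (forall x, `|v x| <= c) ->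
  mu.-integrable setT (EFin \o (fun x => rho x * v x)).
Proof.
move=> mv vc; apply: (@le_integrable _ _ _ mu _ measurableT _ (fun x => (c * rho x)%:E)).
- by apply/measurable_EFinP; exact: measurable_funM.
- move=> x _ /=; rewrite lee_fin normrM (ger0_norm (rho0 x)) mulrC.
  apply: le_trans (ler_norm _); exact: ler_wpM2r.
- have -> : (fun x => (c * rho x)%:E) = (fun x => c%:E * (EFin \o rho) x)%E by [].
  by apply: integrableZl => //; exact: density_integrable.
Qed.

Lemma mean_le v1 v2 c : measurable_fun setT v1 -> measurable_fun setT v2 ->
  (forall x, `|v1 x| <= c) -> (forall x, `|v2 x| <= c) ->
  (forall x, v1 x <= v2 x) -> mean v1 <= mean v2.
Proof.
move=> m1 m2 b1 b2 h; apply: le_Rintegral => //.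
- exact: (density_mul_integrable m1 b1).
- exact: (density_mul_integrable m2 b2).
- by move=> x _; exact: ler_wpM2l.
Qed.

Lemma mean_cst c : mean (fun=> c) = c.
Proof.
rewrite /mean RintegralZr//; last exact: density_integrable.
by rewrite /Rintegral rho1 mul1r.
Qed.

Lemma mean_bounds v a b : measurable_fun setT v -> (forall x, a <= v x <= b) ->
  a <= mean v <= b.
Proof.
move=> mv h.
have hv x : `|v x| <= `|a| + `|b| by exact: ler_norm_bounds.
have [ab|ba] := leP a b.
  rewrite -{1}[a]mean_cst -[b]mean_cst; apply/andP; split;
    apply: (@mean_le _ _ (`|a| + `|b|)) => // x; try by have /andP[] := h x.
  - by apply: ler_norm_bounds; rewrite lexx ab.
  - by apply: ler_norm_bounds; rewrite lexx ab.
(* If [b < a] the bounds are contradictory at every state, and [point] is a state. *)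
exfalso; have noS : forall x : S, False.
  by move=> x; have /andP[h1 h2] := h x; have := le_trans h1 h2; rewrite leNgt ba.
exact: (noS point).
Qed.

Lemma meanB v1 v2 c : measurable_fun setT v1 -> measurable_fun setT v2 ->
  (forall x, `|v1 x| <= c) -> (forall x, `|v2 x| <= c) ->
  mean (fun x => v1 x - v2 x) = mean v1 - mean v2.
Proof.
move=> m1 m2 b1 b2; rewrite /mean -RintegralB//.
- by apply: eq_Rintegral => x _; rewrite mulrBr.
- exact: (density_mul_integrable m1 b1).
- exact: (density_mul_integrable m2 b2).
Qed.

(** The exponential is replaced by its chord over [[-c, c]], the range of the centred variable; the
    linear term has mean zero and [cosh (t c)] remains. The resulting exponent [t^2 c^2 / 2] is the
    one that fits the normalisation [2 c^2] of [mixture]. *)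
Lemma subgaussian v (a c t : R) : measurable_fun setT v -> 0 < c ->
  (forall x, a <= v x <= a + c) ->
  (\int[mu]_x (expR (t * (v x - mean v)) * rho x)%:E <= (expR (t ^+ 2 * c ^+ 2 / 2))%:E)%E.
Proof.
move=> mv c0 va; set m := mean v.
have /andP[ma mb] : a <= m <= a + c by exact: mean_bounds.
pose u := t * c.
pose p := (expR u + expR (- u)) / 2; pose q := (expR u - expR (- u)) / (2 * c).
have vb x : `|v x| <= `|a| + `|a + c| by exact: ler_norm_bounds.
have i1 : mu.-integrable setT (EFin \o (fun x => rho x * v x)).
  exact: (density_mul_integrable mv vb).
have chord x : expR (t * (v x - m)) * rho x <= (p - q * m) * rho x + q * (rho x * v x).
  have /andP[h1 h2] := va x.
  have -> : (p - q * m) * rho x + q * (rho x * v x) = (p + q * (v x - m)) * rho x by ring.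
  apply: ler_wpM2r => //.
  have y1 : -1 <= (v x - m) / c <= 1.
    by rewrite ler_pdivlMr// ler_pdivrMr//; apply/andP; split; lra.
  have := expR_le_chord u y1.
  have -> : u * ((v x - m) / c) = t * (v x - m).
    by rewrite /u; field; rewrite gt_eqF.
  move/le_trans; apply; rewrite le_eqVlt; apply/orP; left; apply/eqP.
  by rewrite /p /q; field; rewrite gt_eqF.
have iR : mu.-integrable setT (EFin \o (fun x => (p - q * m) * rho x + q * (rho x * v x))).
  have -> : EFin \o (fun x => (p - q * m) * rho x + q * (rho x * v x)) =
    (fun x => (p - q * m)%:E * (EFin \o rho) x + q%:E * (EFin \o (fun x => (rho x * v x)%R)) x)%E by [].
  apply: integrableD => //; apply: integrableZl => //; exact: density_integrable.
have mE : measurable_fun setT (fun x => expR (t * (v x - m)) * rho x).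
  apply: measurable_funM => //; apply: measurableT_comp; first exact: measurable_expR.
  by apply: measurable_funM => //; exact: measurable_funB.
apply: (@le_trans _ _ (\int[mu]_x ((p - q * m) * rho x + q * (rho x * v x))%:E)%E).
  apply: ge0_le_integral => //.
  - by move=> x _; rewrite lee_fin mulr_ge0// expR_ge0.
  - exact/measurable_EFinP.
  - by case/integrableP: iR.
  - by move=> x _; rewrite lee_fin.
have -> : (\int[mu]_x ((p - q * m) * rho x + q * (rho x * v x))%:E)%E = p%:E.
  have -> : (\int[mu]_x ((p - q * m) * rho x + q * (rho x * v x))%:E)%E =
    (\int[mu]_x ((p - q * m)%:E * (EFin \o rho) x + q%:E * (EFin \o (fun x => (rho x * v x)%R)) x))%E by [].
  rewrite integralD//; last 2 first.
  - by apply: integrableZl => //; exact: density_integrable.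
  - exact: integrableZl.
  rewrite integralZl//; last exact: density_integrable.
  rewrite integralZl// rho1 mule1.
  have -> : (\int[mu]_x (EFin \o (fun x => (rho x * v x)%R)) x)%E = m%:E.
    by rewrite /m /mean /Rintegral fineK//; exact: integrable_fin_num.
  by rewrite -EFinM -EFinD; congr EFin; ring.
rewrite lee_fin; apply: le_trans (cosh_le u) _.
by rewrite ler_expR /u exprMn.
Qed.

(** Closed form of the Gaussian average of exponential martingales. Taking for [kap] the determinant
    of the initial matrix makes it start at 1. *)
Definition mixture {n : nat} (kap c : R) (M : 'M[R]_n) (z : 'cV[R]_n) : R :=
  Num.sqrt (kap / \det M) * expR (qf (invmx M) z / (2 * c ^+ 2)).

(* With [q = x^T M^-1 x] the noise enters through [exp ((2 e s + e^2 q - s^2) / (2 c^2 (1 + q)))];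
   bounding [e^2] by [c^2] leaves a sub-Gaussian exponential whose mean is at most
   [exp (q / (2 (1 + q))) <= sqrt (1 + q)], which the determinant ratio absorbs. *)
Lemma mixture_supermartingale n (kap a c : R) (M : 'M[R]_n) (x z : 'cV[R]_n) v :
  0 < kap -> 0 < c -> posdef M -> 0 < \det M -> measurable_fun setT v ->
  (forall y, a <= v y <= a + c) ->
  (\int[mu]_y (mixture kap c (M + x *m x^T) (z + (v y - mean v) *: x) * rho y)%:E
   <= (mixture kap c M z)%:E)%E.
Proof.
move=> kap0 c0 Mp dM mv va; set m := mean v.
have /andP[ma mb] : a <= m <= a + c by exact: mean_bounds.
set q := qf (invmx M) x; set s := dotv z (invmx M *m x).
have q0 : 0 <= q by exact: qf_invmx_ge0.
have q1 : 0 < 1 + q by lra.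
have c2 : 0 < c ^+ 2 by rewrite exprn_gt0.
(* [t] is the coefficient of the centred value in the exponent, and [C] gathers the factors
   independent of the next state. *)
pose t := s / (c ^+ 2 * (1 + q)).
pose C := mixture kap c M z * (Num.sqrt (1 + q))^-1 *
  expR ((c ^+ 2 * q - s ^+ 2) / (2 * c ^+ 2 * (1 + q))).
have mix0 : 0 <= mixture kap c M z by rewrite mulr_ge0 ?sqrtr_ge0 ?expR_ge0.
have C0 : 0 <= C by rewrite !mulr_ge0 ?invr_ge0 ?sqrtr_ge0 ?expR_ge0.
have bound y : mixture kap c (M + x *m x^T) (z + (v y - m) *: x) * rho y <=
    C * (expR (t * (v y - m)) * rho y).
  rewrite mulrA; apply: ler_wpM2r => //.
  rewrite /mixture det_outer// Sherman_Morrison// -/q -/s.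
  have /andP[h1 h2] := va y; set e := v y - m.
  have e2 : e ^+ 2 <= c ^+ 2.
    by rewrite -real_normK ?num_real// ler_pXn2r ?nnegrE ?(ltW c0)// ler_norml /e; lra.
  rewrite /C /mixture invfM mulrA sqrtrM; last by rewrite divr_ge0// ltW.
  rewrite sqrtrV; last exact: ltW.
  set sq := Num.sqrt (kap / _); set iv := (Num.sqrt _)^-1.
  set G := expR (qf (invmx M) z / _); set B := expR ((c ^+ 2 * q - s ^+ 2) / _); set D := expR (t * _).
  have -> : sq * G * iv * B * D = sq * iv * (G * (B * D)) by ring.
  apply: ler_wpM2l; first by rewrite mulr_ge0 ?invr_ge0 ?sqrtr_ge0.
  rewrite /G /B /D.
  rewrite -!expRD ler_expR mulrDl lerD2l.
  have -> : (2 * e * s + e ^+ 2 * q - s ^+ 2) / (1 + q) / (2 * c ^+ 2) =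
    (2 * e * s + e ^+ 2 * q - s ^+ 2) / (2 * c ^+ 2 * (1 + q)).
    by field; rewrite !gt_eqF.
  have -> : (c ^+ 2 * q - s ^+ 2) / (2 * c ^+ 2 * (1 + q)) + t * e =
    (2 * e * s + c ^+ 2 * q - s ^+ 2) / (2 * c ^+ 2 * (1 + q)).
    by rewrite /t; field; rewrite !gt_eqF.
  rewrite ler_pM2r ?invr_gt0; last by rewrite !mulr_gt0.
  by rewrite lerD2r lerD2l ler_wpM2r.
have mexp : measurable_fun setT (fun y => expR (t * (v y - m)) * rho y).
  apply: measurable_funM => //; apply: measurableT_comp; first exact: measurable_expR.
  by apply: measurable_funM => //; exact: measurable_funB.
have mmix : measurable_fun setT
    (fun y => mixture kap c (M + x *m x^T) (z + (v y - m) *: x) * rho y).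
  apply: measurable_funM => //; apply: measurable_funM => //.
  apply: measurableT_comp; first exact: measurable_expR.
  apply: measurable_funM => //; apply: measurable_qf; first exact: measurable_mx_cst.
  apply: measurable_mxD; first exact: measurable_mx_cst.
  by apply: measurable_mxZ; [exact: measurable_funB|exact: measurable_mx_cst].
apply: (@le_trans _ _ (\int[mu]_y (C%:E * (expR (t * (v y - m)) * rho y)%:E))%E).
  apply: ge0_le_integral => //.
  - by move=> y _; rewrite lee_fin !mulr_ge0 ?sqrtr_ge0 ?expR_ge0.
  - exact/measurable_EFinP.
  - by apply/measurable_EFinP; exact: measurable_funM.
  - by move=> y _; rewrite -EFinM lee_fin.
rewrite ge0_integralZl//; last 2 first.
- exact/measurable_EFinP.
- by move=> y _; rewrite lee_fin mulr_ge0 ?expR_ge0.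
apply: (@le_trans _ _ (C%:E * (expR (t ^+ 2 * c ^+ 2 / 2))%:E)%E).
  by apply: lee_wpmul2l; [rewrite lee_fin|exact: (@subgaussian v a c t mv c0 va)].
rewrite -EFinM lee_fin.
have -> : C * expR (t ^+ 2 * c ^+ 2 / 2) = mixture kap c M z * ((Num.sqrt (1 + q))^-1 *
    expR ((c ^+ 2 * q - s ^+ 2) / (2 * c ^+ 2 * (1 + q)) + t ^+ 2 * c ^+ 2 / 2)).
  by rewrite expRD /C; ring.
rewrite -[leRHS]mulr1.
apply: ler_wpM2l => //; rewrite ler_pdivrMl ?sqrtr_gt0// mulr1.
(* The sub-Gaussian factor contributes [s^2 / (2 c^2 (1 + q)^2)], which the term
   [- s^2 / (2 c^2 (1 + q))] outweighs; the two together are nonpositive. *)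
apply: (@le_trans _ _ (expR (q / (1 + q) / 2))).
  rewrite ler_expR.
  have -> : (c ^+ 2 * q - s ^+ 2) / (2 * c ^+ 2 * (1 + q)) + t ^+ 2 * c ^+ 2 / 2 =
    q / (1 + q) / 2 - s ^+ 2 * q / (2 * c ^+ 2 * (1 + q) ^+ 2).
    by rewrite /t; field; rewrite !gt_eqF.
  rewrite lerBlDr lerDl; apply: divr_ge0; first exact: (mulr_ge0 (sqr_ge0 s) q0).
  apply: mulr_ge0; last exact: sqr_ge0.
  by apply: mulr_ge0 => //; exact: ltW.
rewrite -(@ler_pXn2r _ 2%N) ?nnegrE ?expR_ge0 ?sqrtr_ge0// sqr_sqrtr; last exact: ltW.
by rewrite expr2 -expRD -splitr expR_div1D_le.
Qed.

End ProbabilityDensity.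

Section SupermartingaleStep.
Local Open Scope ereal_scope.
Context dO (Omega : measurableType dO) (R : realType) (P : probability Omega R).
Context dT (T : measurableType dT) dS (S : measurableType dS).
Variables (mu : {measure set S -> \bar R}) (musf : sigma_finite setT mu).
Variables (X : Omega -> T) (Y : Omega -> S) (rho : T * S -> R).
Hypotheses (mX : measurable_fun setT X) (mY : measurable_fun setT Y).
Hypotheses (mrho : measurable_fun setT rho) (rho0 : forall z, (0 <= rho z)%R).
Hypothesis XY_law : forall E B, measurable E -> measurable B ->
  P (X @^-1` E `&` Y @^-1` B) =
  \int[P]_(o in X @^-1` E) \int[mu]_(x in B) (rho (X o, x))%:E.

(** The integrated form of [E[f (X, Y) | X] <= g X]: the conditional bound is checked pointwise in
    [t] against the transition density, and the event is carried inside as an indicator. *)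
Lemma supermartingale_step (E : set T) (f : T * S -> R) (g : T -> R) :
  measurable E -> measurable_fun setT f -> (forall z, (0 <= f z)%R) ->
  measurable_fun setT g ->
  (forall t, \int[mu]_x (f (t, x) * rho (t, x))%:E <= (g t)%:E) ->
  \int[P]_(o in X @^-1` E) (f (X o, Y o))%:E <= \int[P]_(o in X @^-1` E) (g (X o))%:E.
Proof.
move=> mE mf f0 mg fg.
have mXE : measurable (X @^-1` E) by rewrite -[X in measurable X]setTI; exact: mX.
have g0 t : (0 <= g t)%R.
  by rewrite -lee_fin; apply: le_trans (fg t); apply: integral_ge0 => x _;
    rewrite lee_fin mulr_ge0.
pose F (z : T * S) : \bar R := (\1_E z.1 * f z)%:E.
have mF : measurable_fun setT F.
  apply/measurable_EFinP; apply: measurable_funM => //.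
  by apply: (measurableT_comp _ measurable_fst); exact: measurable_indic.
have F0 z : 0 <= F z by rewrite lee_fin mulr_ge0.
have patchE (G : Omega -> R) : \int[P]_(o in X @^-1` E) (G o)%:E =
    \int[P]_o (\1_E (X o) * G o)%:E.
  rewrite integral_mkcond; apply: eq_integral => o _; rewrite /patch indicE.
  have -> : (o \in X @^-1` E) = (X o \in E) by apply/idP/idP; rewrite !inE.
  by case: ifP => _; rewrite ?mul1r ?mul0r.
rewrite !patchE.
have -> : \int[P]_o (\1_E (X o) * f (X o, Y o))%:E = \int[P]_o F (X o, Y o) by [].
rewrite (integral_conditional_law musf mX mY mrho rho0 XY_law mF F0).
have inE o : \int[mu]_x (F (X o, x) * (rho (X o, x))%:E) =
    (\1_E (X o))%:E * \int[mu]_x (f (X o, x) * rho (X o, x))%:E.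
  rewrite -ge0_integralZl//.
  - by apply: eq_integral => x _; rewrite /F /= -!EFinM mulrA.
  - apply/measurable_EFinP; apply: measurable_funM.
      exact: (measurableT_comp mf (pair1_measurable _)).
    exact: (measurableT_comp mrho (pair1_measurable _)).
  - by move=> x _; rewrite lee_fin mulr_ge0.
have mg' : measurable_fun setT (fun o => (\1_E (X o) * g (X o))%:E).
  apply/measurable_EFinP; apply: measurable_funM; last exact: (measurableT_comp mg mX).
  by apply: (measurableT_comp _ mX); exact: measurable_indic.
apply: ge0_le_integral => //.
- by move=> o _; rewrite inE mule_ge0 ?lee_fin//; apply: integral_ge0 => x _;
    rewrite lee_fin mulr_ge0.
- have [mus musE] := sigma_finite_measure_exists musf.
  have -> : (fun o => \int[mu]_x (F (X o, x) * (rho (X o, x))%:E)) =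
      fubini_F mus (fun z => F z * (rho z)%:E) \o X.
    by apply/funext => o /=; apply: eq_measure_integral => B _ _; exact/esym/musE.
  apply: (measurableT_comp _ mX); apply: measurable_fun_fubini_tonelli_F => //.
    by apply: emeasurable_funM => //; exact/measurable_EFinP.
  by move=> z; rewrite mule_ge0// lee_fin.
- move=> o _; rewrite inE EFinM; apply: lee_wpmul2l; first by rewrite lee_fin.
  exact: fg.
Qed.

End SupermartingaleStep.

(** * Ville's maximal inequality over a finite horizon *)

Section Ville.
Local Open Scope ereal_scope.
Context dO (Omega : measurableType dO) (R : realType) (P : probability Omega R).
Variables (N : nat) (M : nat -> Omega -> R) (a : R).
Hypotheses (mM : forall n, (n <= N)%N -> measurable_fun setT (M n))
  (M0 : forall n o, (0 <= M n o)%R) (a0 : (0 < a)%R).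

Definition below n : set Omega := [set o | forall j, (j <= n)%N -> (M j o < a)%R].

Hypothesis step : forall n, (n < N)%N ->
  \int[P]_(o in below n) (M n.+1 o)%:E <= \int[P]_(o in below n) (M n o)%:E.
Hypothesis init : \int[P]_o (M 0%N o)%:E <= 1.

Lemma belowS n : below n.+1 = below n `&` [set o | (M n.+1 o < a)%R].
Proof.
apply/seteqP; split => o /=.
  by move=> h; split => [j jn|]; apply: h => //; exact: leqW.
by move=> [h1 h2] j; rewrite leq_eqVlt => /orP[/eqP->//|]; rewrite ltnS; exact: h1.
Qed.

Lemma below0 : below 0 = [set o | (M 0%N o < a)%R].
Proof.
apply/seteqP; split => o /=; first by apply.
by move=> h j; rewrite leqn0 => /eqP->.
Qed.

Lemma measurable_level n : (n <= N)%N -> measurable [set o | (M n o < a)%R].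
Proof.
move=> nN; have := measurable_fun_ltr (mM nN) (measurable_cst a) measurableT (Y := [set true]) I.
by rewrite setTI.
Qed.

Lemma measurable_below n : (n <= N)%N -> measurable (below n).
Proof.
elim: n => [|n IH] nN; first by rewrite below0; exact: measurable_level.
by rewrite belowS; apply: measurableI; [exact/IH/ltnW|exact: measurable_level].
Qed.

(** Markov's inequality on the part of [D] where the level is reached, the rest of the integral
    being kept for later times. *)
Lemma level_split D n : measurable D -> (n <= N)%N ->
  a%:E * P (D `\` [set o | (M n o < a)%R]) +
  \int[P]_(o in D `&` [set o | (M n o < a)%R]) (M n o)%:E <= \int[P]_(o in D) (M n o)%:E.
Proof.
move=> mD nN; set L := [set o | _].
have mL : measurable L by exact: measurable_level.
have mDL : measurable (D `\` L) by exact: measurableD.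
have mDI : measurable (D `&` L) by exact: measurableI.
have mMn : measurable_fun setT (fun o => (M n o)%:E) by exact/measurable_EFinP/mM.
have {3}-> : D = (D `\` L) `|` (D `&` L) by rewrite setUC setUIDK.
rewrite ge0_integral_setU//; last 3 first.
- exact: measurable_funTS.
- by move=> o _; rewrite lee_fin.
- by apply/disj_set2P/seteqP; split => o //= -[[_ h] [_ /h]].
apply: leeD => //.
rewrite -integral_cst//; apply: ge0_le_integral => //.
- by move=> o _; rewrite lee_fin ltW.
- exact: measurable_funTS.
- by move=> o [_ /negP]; rewrite -leNgt lee_fin.
Qed.

(** The invariant is that [a] times the probability of having reached the level, plus the integral
    of the process over the paths still below it, is at most 1. It is the expectation bound for the
    stopped process, so [step] is asked only on [below n]. *)
Lemma Ville_ineq : a%:E * P (~` below N) <= 1.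
Proof.
suff h n : (n <= N)%N -> a%:E * P (~` below n) + \int[P]_(o in below n) (M n o)%:E <= 1.
  apply: le_trans (h N (leqnn N)); rewrite leeDl//.
  by apply: integral_ge0 => o _; rewrite lee_fin.
elim: n => [|n IH] nN.
  apply: le_trans init; rewrite below0 -setTD -[X in \int[P]_(o in X) _]setTI.
  exact: level_split.
have mB := measurable_below (ltnW nN).
apply: le_trans (IH (ltnW nN)).
have -> : ~` below n.+1 = ~` below n `|` (below n `\` [set o | (M n.+1 o < a)%R]).
  rewrite belowS setCI; apply/seteqP; split => o /=; last by move=> [|[]]; tauto.
  by move=> [|]; [left|have [|] := pselect (below n o); [right|left]].
rewrite measureU//; last 3 first.
- exact: measurableC.
- by apply: measurableD => //; exact: measurable_level.
- by apply/seteqP; split => o //= [h1 [h2 _]].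
rewrite muleDr//; last by rewrite ge0_adde_def ?inE.
rewrite -addeA; apply: leeD => //; apply: le_trans (step nN).
by rewrite belowS; exact: level_split.
Qed.

End Ville.

(** * Confidence ellipsoids and the elliptical potential *)

Section ConfidenceSet.
Context {R : realType} {d : nat}.
Implicit Types (M B : 'M[R]_d) (x w z g : 'cV[R]_d).

Lemma mxnorm_invmx_le (a : R) M x : 0 < a -> M^T = M ->
  (forall y, a * dotv y y <= qf M y) -> mxnorm (invmx M) x <= norm2 x / Num.sqrt a.
Proof.
move=> a0 Ms h; rewrite mxnormE /norm2 -sqrtrV ?(ltW a0)//.
rewrite -sqrtrM ?dotv_ge0//; apply: ler_wsqrtr.
exact: qf_invmx_le.
Qed.

Lemma mxnorm_invmx_anti M N x : posdef N -> M^T = M -> (forall y, qf N y <= qf M y) ->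
  mxnorm (invmx M) x <= mxnorm (invmx N) x.
Proof. by move=> Np Ms h; rewrite !mxnormE; apply: ler_wsqrtr; exact: qf_invmx_anti. Qed.

(** By the normal equations the error is [(M + B)^-1] applied to [z + g - lam w - B w]. The
    deterministic terms are measured through [M + B >= lam + lo], which gives the fraction in the
    width condition; the noise [z] keeps its norm in [M^-1] because [B] is nonnegative. *)
Lemma perturbed_regression_error M B w z g x (lam lo hi Cw C s : R) :
  0 < lam -> 0 <= lo -> 0 <= hi -> M^T = M -> (forall y, lam * dotv y y <= qf M y) ->
  B^T = B -> (forall e, eigenvalue B e -> lo <= e <= hi) ->
  norm2 w <= Cw -> norm2 g <= C -> mxnorm (invmx M) z <= s ->
  `|dotv x (invmx (M + B) *m ((M - lam%:M) *m w + z + g) - w)| <=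
  (((lam + hi) * Cw + C) / Num.sqrt (lam + lo) + s) * mxnorm (invmx (M + B)) x.
Proof.
move=> lam0 lo0 hi0 Ms Mlam Bs Beig wC gC zs.
have qB y := qf_ge_eigenvalue y Bs Beig.
have MBs : (M + B)^T = M + B by rewrite linearD /= Ms Bs.
have ll0 : 0 < lam + lo by rewrite ltr_wpDr.
have MBge y : (lam + lo) * dotv y y <= qf (M + B) y.
  by rewrite mulrDl qf_addmx lerD.
have Mp : posdef M.
  by apply: (posdef_ge (posdef_scalar lam0)) => // y; rewrite qf_scalar.
have MBp : posdef (M + B).
  by apply: (posdef_ge (posdef_scalar ll0)) => // y; rewrite qf_scalar.
set u := z + (g - (lam *: w + B *m w)).
have -> : invmx (M + B) *m ((M - lam%:M) *m w + z + g) - w = invmx (M + B) *m u.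
  apply: (can_inj (mulKmx (posdef_unitmx MBp))).
  rewrite mulmxBr !mulKVmx ?posdef_unitmx// /u mulmxBl mulmxDl mul_scalar_mx.
  apply/colP => i; rewrite !mxE; ring.
have uB : mxnorm (invmx (M + B)) u <= ((lam + hi) * Cw + C) / Num.sqrt (lam + lo) + s.
  apply: le_trans (mxnorm_invmxD_le _ _ MBp) _; rewrite addrC; apply: lerD; last first.
    apply: le_trans zs; apply: mxnorm_invmx_anti => // y.
    by rewrite qf_addmx lerDl (le_trans _ (qB y))// mulr_ge0// dotv_ge0.
  apply: le_trans (mxnorm_invmxD_le _ _ MBp) _; rewrite mxnormN mulrDl addrC; apply: lerD.
    apply: le_trans (mxnorm_invmxD_le _ _ MBp) _; rewrite mulrDl mulrDl; apply: lerD.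
      apply: le_trans (mxnorm_invmx_le _ ll0 MBs MBge) _.
      apply: ler_wpM2r; first by rewrite invr_ge0 sqrtr_ge0.
      rewrite /norm2 dotvZl dotvZr mulrA -expr2 sqrtrM ?sqr_ge0// sqrtr_sqr ger0_norm ?(ltW lam0)//.
      by apply: ler_wpM2l => //; exact: ltW.
    apply: le_trans (mxnorm_invmx_le _ ll0 MBs MBge) _.
    apply: ler_wpM2r; first by rewrite invr_ge0 sqrtr_ge0.
    apply: le_trans (norm2_mul_le_eigenvalue w Bs lo0 hi0 Beig) _.
    exact: ler_wpM2l.
  apply: le_trans (mxnorm_invmx_le _ ll0 MBs MBge) _.
  by apply: ler_wpM2r => //; rewrite invr_ge0 sqrtr_ge0.
have -> : dotv x (invmx (M + B) *m u) = dotv (invmx (M + B) *m x) u.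
  by rewrite dotv_mulmxr trmx_invmx.
apply: (@le_trans _ _ (mxnorm (invmx (M + B)) u * mxnorm (invmx (M + B)) x)); last first.
  by apply: ler_wpM2r => //; exact: mxnorm_ge0.
rewrite !mxnormE -sqrtrM ?qf_invmx_ge0// -sqrtr_sqr; apply: ler_wsqrtr.
rewrite dotvC.
by apply: qf_psd_CS => [|y]; [rewrite trmx_invmx|exact: qf_invmx_ge0].
Qed.

(** [D] bounds the determinant ratio, and solving the level condition for the noise norm puts
    [a * sqrt D] inside the logarithm of the width. *)
Lemma mixture_lt (kap c a D : R) M z : 0 < kap -> 0 < c -> 0 < a -> 0 < D ->
  0 < \det M <= kap * D -> mixture kap c M z < a ->
  mxnorm (invmx M) z <= Num.sqrt (2 * c ^+ 2 * ln (a * Num.sqrt D)).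
Proof.
move=> kap0 c0 a0 D0 /andP[dM0 dM]; rewrite /mixture => h.
have c2 : 0 < 2 * c ^+ 2 by rewrite mulr_gt0// exprn_gt0.
rewrite mxnormE; apply: ler_wsqrtr.
rewrite mulrC -ler_pdivrMr//.
have sD : 0 < Num.sqrt D by rewrite sqrtr_gt0.
rewrite -[leLHS]expRK ler_ln ?posrE ?expR_gt0 ?mulr_gt0//.
have sk : (Num.sqrt D)^-1 <= Num.sqrt (kap / \det M).
  rewrite -sqrtrV ?(ltW D0)//; apply: ler_wsqrtr.
  by rewrite ler_pdivlMr// mulrC ler_pdivrMr.
rewrite -ler_pdivrMr// mulrC; apply: ltW; apply: le_lt_trans h.
by apply: ler_wpM2r => //; exact: expR_ge0.
Qed.

Lemma sum_le_sqrt n (a : nat -> R) (Q : R) : (forall i, 0 <= a i) ->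
  \sum_(0 <= i < n) a i ^+ 2 <= Q -> \sum_(0 <= i < n) a i <= Num.sqrt (n%:R * Q).
Proof.
move=> a0 hQ.
have key : (\sum_(0 <= i < n) a i) ^+ 2 <= n%:R * \sum_(0 <= i < n) a i ^+ 2.
  elim: n {hQ} => [|n IH]; first by rewrite !big_geq// expr0n mul0r.
  rewrite !big_nat_recr//=.
  set s := \sum_(0 <= i < n) a i in IH *; set q := \sum_(0 <= i < n) a i ^+ 2 in IH *.
  case: n @s @q IH => [|n] s q IH.
    by rewrite /s /q !big_geq// !add0r mul1r.
  have n0 : 0 < n.+1%:R :> R by rewrite ltr0n.
  (* Weighted arithmetic-geometric mean for [s] and [n.+1 * a n.+1], combined with the induction
     hypothesis [s^2 <= n.+1 * q]. *)
  have h : 2 * s * a n.+1 <= q + n.+1%:R * a n.+1 ^+ 2.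
    have : 0 <= (s - n.+1%:R * a n.+1) ^+ 2 by exact: sqr_ge0.
    have -> : (s - n.+1%:R * a n.+1) ^+ 2 =
      s ^+ 2 - n.+1%:R * (2 * s * a n.+1 - n.+1%:R * a n.+1 ^+ 2) by ring.
    move=> h1; have := le_trans (_ : n.+1%:R * (2 * s * a n.+1 - n.+1%:R * a n.+1 ^+ 2) <= s ^+ 2) IH.
    by rewrite ler_pM2l// lerBlDr; apply; rewrite -subr_ge0.
  rewrite sqrrD -[n.+2%:R]natr1 mulrDl mul1r mulrDr -mulr_natl mulrA.
  have := lerD IH h; lra.
rewrite -[leLHS]ger0_norm ?sumr_ge0// -sqrtr_sqr; apply: ler_wsqrtr.
by apply: le_trans key _; exact: ler_wpM2l.
Qed.

Definition gram (lam : R) (x : nat -> 'cV[R]_d) n : 'M[R]_d :=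
  lam%:M + \sum_(1 <= i < n.+1) x i *m (x i)^T.

Lemma gramS lam (x : nat -> 'cV[R]_d) n : gram lam x n.+1 = gram lam x n + x n.+1 *m (x n.+1)^T.
Proof. by rewrite /gram big_nat_recr//= addrA. Qed.

Lemma gram0 lam (x : nat -> 'cV[R]_d) : gram lam x 0 = lam%:M.
Proof. by rewrite /gram big_geq// addr0. Qed.

Lemma gram_posdef lam (x : nat -> 'cV[R]_d) n : 0 < lam -> posdef (gram lam x n).
Proof.
move=> lam0; elim: n => [|n IH]; first by rewrite gram0; exact: posdef_scalar.
by rewrite gramS; exact: posdef_outer.
Qed.

Lemma gram_ge lam (x : nat -> 'cV[R]_d) n y : lam * dotv y y <= qf (gram lam x n) y.
Proof.
elim: n => [|n IH]; first by rewrite gram0 qf_scalar.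
by rewrite gramS qf_addmx qf_outer; apply: le_trans IH _; rewrite lerDl sqr_ge0.
Qed.

Lemma gram_le lam (x : nat -> 'cV[R]_d) n y : (forall i, (1 <= i <= n)%N -> dotv (x i) (x i) <= lam) ->
  qf (gram lam x n) y <= lam * (1 + n%:R) * dotv y y.
Proof.
elim: n => [|n IH] h; first by rewrite gram0 qf_scalar addr0 mulr1.
rewrite gramS qf_addmx qf_outer -[n.+1%:R]natr1 addrA [lam * _]mulrDr mulr1 mulrDl.
apply: lerD; first by apply: IH => i /andP[i1 iN]; apply: h; rewrite i1 leqW.
have CS := @qf_psd_CS R d 1%:M (x n.+1) y.
have := CS (trmx1 _ _) (fun z => _); rewrite !qf_scalar !mul1r mul1mx => CS'.
apply: le_trans (CS' _) _ => [z|]; first by rewrite qf_scalar mul1r dotv_ge0.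
by apply: ler_wpM2r; [exact: dotv_ge0|apply: h; rewrite leqnn].
Qed.

Lemma gram_det lam (x : nat -> 'cV[R]_d) n : 0 < lam -> (forall i, (1 <= i <= n)%N -> dotv (x i) (x i) <= lam) ->
  0 < \det (gram lam x n) <= lam ^+ d * (1 + n%:R) ^+ d.
Proof.
move=> lam0 h; have Mp := gram_posdef x n lam0.
rewrite det_posdef_gt0//= -exprMn; apply: det_posdef_le => // y; exact: gram_le.
Qed.

(** Each rank-one update multiplies the determinant by [1 + q], and [q <= 1] because the squared
    norms are at most [lam], so [q <= 2 ln (1 + q)] and the logarithms telescope. *)
Lemma elliptical_potential lam (x : nat -> 'cV[R]_d) n : 0 < lam ->
  (forall i, (1 <= i <= n)%N -> dotv (x i) (x i) <= lam) ->
  \sum_(1 <= i < n.+1) mxnorm (invmx (gram lam x i.-1)) (x i) ^+ 2 <=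
  2 * (d%:R * ln (1 + n%:R)).
Proof.
move=> lam0 h.
have lamd : 0 < lam ^+ d by rewrite exprn_gt0.
apply: (@le_trans _ _ (2 * ln (\det (gram lam x n) / lam ^+ d))); last first.
  have /andP[d1 d2] := gram_det lam0 h.
  rewrite ler_wpM2l// mulr_natl -lnXn ?ltr_wpDr// ler_ln ?posrE ?divr_gt0 ?exprn_gt0 ?ltr_wpDr//.
  by rewrite ler_pdivrMr// mulrC.
elim: n h => [|n IH] h.
  by rewrite big_geq// gram0 det_scalar divff ?ln1 ?mulr0// gt_eqF.
have h' i : (1 <= i <= n)%N -> dotv (x i) (x i) <= lam.
  by move=> /andP[i1 iN]; apply: h; rewrite i1 leqW.
rewrite big_nat_recr//= gramS det_outer; last exact: gram_posdef.
have Mp := gram_posdef x n lam0.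
set q := qf _ _; have q0 : 0 <= q by exact: qf_invmx_ge0.
have q1 : q <= 1.
  apply: le_trans (qf_invmx_le _ lam0 Mp.1 (gram_ge _ _ _)) _.
  by rewrite ler_pdivrMr// mul1r h ?leqnn.
have /andP[dg _] := gram_det lam0 h'.
rewrite mulrAC lnM ?posrE ?divr_gt0 ?ltr_wpDr// mulrDr; apply: lerD; first exact: IH.
by rewrite mxnormE sqr_sqrtr// ln1D_ge// q0.
Qed.

Lemma elliptical_sum lam (x : nat -> 'cV[R]_d) n : 0 < lam ->
  (forall i, (1 <= i <= n)%N -> dotv (x i) (x i) <= lam) ->
  \sum_(1 <= i < n.+1) mxnorm (invmx (gram lam x i.-1)) (x i) <=
  Num.sqrt (n%:R * (2 * (d%:R * ln (1 + n%:R)))).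
Proof.
move=> lam0 h; have := elliptical_potential lam0 h.
by rewrite !big_add1 /= => h1; apply: sum_le_sqrt => // i; exact: mxnorm_ge0.
Qed.

End ConfidenceSet.

(** * Planning in a linear mixture MDP *)

Section LinearMixtureMDP.
Context {R : realType} {dS : measure_display} {S : measurableType dS}
  (mu : {measure set S -> \bar R}) (musf : sigma_finite setT mu) {A : finType} {d : nat}.
Variables (phi : S -> A -> S -> 'cV[R]_d) (H : nat) (r : nat -> S -> A -> R)
  (w : nat -> 'cV[R]_d).
Hypothesis H0 : (0 < H)%N.
Hypothesis r01 : forall h x a, 0 <= r h x a <= 1.
Hypothesis mr : forall h a, measurable_fun setT (fun x => r h x a).
Hypothesis mphi : forall a i, measurable_fun setT (fun x : S * S => phi x.1 a x.2 i 0).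
Hypothesis iphi : forall x a i, mu.-integrable setT (fun x' => (phi x a x' i 0)%:E).
Hypothesis phi1 : forall v : S -> R, measurable_fun setT v -> (forall x, 0 <= v x <= 1) ->
  forall x a, norm2 (phi_v mu phi v x a) <= 1.
Hypothesis dens0 : forall h x a x', (1 <= h <= H)%N -> 0 <= trans_dens phi (w h) x a x'.
Hypothesis dens1 : forall h x a, (1 <= h <= H)%N ->
  (\int[mu]_(x' in setT) (trans_dens phi (w h) x a x')%:E = 1)%E.

Notation rho h x a := (trans_dens phi (w h) x a).
Notation E h x a := (mean mu (trans_dens phi (w h) x a)).

Lemma measurable_phi_section x a i : measurable_fun setT (fun x' => phi x a x' i 0).
Proof. exact: (measurableT_comp (mphi a i) (pair1_measurable x)). Qed.

Lemma measurable_rho wh x a : measurable_fun setT (trans_dens phi wh x a).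
Proof.
apply: measurable_dotv; last exact: measurable_mx_cst.
by move=> i j; rewrite (ord1 j); exact: measurable_phi_section.
Qed.

Lemma integrable_phi_mul x a i (v : S -> R) (c : R) : measurable_fun setT v -> (forall x, `|v x| <= c) ->
  mu.-integrable setT (EFin \o (fun x' => phi x a x' i 0 * v x')).
Proof.
move=> mv vc.
apply: (@le_integrable _ _ _ mu _ measurableT _ (fun x' => c%:E * (phi x a x' i 0)%:E)%E).
- apply/measurable_EFinP; apply: measurable_funM => //.
  exact: measurable_phi_section.
- move=> x' _; rewrite /= lee_fin !normrM mulrC; apply: ler_wpM2r => //.
  by apply: le_trans (vc x') _; exact: ler_norm.
- exact: integrableZl.
Qed.

Lemma phi_v_mean wh x a (v : S -> R) (c : R) : measurable_fun setT v -> (forall x, `|v x| <= c) ->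
  dotv (phi_v mu phi v x a) wh = mean mu (trans_dens phi wh x a) v.
Proof.
move=> mv vc; rewrite dotvE /mean.
pose f i x' := phi x a x' i 0 * v x'.
have fi i : mu.-integrable setT (EFin \o f i) by exact: (integrable_phi_mul x a i mv vc).
have E1 : (fun x' => trans_dens phi wh x a x' * v x') =
    (fun x' => \sum_i wh i 0 * f i x').
  apply/funext => x'; rewrite /trans_dens dotvE mulr_suml; apply: eq_bigr => i _.
  by rewrite /f; ring.
rewrite E1 /Rintegral.
have -> : (\int[mu]_x0 (\sum_i wh i 0 * f i x0)%R%:E =
    \int[mu]_x0 (\sum_(i <- index_enum 'I_d) ((wh i 0%R)%:E * (EFin \o f i) x0)))%E.
  by apply: eq_integral => y _; rewrite -sumEFin; apply: eq_bigr => i _.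
rewrite integral_sum//; last by move=> i; exact: integrableZl.
have -> : (\sum_(i <- index_enum 'I_d) \int[mu]_x0 ((wh i 0%R)%:E * (EFin \o f i) x0) =
    \sum_(i <- index_enum 'I_d) (wh i 0 * Rintegral mu setT (f i))%R%:E)%E.
  apply: eq_bigr => i _; rewrite integralZl// EFinM; congr (_ * _)%E.
  by rewrite /Rintegral fineK//; exact: (integrable_fin_num measurableT (fi i)).
rewrite sumEFin /=; apply: eq_bigr => i _.
by rewrite mxE mulrC.
Qed.

Lemma phi_v_norm x a (v : S -> R) : measurable_fun setT v -> (forall x, 0 <= v x <= H%:R) ->
  dotv (phi_v mu phi v x a) (phi_v mu phi v x a) <= H%:R ^+ 2.
Proof.
move=> mv v0H; have Hp : 0 < H%:R :> R by rewrite ltr0n.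
pose u y := v y / H%:R.
have u01 y : 0 <= u y <= 1.
  by have /andP[h1 h2] := v0H y; rewrite divr_ge0 ?(ltW Hp)//= ler_pdivrMr// mul1r.
have mu_ : measurable_fun setT u by exact: measurable_funM.
have -> : phi_v mu phi v x a = H%:R *: phi_v mu phi u x a.
  apply/colP => i; rewrite !mxE -RintegralZl//.
    by apply: eq_Rintegral => y _; rewrite /u; field; rewrite gt_eqF.
  apply: (integrable_phi_mul x a i mu_ (c := 1)) => y.
  by have /andP[h1 h2] := u01 y; rewrite ger0_norm.
rewrite dotvZl dotvZr mulrA -expr2 -[leRHS]mulr1; apply: ler_wpM2l; first exact: sqr_ge0.
rewrite -norm2_sq -[leRHS](expr1n _ 2) ler_pXn2r ?nnegrE ?norm2_ge0//.
exact: phi1.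
Qed.

Lemma Vpi_aux_facts (pi : nat -> S -> A) n h :
  (forall j, (h <= j < h + n)%N -> measurable_fibers (pi j)) ->
  (1 <= h)%N -> (h + n <= H.+1)%N ->
  measurable_fun setT (Vpi_aux mu phi r w pi n h) /\
  (forall x, 0 <= Vpi_aux mu phi r w pi n h x <= n%:R).
Proof.
move=> mpi h1 hn; split.
  have := @jointly_measurable_Vpi_aux R dS S mu musf A d phi r mr mphi _ S w (fun=> pi) n h _.
  move=> /(_ _)/(jointly_measurable_section point); apply => j jh a.
  rewrite -[X in measurable X]setTI.
  have -> : [set: S * S] `&` (fun z : S * S => pi j z.2) @^-1` [set a] =
    [set: S * S] `&` snd @^-1` (pi j @^-1` [set a]) by [].
  by apply: measurable_snd => //; exact: mpi.
elim: n h h1 hn mpi => [|n IH] h h1 hn mpi x; first by rewrite /= lexx.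
have hH : (1 <= h <= H)%N by rewrite h1 /= -ltnS (leq_trans _ hn)// addnS ltnS leq_addr.
have mpi' j : (h.+1 <= j < h.+1 + n)%N -> measurable_fibers (pi j).
  by move=> /andP[hj jn]; apply: mpi; rewrite (ltnW hj) addnS -addSn.
have hn' : (h.+1 + n <= H.+1)%N by rewrite addSn -addnS.
have b := IH h.+1 isT hn' mpi'.
have mV : measurable_fun setT (Vpi_aux mu phi r w pi n h.+1).
  have := @jointly_measurable_Vpi_aux R dS S mu musf A d phi r mr mphi _ S w (fun=> pi) n h.+1 _.
  move=> /(_ _)/(jointly_measurable_section point); apply => j jh a.
  rewrite -[X in measurable X]setTI.
  have -> : [set: S * S] `&` (fun z : S * S => pi j z.2) @^-1` [set a] =
    [set: S * S] `&` snd @^-1` (pi j @^-1` [set a]) by [].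
  by apply: measurable_snd => //; exact: mpi'.
have /andP[m1 m2] := mean_bounds (measurable_rho (w h) x (pi h x))
  (fun y => dens0 x (pi h x) y hH) (dens1 x (pi h x) hH) mV b.
have /andP[r1 r2] := r01 h x (pi h x).
rewrite /= -/(mean mu (rho h x (pi h x)) _) -[n.+1%:R]natr1.
by apply/andP; split; [exact: addr_ge0|rewrite addrC lerD].
Qed.

Lemma Vpi_auxS (pi : nat -> S -> A) n h x :
  Vpi_aux mu phi r w pi n.+1 h x =
  r h x (pi h x) + E h x (pi h x) (Vpi_aux mu phi r w pi n h.+1).
Proof. by []. Qed.

Section Planning.
Variables (a0 : A) (Lam : nat -> 'M[R]_d) (wt : nat -> 'cV[R]_d) (b : R).

Notation Vt := (Vtil_aux mu phi H r a0 Lam wt b).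
Notation Qt n h := (Qtil mu phi H r (Lam h) (wt h) b h (Vt n h.+1)).

Lemma measurable_Vtil_aux n h : measurable_fun setT (Vt n h).
Proof.
have := @jointly_measurable_Vtil_aux R dS S mu musf A d phi H r mr mphi _ S a0
  (fun=> Lam) (fun=> wt) b n h (fun j _ => measurable_mx_cst (T := S) (Lam j))
  (fun j _ => measurable_mx_cst (T := S) (wt j)).
exact: (jointly_measurable_section point).
Qed.

Lemma Vtil_aux_leH n h x : Vt n h x <= H%:R.
Proof.
case: n => [|n] /=; first exact: ler0n.
by apply: bigmax_le => [|a _]; rewrite /Qtil ge_min lexx.
Qed.

Lemma Qtil_le_Vtil n h x a : Qt n h x a <= Vt n.+1 h x.
Proof. exact: (le_bigmax _ (Qt n h x) a). Qed.

Lemma Vtil_greedy h x : (h <= H)%N ->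
  Vtil mu phi H r a0 Lam wt b h x =
  Qtil mu phi H r (Lam h) (wt h) b h (Vtil mu phi H r a0 Lam wt b h.+1) x
    (greedy mu phi H r a0 Lam wt b h x).
Proof.
move=> hH; rewrite {1}/Vtil subSn//.
set Q := Qtil _ _ _ _ _ _ _ _ _ x.
have QE a : Qt (H - h) h x a = Q a by rewrite /Q /Vtil subSS.
have best : forall a, Q a <= Q (greedy mu phi H r a0 Lam wt b h x).
  rewrite /greedy -/Q; case: pickP => [a /forallP //|noA].
  (* The action set is finite and contains [a0], so a maximiser exists and the default of [odflt] is
     never returned. *)
  exfalso; have [a _ aP] := @arg_maxP _ R A a0 predT Q isT.
  by have /negP := noA a; apply; apply/forallP => a'; exact: aP.
apply/eqP; rewrite eq_le; apply/andP; split.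
  by rewrite /=; apply: bigmax_le => [|a _]; rewrite QE; exact: best.
by rewrite -QE; exact: Qtil_le_Vtil.
Qed.

Hypothesis conf : forall h (v : S -> R) x a, (1 <= h <= H)%N -> measurable_fun setT v ->
  `|dotv (phi_v mu phi v x a) (wt h - w h)| <= b * mxnorm (invmx (Lam h)) (phi_v mu phi v x a).

Lemma mean_le_Qtil h (v : S -> R) x a : (1 <= h <= H)%N -> measurable_fun setT v ->
  (forall y, 0 <= v y <= H%:R) ->
  Num.min H%:R (r h x a + E h x a v) <= Qtil mu phi H r (Lam h) (wt h) b h v x a.
Proof.
move=> hH mv v0; rewrite /Qtil le_min ge_min lexx /= ge_min; apply/orP; right.
rewrite -addrA lerD2l -(phi_v_mean (w h) x a mv (c := H%:R)); last first.
  by move=> y; have /andP[h1 h2] := v0 y; rewrite ger0_norm.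
have := conf x a hH mv; rewrite dotvDr dotvNr ler_norml => /andP[h1 _].
by move: h1; rewrite lerNl opprB lerBlDr addrC.
Qed.

(** Two bonuses appear: one is added by [Qtil], the other bounds the error of the estimate. *)
Lemma Qtil_le_mean h (v : S -> R) x a : (1 <= h <= H)%N -> measurable_fun setT v ->
  (forall y, 0 <= v y <= H%:R) ->
  Qtil mu phi H r (Lam h) (wt h) b h v x a <=
  r h x a + E h x a v + 2 * b * mxnorm (invmx (Lam h)) (phi_v mu phi v x a).
Proof.
move=> hH mv v0; rewrite /Qtil ge_min; apply/orP; right.
rewrite -(phi_v_mean (w h) x a mv (c := H%:R)); last first.
  by move=> y; have /andP[h1 h2] := v0 y; rewrite ger0_norm.
have := conf x a hH mv; rewrite dotvDr dotvNr ler_norml => /andP[_].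
set p1 := dotv _ _; set p2 := dotv _ _; set c := mxnorm _ _; move: (r h x a) => rr.
have -> : rr + p2 + 2 * b * c = rr + (b * c + p2) + b * c by ring.
by rewrite lerD2r lerD2l -lerBlDr.
Qed.

(** Nonnegativity is carried along with domination, since the backup comparison wants the next
    estimate in [[0, H]]. The cap at [H] preserves domination because the true value of the
    remaining stages is at most their number. *)
Lemma Vtil_optimistic n h : (1 <= h)%N -> (h + n = H.+1)%N ->
  (forall x, 0 <= Vt n h x) /\
  (forall pi, (forall j, measurable_fibers (pi j)) ->
    forall x, Vpi_aux mu phi r w pi n h x <= Vt n h x).
Proof.
elim: n h => [|n IH] h h1 hn; first by split => *; rewrite /= lexx.
have hH : (1 <= h <= H)%N by rewrite h1 /= -ltnS -hn addnS ltnS leq_addr.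
have [V0 Vopt] := IH h.+1 isT (etrans (addSnnS h n) hn).
have mV := measurable_Vtil_aux n h.+1.
have bV y : 0 <= Vt n h.+1 y <= H%:R by rewrite V0 Vtil_aux_leH.
have mrho x a := measurable_rho (w h) x a.
split=> [x|pi mpi x].
  apply: le_trans (Qtil_le_Vtil n h x a0); apply: le_trans (mean_le_Qtil x a0 hH mV bV).
  rewrite le_min ler0n /=; apply: addr_ge0; first by have /andP[] := r01 h x a0.
  by have /andP[] := mean_bounds (mrho x a0) (fun y => dens0 x a0 y hH) (dens1 x a0 hH) mV bV.
apply: le_trans (Qtil_le_Vtil n h x (pi h x)).
apply: le_trans (mean_le_Qtil x (pi h x) hH mV bV).
have [mVp bVp] := @Vpi_aux_facts pi n h.+1 (fun j _ => mpi j) isT (eq_leq (etrans (addSnnS h n) hn)).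
have [_ bVp'] := @Vpi_aux_facts pi n.+1 h (fun j _ => mpi j) h1 (eq_leq hn).
have nH : (n.+1 <= H)%N by rewrite -ltnS -hn -{1}[n.+1]add0n ltn_add2r.
rewrite le_min; apply/andP; split.
  by have /andP[_ h2] := bVp' x; apply: le_trans h2 _; rewrite ler_nat.
rewrite Vpi_auxS lerD2l.
apply: (mean_le (mrho _ _) (fun y => dens0 _ _ y hH) (dens1 _ _ hH) (c := H%:R)) => // y.
- have /andP[h2 h3] := bVp y; rewrite ger0_norm//; apply: le_trans h3 _.
  by rewrite ler_nat ltnW.
- by have /andP[h2 h3] := bV y; rewrite ger0_norm.
- exact: Vopt.
Qed.

End Planning.

End LinearMixtureMDP.

(** * Regret along a trajectory *)

Section Trajectory.
Context {R : realType} {dS : measure_display} {S : measurableType dS}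
  (mu : {measure set S -> \bar R}) {A : finType} {d : nat}.
Variables (phi : S -> A -> S -> 'cV[R]_d) (H : nat) (r : nat -> S -> A -> R)
  (w : nat -> 'cV[R]_d) (lam : R) (beta : nat -> R) (a0 : A).
Variables (st : nat -> nat -> S) (B1 B2 : nat -> nat -> 'M[R]_d)
          (g1 g2 : nat -> nat -> 'cV[R]_d).

Let pre n := acc mu phi H r lam beta a0 st B1 B2 g1 g2 n.

Definition act k h : A := action mu phi H r lam beta a0 st B1 B2 g1 g2 k h.
Definition pol k : nat -> S -> A := policy mu phi H r lam beta a0 st B1 B2 g1 g2 k.
Definition Vk k h : S -> R := V_of mu phi H r lam beta a0 B1 B2 g1 g2 (pre k.-1) k h.
(* the truncation at [0] matters only outside the confidence event *)
Definition Vplus k h (x : S) : R := Num.max 0 (Vk k h x).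
Definition feat k h : 'cV[R]_d := phi_v mu phi (Vplus k h.+1) (st k h) (act k h).
Definition next_mean k h (v : S -> R) : R :=
  mean mu (trans_dens phi (w h) (st k h) (act k h)) v.
Definition noise n h : 'cV[R]_d := \sum_(1 <= i < n.+1)
  (Vplus i h.+1 (st i h.+1) - next_mean i h (Vplus i h.+1)) *: feat i h.
Definition feat_gram n h : 'M[R]_d := gram lam (feat^~ h) n.
Definition mix n h : R := mixture (lam ^+ d) H%:R (feat_gram n h) (noise n h).
Definition value_gap k h (x : S) : R := Vplus k h x - Vpi mu phi H r w (pol k) h x.
(** Minus the centred gap at the next state, hence a martingale difference. The gap lies in
    [[-H, H]] on every outcome, thanks to the truncation. *)
Definition gap_diff k h : R :=
  next_mean k h (value_gap k h.+1) - value_gap k h.+1 (st k h.+1).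

Lemma accE n h :
  (pre n h).1 = \sum_(1 <= i < n.+1)
    phi_v mu phi (Vk i h.+1) (st i h) (act i h) *m
    (phi_v mu phi (Vk i h.+1) (st i h) (act i h))^T /\
  (pre n h).2 = \sum_(1 <= i < n.+1)
    Vk i h.+1 (st i h.+1) *: phi_v mu phi (Vk i h.+1) (st i h) (act i h).
Proof.
elim: n => [|n [IH1 IH2]]; first by rewrite !big_geq.
by rewrite ![\sum_(1 <= i < n.+2) _]big_nat_recr//= -IH1 -IH2.
Qed.

Hypothesis musf : sigma_finite setT mu.
Hypothesis H0 : (0 < H)%N.
Hypothesis lamE : lam = H%:R ^+ 2.
Hypothesis r01 : forall h x a, 0 <= r h x a <= 1.
Hypothesis mr : forall h a, measurable_fun setT (fun x => r h x a).
Hypothesis mphi : forall a i, measurable_fun setT (fun x : S * S => phi x.1 a x.2 i 0).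
Hypothesis iphi : forall x a i, mu.-integrable setT (fun x' => (phi x a x' i 0)%:E).
Hypothesis phi1 : forall v : S -> R, measurable_fun setT v -> (forall x, 0 <= v x <= 1) ->
  forall x a, norm2 (phi_v mu phi v x a) <= 1.
Hypothesis dens0 : forall h x a x', (1 <= h <= H)%N -> 0 <= trans_dens phi (w h) x a x'.
Hypothesis dens1 : forall h x a, (1 <= h <= H)%N ->
  (\int[mu]_(x' in setT) (trans_dens phi (w h) x a x')%:E = 1)%E.

Lemma lam_gt0 : 0 < lam.
Proof. by rewrite lamE exprn_gt0// ltr0n. Qed.

Lemma measurable_Vk k h : measurable_fun setT (Vk k h).
Proof. exact: measurable_Vtil_aux. Qed.

Lemma measurable_Vplus k h : measurable_fun setT (Vplus k h).
Proof. by apply: measurable_maxr; [exact: measurable_cst|exact: measurable_Vk]. Qed.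

Lemma Vplus_bounds k h x : 0 <= Vplus k h x <= H%:R.
Proof.
by rewrite /Vplus le_max lexx ge_max ler0n /=; exact: Vtil_aux_leH.
Qed.

Lemma feat_norm k h : dotv (feat k h) (feat k h) <= lam.
Proof.
rewrite lamE; apply: phi_v_norm => //; first exact: measurable_Vplus.
exact: Vplus_bounds.
Qed.

Lemma pol_fibers k h : (h <= H)%N -> measurable_fibers (pol k h).
Proof.
move=> hH a.
have h1 := @measurable_fibers_greedy R dS S mu musf A d phi H r mr mphi _ S a0
  (fun=> Lam_of lam B1 B2 (pre k.-1) k) (fun=> w_of lam B1 B2 g1 g2 (pre k.-1) k)
  (beta k) h (fun j _ => measurable_mx_cst (T := S) _)
  (fun j _ => measurable_mx_cst (T := S) _) hH a.
by have := pair1_measurable (point : S) measurableT h1; rewrite setTI.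
Qed.

Lemma Vpi_pol_facts k h : (1 <= h <= H.+1)%N ->
  measurable_fun setT (Vpi mu phi H r w (pol k) h) /\
  forall x, 0 <= Vpi mu phi H r w (pol k) h x <= H%:R.
Proof.
move=> /andP[h1 hH].
have [j|//||m b] := @Vpi_aux_facts R dS S mu musf A d phi H r w r01 mr mphi dens0 dens1
  (pol k) (H.+1 - h) h.
- by rewrite subnKC// => /andP[_ jH]; exact: pol_fibers.
- by rewrite subnKC.
split => // x; have /andP[b1 b2] := b x; rewrite b1 /=; apply: le_trans b2 _.
by rewrite ler_nat leq_subLR -add1n leq_add2r.
Qed.

(** * Deterministic consequences of the good event on one realisation *)

Section GoodTrajectory.
Variables (K : nat) (Cw p : R) (Ulow Uhigh C : nat -> R).
Hypothesis p0 : 0 < p.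
Hypothesis wC : forall h, (1 <= h <= H)%N -> norm2 (w h) <= Cw.
Hypothesis B12 : forall k h, (B1 k h)^T = B1 k h /\ (B2 k h)^T = B2 k h.
Hypothesis UC : forall k, 0 <= Ulow k /\ 0 <= Uhigh k /\ 0 <= C k.
Hypothesis eigB : forall k h, (1 <= k <= K)%N -> (1 <= h <= H)%N ->
  forall e, eigenvalue (Bpert B1 B2 k h) e -> Ulow k <= e <= Uhigh k.
Hypothesis gC : forall k h, (1 <= k <= K)%N -> (1 <= h <= H)%N ->
  norm2 (gpert g1 g2 k h) <= C k.
Hypothesis beta_mono : forall k1 k2, (1 <= k1)%N -> (k1 <= k2 <= K)%N -> beta k1 <= beta k2.
Hypothesis beta_ge : forall k, (1 <= k <= K)%N ->
  ((lam + Uhigh k) * Cw + C k) / Num.sqrt (lam + Ulow k)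
  + Num.sqrt (2 * H%:R ^+ 2 * ln (3 * H%:R * Num.sqrt ((1 + K%:R * H%:R) ^+ d) / p))
  <= beta k.
Hypothesis mix_lt : forall n h, (n < K)%N -> (1 <= h <= H)%N -> mix n h < 3 * H%:R / p.

Lemma Bpert_sym k h : (Bpert B1 B2 k h)^T = Bpert B1 B2 k h.
Proof.
case: k => [|[|k]] /=; rewrite ?trmx0// linearD linear_sum /= (B12 _ _).2; congr (_ + _).
by apply: eq_bigr => i _; rewrite (B12 _ _).1.
Qed.

Lemma Cw_ge0 : 0 <= Cw.
Proof. by apply: le_trans (norm2_ge0 (w 1)) _; apply: wC; rewrite leqnn. Qed.

Lemma beta_ge0 k : (1 <= k <= K)%N -> 0 <= beta k.
Proof.
move=> kK; apply: le_trans (beta_ge kK); have [u1 [u2 u3]] := UC k.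
have := lam_gt0; have := Cw_ge0 => Cw0 l0.
apply: addr_ge0; last exact: sqrtr_ge0.
apply: divr_ge0; last exact: sqrtr_ge0.
by apply: addr_ge0 => //; apply: mulr_ge0 => //; apply: addr_ge0 => //; exact: ltW.
Qed.

Definition confident k : Prop := forall h (v : S -> R) x a, (1 <= h <= H)%N ->
  measurable_fun setT v ->
  `|dotv (phi_v mu phi v x a) (w_of lam B1 B2 g1 g2 (pre k.-1) k h - w h)| <=
  beta k * mxnorm (invmx (Lam_of lam B1 B2 (pre k.-1) k h)) (phi_v mu phi v x a).

Lemma Vplus_eq k : (forall h x, (1 <= h <= H.+1)%N -> 0 <= Vk k h x) ->
  forall h, (1 <= h <= H)%N -> Vplus k h.+1 = Vk k h.+1.
Proof.
move=> V0 h /andP[h1 hH]; apply/funext => x; rewrite /Vplus.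
by apply/max_idPr; apply: V0; rewrite /= ltnS.
Qed.

Lemma next_mean_feat k h : (1 <= h <= H)%N ->
  next_mean k h (Vplus k h.+1) = dotv (feat k h) (w h).
Proof.
move=> hH; rewrite /feat (phi_v_mean mphi iphi (w h) _ _ (measurable_Vplus k h.+1) (c := H%:R))//.
by move=> x; have /andP[b1 b2] := Vplus_bounds k h.+1 x; rewrite ger0_norm.
Qed.

(** Past nonnegativity makes the truncation inactive, so the matrices and targets accumulated by the
    algorithm are those of the controlled noise process, and its bound transfers to the estimate. *)
Lemma confident_of_past k : (1 <= k <= K)%N ->
  (forall i, (1 <= i < k)%N -> forall h x, (1 <= h <= H.+1)%N -> 0 <= Vk i h x) ->
  confident k.
Proof.
move=> /andP[k1 kK] past h v x a hH mv.
have [e1 e2] := accE k.-1 h.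
have kk : k.-1.+1 = k by rewrite prednK.
have Veq i : (1 <= i < k)%N -> Vk i h.+1 = Vplus i h.+1.
  by move=> ik; rewrite (Vplus_eq (past i ik)).
have E1 : lam%:M + (pre k.-1 h).1 = feat_gram k.-1 h.
  rewrite e1 /feat_gram /gram; congr (_ + _); rewrite !big_nat; apply: eq_bigr => i.
  by rewrite kk => ik; rewrite /feat Veq.
have E2 : (pre k.-1 h).2 = (feat_gram k.-1 h - lam%:M) *m w h + noise k.-1 h.
  rewrite e2 /feat_gram /gram [lam%:M + _]addrC addrK mulmx_suml /noise -big_split /=.
  rewrite !big_nat; apply: eq_bigr => i; rewrite kk => ik.
  by rewrite Veq// outer_mulmx -scalerDl next_mean_feat// addrC subrK.
rewrite /w_of /Lam_of E1 E2.
have [u1 [u2 u3]] := UC k; have kK' : (1 <= k <= K)%N by rewrite k1.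
have l0 := lam_gt0.
have Mp := gram_posdef (feat^~ h) k.-1 l0.
have D0 : 0 < (1 + K%:R * H%:R) ^+ d :> R.
  by rewrite exprn_gt0// ltr_wpDr// mulr_ge0.
have kH : 0 < H%:R :> R by rewrite ltr0n.
(* The [k - 1] past features give the factor [k^d], which is relaxed to the quantity in the width
   condition. *)
have detb : 0 < \det (feat_gram k.-1 h) <= lam ^+ d * (1 + K%:R * H%:R) ^+ d.
  have /andP[d1 d2] := gram_det l0 (fun i (_ : (1 <= i <= k.-1)%N) => feat_norm i h).
  rewrite d1 /=; apply: le_trans d2 _; apply: ler_wpM2l; first by rewrite exprn_ge0// ltW.
  apply: lerXn2r; rewrite ?nnegrE ?addr_ge0 ?mulr_ge0// lerD2l -natrM ler_nat.
  by apply: (@leq_trans K); [rewrite -ltnS kk ltnW// ltnS|rewrite leq_pmulr].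
have noiseb : mxnorm (invmx (feat_gram k.-1 h)) (noise k.-1 h) <=
    Num.sqrt (2 * H%:R ^+ 2 * ln (3 * H%:R * Num.sqrt ((1 + K%:R * H%:R) ^+ d) / p)).
  rewrite [3 * H%:R * _ / p]mulrAC.
  apply: mixture_lt detb _ => //; first by rewrite exprn_gt0.
    by rewrite divr_gt0// mulr_gt0.
  by apply: mix_lt; rewrite ?kk.
have := @perturbed_regression_error R d (feat_gram k.-1 h) (Bpert B1 B2 k h) (w h)
  (noise k.-1 h) (gpert g1 g2 k h) (phi_v mu phi v x a) lam (Ulow k) (Uhigh k) Cw (C k)
  _ l0 u1 u2 Mp.1 (gram_ge _ _ _) (Bpert_sym k h) (eigB kK' hH) (wC hH) (gC kK' hH) noiseb.
move/le_trans; apply; apply: ler_wpM2r; first exact: mxnorm_ge0.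
exact: beta_ge.
Qed.

(** Resolves a circularity: confidence in episode [k] rests on nonnegativity in earlier episodes,
    and it in turn yields nonnegativity and optimism in episode [k]. *)
Lemma trajectory_optimism k : (1 <= k <= K)%N -> confident k /\
  (forall h, (1 <= h <= H.+1)%N -> (forall x, 0 <= Vk k h x) /\
    forall pi, (forall j, measurable_fibers (pi j)) ->
    forall x, Vpi mu phi H r w pi h x <= Vk k h x).
Proof.
elim/ltn_ind: k => k IH kK.
have ck : confident k.
  apply: confident_of_past => // i /andP[i1 ik] h x hH.
  have iK : (1 <= i <= K)%N by rewrite i1 (leq_trans (ltnW ik))//; case/andP: kK.
  by have [_ /(_ h hH)[V0 _]] := IH i ik iK; exact: V0.
split=> // h /andP[h1 hH].
have [V0 Vo] := @Vtil_optimistic R dS S mu musf A d phi H r w r01 mr mphi iphi dens0 dens1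
  a0 _ _ (beta k) ck (H.+1 - h) h h1 (subnKC hH).
by split=> [x|pi mpi x]; [exact: V0|exact: Vo].
Qed.

Lemma value_gap_step k h : (1 <= k <= K)%N -> (1 <= h <= H)%N ->
  Vk k h (st k h) - Vpi mu phi H r w (pol k) h (st k h) <=
  2 * beta k * mxnorm (invmx (feat_gram k.-1 h)) (feat k h) + gap_diff k h +
  (Vk k h.+1 (st k h.+1) - Vpi mu phi H r w (pol k) h.+1 (st k h.+1)).
Proof.
move=> kK hH; have /andP[h1 hH'] := hH.
have [ck opt] := trajectory_optimism kK.
have V0 h' x : (1 <= h' <= H.+1)%N -> 0 <= Vk k h' x.
  by move=> hh; have [+ _] := opt h' hh; apply.
have Veq := Vplus_eq V0 hH.
have [mVpi bVpi] := @Vpi_pol_facts k h.+1 hH'.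
have mVp := measurable_Vplus k h.+1.
have bVp := Vplus_bounds k h.+1.
have -> : gap_diff k h = next_mean k h (Vplus k h.+1) -
    next_mean k h (Vpi mu phi H r w (pol k) h.+1) -
    (Vk k h.+1 (st k h.+1) - Vpi mu phi H r w (pol k) h.+1 (st k h.+1)).
  rewrite /gap_diff {2}/value_gap Veq; congr (_ - _).
  rewrite /next_mean /value_gap -Veq; apply: (meanB _ _ _ _ _ (c := H%:R)) => //.
  - exact: measurable_rho.
  - by move=> y; exact: dens0.
  - exact: dens1.
  - by move=> y; have /andP[b1 b2] := bVp y; rewrite ger0_norm.
  - by move=> y; have /andP[b1 b2] := bVpi y; rewrite ger0_norm.
rewrite -addrA subrK.
have piE : Vpi mu phi H r w (pol k) h (st k h) =
    r h (st k h) (act k h) + next_mean k h (Vpi mu phi H r w (pol k) h.+1).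
  by rewrite {1}/Vpi subSn// /Vpi subSS.
rewrite piE.
have QE : Vk k h (st k h) = Qtil mu phi H r (Lam_of lam B1 B2 (pre k.-1) k h)
    (w_of lam B1 B2 g1 g2 (pre k.-1) k h) (beta k) h (Vplus k h.+1) (st k h) (act k h).
  by rewrite Veq /Vk /V_of Vtil_greedy.
have := @Qtil_le_mean R dS S mu A d phi H r w mphi iphi (Lam_of lam B1 B2 (pre k.-1) k)
  (w_of lam B1 B2 g1 g2 (pre k.-1) k) (beta k) ck h (Vplus k h.+1) (st k h) (act k h) hH mVp bVp.
rewrite -QE -/(next_mean k h (Vplus k h.+1)) -/(feat k h) => Qle.
have E1 : lam%:M + (pre k.-1 h).1 = feat_gram k.-1 h.
  have [e1 _] := accE k.-1 h.
  rewrite e1 /feat_gram /gram; congr (_ + _); rewrite !big_nat; apply: eq_bigr => i.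
  have kk : k.-1.+1 = k by case/andP: kK => k1 _; rewrite prednK.
  rewrite kk => /andP[i1 ik]; rewrite /feat (Vplus_eq _ hH)// => h' x hh.
  have iK : (1 <= i <= K)%N by rewrite i1 (leq_trans (ltnW ik))//; case/andP: kK.
  by have [_ /(_ h' hh)[+ _]] := trajectory_optimism iK; apply.
have l0 := lam_gt0.
(* The bonus is taken in the perturbed norm; since [Ulow] is nonnegative it is dominated by the
   unperturbed one, to which the elliptical potential applies. *)
have Lle : mxnorm (invmx (Lam_of lam B1 B2 (pre k.-1) k h)) (feat k h) <=
    mxnorm (invmx (feat_gram k.-1 h)) (feat k h).
  have Mp := gram_posdef (feat^~ h) k.-1 l0.
  rewrite /Lam_of E1; apply: mxnorm_invmx_anti => //.
    by rewrite linearD /= Mp.1 Bpert_sym.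
  move=> y; rewrite qf_addmx lerDl.
  apply: le_trans (qf_ge_eigenvalue y (Bpert_sym k h) (eigB kK hH)).
  by rewrite mulr_ge0 ?dotv_ge0//; case: (UC k).
have b0 : 0 <= 2 * beta k by rewrite mulr_ge0// beta_ge0.
have := ler_wpM2l b0 Lle.
move: Qle; set q := Vk k h _; set rr := r h _ _; set e1 := next_mean _ _ _.
set e2 := next_mean _ _ _; set t1 := 2 * beta k * _; set t2 := 2 * beta k * _.
move=> q1 t12; rewrite lerBlDr; apply: le_trans q1 _.
rewrite [leRHS](_ : _ = rr + e1 + t2); last by ring.
by rewrite lerD2l.
Qed.

Lemma episode_regret k : (1 <= k <= K)%N ->
  Vstar mu phi H r w 1 (st k 1%N) - Vpi mu phi H r w (pol k) 1 (st k 1%N) <=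
  \sum_(1 <= h < H.+1)
    (2 * beta k * mxnorm (invmx (feat_gram k.-1 h)) (feat k h) + gap_diff k h).
Proof.
move=> kK.
have [_ /(_ 1%N isT)[_ opt]] := trajectory_optimism kK.
have Vs : Vstar mu phi H r w 1 (st k 1%N) <= Vk k 1 (st k 1%N).
  apply: ge_sup.
    (* The supremum is over a nonempty set: constant policies are measurable. *)
    exists (Vpi mu phi H r w (fun _ _ => a0) 1 (st k 1%N)).
    exists (fun _ _ => a0) => // h a.
    have [->|aa] := eqVneq a0 a.
      rewrite (_ : _ @^-1` _ = setT)//; exact/seteqP.
    rewrite (_ : _ @^-1` _ = set0)//; apply/seteqP; split => // x /= /eqP.
    by rewrite (negbTE aa).
  by move=> _ [pi mpi <-]; apply: opt => j a; exact: mpi.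
apply: le_trans (lerB Vs (lexx _)) _.
have tele n h : (1 <= h)%N -> (h + n = H.+1)%N ->
    Vk k h (st k h) - Vpi mu phi H r w (pol k) h (st k h) <=
    \sum_(h <= j < H.+1)
      (2 * beta k * mxnorm (invmx (feat_gram k.-1 j)) (feat k j) + gap_diff k j).
  elim: n h => [|n IH] h h1 hn.
    have -> : h = H.+1 by rewrite -hn addn0.
    by rewrite big_geq// /Vk /V_of /Vtil /Vpi subnn /= subrr.
  have hH : (1 <= h <= H)%N by rewrite h1 /= -ltnS -hn addnS ltnS leq_addr.
  rewrite big_ltn; last by case/andP: hH.
  apply: le_trans (value_gap_step kK hH) _; rewrite lerD2l.
  by apply: IH => //; rewrite addSnnS.
exact: (tele H 1%N).
Qed.

Lemma regret_trajectory :
  regret mu phi H r w lam beta a0 st B1 B2 g1 g2 K <=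
  2 * beta K * (H%:R * Num.sqrt (K%:R * (2 * (d%:R * ln (1 + K%:R))))) +
  \sum_(1 <= k < K.+1) \sum_(1 <= h < H.+1) gap_diff k h.
Proof.
(* The sign of [beta K] is known only for [K >= 1]. *)
have [->|K0] := posnP K.
  rewrite /regret !big_geq// mul0r sqrtr0 !mulr0 add0r//.
have b0 : 0 <= beta K by apply: beta_ge0; rewrite K0 leqnn.
have l0 := lam_gt0.
apply: (@le_trans _ _ (\sum_(1 <= k < K.+1) \sum_(1 <= h < H.+1)
    (2 * beta K * mxnorm (invmx (feat_gram k.-1 h)) (feat k h) + gap_diff k h))).
  rewrite /regret !big_nat; apply: ler_sum => k kK.
  apply: le_trans (episode_regret kK) _; apply: ler_sum => h _.
  rewrite lerD2r; apply: ler_wpM2r; first exact: mxnorm_ge0.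
  by rewrite ler_wpM2l// beta_mono//; case/andP: kK => // k1; rewrite ltnS => ->; rewrite leqnn.
under eq_bigr do rewrite big_split /=.
rewrite big_split /= lerD2r exchange_big /=.
under eq_bigr do rewrite -mulr_sumr.
rewrite -mulr_sumr; apply: ler_wpM2l; first exact: mulr_ge0.
rewrite [leRHS](_ : _ = \sum_(1 <= h < H.+1)
   Num.sqrt (K%:R * (2 * (d%:R * ln (1 + K%:R))))); last first.
  by rewrite sumr_const_nat subn1 /= mulr_natl.
by apply: ler_sum => h _; apply: elliptical_sum => // i _; exact: feat_norm.
Qed.

End GoodTrajectory.
End Trajectory.

(** * Measurability of the algorithm *)

Section TrajectoryMeasurability.
Context {R : realType} {dS : measure_display} {S : measurableType dS}
  (mu : {measure set S -> \bar R}) (musf : sigma_finite setT mu) {A : finType} {d : nat}.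
Variables (phi : S -> A -> S -> 'cV[R]_d) (H : nat) (r : nat -> S -> A -> R)
  (w : nat -> 'cV[R]_d) (lam : R) (beta : nat -> R) (a0 : A).
Hypothesis mr : forall h a, measurable_fun setT (fun x => r h x a).
Hypothesis mphi : forall a i, measurable_fun setT (fun x : S * S => phi x.1 a x.2 i 0).

(** [T] will be [Omega] with its own sigma-algebra or with a history sigma-algebra. The hypotheses
    cover episodes before [k] only; the states of episode [k] itself are assumed measurable lemma by
    lemma, stage by stage. *)
Context dT (T : measurableType dT).
Variables (st : nat -> nat -> T -> S) (B1 B2 : nat -> nat -> T -> 'M[R]_d)
          (g1 g2 : nat -> nat -> T -> 'cV[R]_d).
Variable k : nat.
Hypothesis mst : forall i j, (1 <= i < k)%N -> (1 <= j <= H.+1)%N ->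
  measurable_fun setT (st i j).
Hypothesis mB : forall i j, (1 <= i < k)%N -> (1 <= j <= H)%N ->
  [/\ measurable_mx (B1 i j), measurable_mx (B2 i j),
      measurable_mx (g1 i j) & measurable_mx (g2 i j)].

Notation at_t F t := (F (fun i j => st i j t) (fun i j => B1 i j t) (fun i j => B2 i j t)
  (fun i j => g1 i j t) (fun i j => g2 i j t)).
Notation pret t := (at_t (acc mu phi H r lam beta a0) t).
Notation Vt t := (at_t (Vk mu phi H r lam beta a0) t).
Notation Vpt t := (at_t (Vplus mu phi H r lam beta a0) t).
Notation polt t := (at_t (pol mu phi H r lam beta a0) t).
Notation actt t := (at_t (act mu phi H r lam beta a0) t).
Notation featt t := (at_t (feat mu phi H r lam beta a0) t).
Notation Lamt_ t j h := (Lam_of lam (fun i j => B1 i j t) (fun i j => B2 i j t) (pret t j.-1) j h).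
Notation wt_ t j h := (w_of lam (fun i j => B1 i j t) (fun i j => B2 i j t)
  (fun i j => g1 i j t) (fun i j => g2 i j t) (pret t j.-1) j h).

Lemma measurable_mx_sum_nat m n (F : nat -> T -> 'M[R]_(m, n)) a b :
  (forall i, (a <= i < b)%N -> measurable_mx (F i)) ->
  measurable_mx (fun t => \sum_(a <= i < b) F i t).
Proof.
move=> mF.
have -> : (fun t => \sum_(a <= i < b) F i t) =
    (fun t => \sum_(a <= i < b) (if (a <= i < b)%N then F i t else 0)).
  by apply/funext => t; rewrite !big_nat; apply: eq_bigr => i ->.
apply: (@measurable_mx_sum _ _ _ _ _ _ _ (fun i t => if (a <= i < b)%N then F i t else 0)) => i /=.
have [ib|ib] := boolP (a <= i < b)%N; first exact: mF.
exact: measurable_mx_cst.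
Qed.

(** The perturbation in force in episode [j] involves only earlier episodes, so [j = k] is
    allowed. *)
Lemma measurable_Bpert j h : (1 <= j <= k)%N -> (1 <= h <= H)%N ->
  measurable_mx (fun t => Bpert (fun i j => B1 i j t) (fun i j => B2 i j t) j h) /\
  measurable_mx (fun t => gpert (fun i j => g1 i j t) (fun i j => g2 i j t) j h).
Proof.
case: j => [|[|j]] //; first by move=> _ _; split; exact: measurable_mx_cst.
move=> jk hH; have ij i : (1 <= i < j.+2)%N -> (1 <= i < k)%N.
  by move=> /andP[-> ij] /=; exact: leq_trans ij jk.
have [_ mb2 _ mg2] := mB (ij j.+1 (leqnn _)) hH.
split; apply: measurable_mxD => //; apply: measurable_mx_sum_nat => i /ij ik.
  by have [] := mB ik hH.
by have [] := mB ik hH.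
Qed.

Section Episode.
Variable j : nat.
Hypothesis jk : (1 <= j <= k)%N.
Hypothesis macc : forall h, (1 <= h <= H)%N ->
  measurable_mx (fun t => (pret t j.-1 h).1) /\ measurable_mx (fun t => (pret t j.-1 h).2).

Lemma measurable_Lam_w h : (1 <= h <= H)%N ->
  measurable_mx (fun t => Lamt_ t j h) /\ measurable_mx (fun t => wt_ t j h).
Proof.
move=> hH; have [m1 m2] := macc hH; have [mb mg] := measurable_Bpert jk hH.
have mL : measurable_mx (fun t => Lamt_ t j h).
  apply: measurable_mxD => //; apply: measurable_mxD => //; exact: measurable_mx_cst.
split=> //; apply: measurable_mxM; first exact: measurable_invmx.
exact: measurable_mxD.
Qed.

Lemma jointly_measurable_Vk h : (1 <= h <= H.+1)%N ->
  jointly_measurable (fun t => Vt t j h).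
Proof.
move=> /andP[h1 hH].
apply: (@jointly_measurable_Vtil_aux R dS S mu musf A d phi H r mr mphi _ T a0
  (fun t h => Lamt_ t j h) (fun t h => wt_ t j h) (beta j) (H.+1 - h) h) => i;
  rewrite subnKC// ltnS => /andP[hi iH].
  by have [] := measurable_Lam_w (h := i) _; rewrite // iH (leq_trans h1 hi).
by have [] := measurable_Lam_w (h := i) _; rewrite // iH (leq_trans h1 hi).
Qed.

Lemma jointly_measurable_Vplus h : (1 <= h <= H.+1)%N ->
  jointly_measurable (fun t => Vpt t j h).
Proof.
move=> hH; apply: measurable_maxr; first exact: measurable_cst.
exact: jointly_measurable_Vk.
Qed.

Lemma measurable_fibers_pol h : (1 <= h <= H)%N ->
  measurable_fibers (fun z : T * S => polt z.1 j h z.2).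
Proof.
move=> /andP[h1 hH].
apply: (@measurable_fibers_greedy R dS S mu musf A d phi H r mr mphi _ T a0
  (fun t h => Lamt_ t j h) (fun t h => wt_ t j h) (beta j) h) => // i /andP[hi iH].
  by have [] := measurable_Lam_w (h := i) _; rewrite // iH (leq_trans h1 hi).
by have [] := measurable_Lam_w (h := i) _; rewrite // iH (leq_trans h1 hi).
Qed.

Section Step.
Variable h : nat.
Hypotheses (hH : (1 <= h <= H)%N) (msth : measurable_fun setT (st j h)).

Lemma measurable_fibers_act : measurable_fibers (fun t => actt t j h).
Proof.
move=> a; have mh : measurable_fun setT (fun t : T => (t, st j h t)).
  by apply: measurable_fun_pair.
by have := mh measurableT _ (measurable_fibers_pol hH a); rewrite setTI.
Qed.

Lemma measurable_phi_act (V : T -> S -> R) : jointly_measurable V ->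
  measurable_mx (fun t => phi_v mu phi (V t) (st j h t) (actt t j h)).
Proof.
move=> mV x y.
apply: (measurable_fun_fibers (g := fun a t => phi_v mu phi (V t) (st j h t) a x y)).
  exact: measurable_fibers_act.
by move=> a; exact: measurable_phi_v.
Qed.

Let hS : (1 <= h.+1 <= H.+1)%N. Proof. by rewrite /= ltnS; case/andP: hH. Qed.

Lemma measurable_feat : measurable_mx (fun t => featt t j h).
Proof. by apply: measurable_phi_act; exact: jointly_measurable_Vplus. Qed.

Lemma measurable_rho_act :
  measurable_fun setT (fun z : T * S => trans_dens phi (w h) (st j h z.1) (actt z.1 j h) z.2).
Proof.
apply: (measurable_fun_fibers (f := fun z : T * S => actt z.1 j h)
  (g := fun a z => trans_dens phi (w h) (st j h z.1) a z.2)).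
  move=> a; have := @measurable_fst _ _ T S measurableT _ (measurable_fibers_act a).
  by rewrite setTI.
by move=> a; exact: measurable_trans_dens.
Qed.

Lemma measurable_next_mean (V : T -> S -> R) : jointly_measurable V ->
  measurable_fun setT (fun t => at_t (next_mean mu phi H r w lam beta a0) t j h (V t)).
Proof.
move=> mV; apply: (measurable_Rintegral_param musf
  (f := fun z => trans_dens phi (w h) (st j h z.1) (actt z.1 j h) z.2 * V z.1 z.2)).
by apply: measurable_funM => //; exact: measurable_rho_act.
Qed.

Lemma jointly_measurable_value_gap :
  jointly_measurable (fun t => at_t (value_gap mu phi H r w lam beta a0) t j h.+1).
Proof.
apply: measurable_funB; first exact: jointly_measurable_Vplus.
apply: (@jointly_measurable_Vpi_aux R dS S mu musf A d phi r mr mphi _ T w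
  (fun t => polt t j) (H.+1 - h.+1) h.+1) => i.
rewrite subnKC; last by case/andP: hS.
by rewrite ltnS => /andP[hi iH]; apply: measurable_fibers_pol; rewrite iH (leq_trans _ hi).
Qed.

Hypothesis msthS : measurable_fun setT (st j h.+1).

Lemma measurable_gap_diff_aux :
  measurable_fun setT (fun t => at_t (gap_diff mu phi H r w lam beta a0) t j h).
Proof.
apply: measurable_funB.
  by apply: measurable_next_mean; exact: jointly_measurable_value_gap.
exact: (jointly_measurable_diag jointly_measurable_value_gap msthS).
Qed.

Lemma measurable_acc_increment :
  measurable_mx (fun t => phi_v mu phi (Vt t j h.+1) (st j h t) (actt t j h)) /\
  measurable_fun setT (fun t => Vt t j h.+1 (st j h.+1 t)).
Proof.
split; first by apply: measurable_phi_act; exact: jointly_measurable_Vk.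
exact: (jointly_measurable_diag (jointly_measurable_Vk hS) msthS).
Qed.

Lemma measurable_noise_increment : measurable_mx (fun t =>
  (Vpt t j h.+1 (st j h.+1 t) - at_t (next_mean mu phi H r w lam beta a0) t j h (Vpt t j h.+1))
  *: featt t j h).
Proof.
apply: measurable_mxZ; last exact: measurable_feat.
apply: measurable_funB.
  exact: (jointly_measurable_diag (jointly_measurable_Vplus hS) msthS).
by apply: measurable_next_mean; exact: jointly_measurable_Vplus.
Qed.

End Step.
End Episode.

(** Discharges the assumption [macc] of the previous section: the statistics before an episode
    determine its policy and values, and these determine the next increment. *)
Lemma measurable_acc n : (n < k)%N -> forall h, (1 <= h <= H)%N ->
  measurable_mx (fun t => (pret t n h).1) /\ measurable_mx (fun t => (pret t n h).2).
Proof.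
elim: n => [|n IH] nk h hH; first by split; exact: measurable_mx_cst.
have [i1 i2] := IH (ltnW nk) h hH.
have nk' : (1 <= n.+1 <= k)%N by rewrite /= ltnW.
have h1 : (1 <= h)%N by case/andP: hH.
have hS : (1 <= h.+1 <= H.+1)%N by rewrite /= ltnS; case/andP: hH.
have hH' : (1 <= h <= H.+1)%N by rewrite h1 leqW//; case/andP: hH.
have [m1 m2] := measurable_acc_increment nk' (IH (ltnW nk)) hH
  (mst (i := n.+1) nk hH') (mst (i := n.+1) nk hS).
split; first by apply: measurable_mxD => //; apply: measurable_mxM => //;
  exact: measurable_mx_tr.
by apply: measurable_mxD => //; exact: measurable_mxZ.
Qed.

Lemma measurable_acc_pred j : (1 <= j <= k)%N -> forall h, (1 <= h <= H)%N ->
  measurable_mx (fun t => (pret t j.-1 h).1) /\ measurable_mx (fun t => (pret t j.-1 h).2).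
Proof.
by move=> /andP[j1 jk]; apply: measurable_acc; rewrite prednK.
Qed.

Lemma measurable_gap_diff i h : (1 <= i <= k)%N -> (1 <= h <= H)%N ->
  measurable_fun setT (st i h) -> measurable_fun setT (st i h.+1) ->
  measurable_fun setT (fun t => at_t (gap_diff mu phi H r w lam beta a0) t i h).
Proof. by move=> ik; exact: (measurable_gap_diff_aux ik (measurable_acc_pred ik)). Qed.

Lemma measurable_feat_gram_noise n h : (n < k)%N -> (1 <= h <= H)%N ->
  measurable_mx (fun t => at_t (feat_gram mu phi H r lam beta a0) t n h) /\
  measurable_mx (fun t => at_t (noise mu phi H r w lam beta a0) t n h).
Proof.
move=> nk hH; have h1 : (1 <= h)%N by case/andP: hH.
have hS : (1 <= h.+1 <= H.+1)%N by rewrite /= ltnS; case/andP: hH.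
have hH' : (1 <= h <= H.+1)%N by rewrite h1 leqW//; case/andP: hH.
have ik i : (1 <= i < n.+1)%N -> (1 <= i < k)%N.
  by move=> /andP[-> ij] /=; exact: leq_trans ij nk.
have ik' i : (1 <= i < k)%N -> (1 <= i <= k)%N by move=> /andP[-> /ltnW].
split.
  apply: measurable_mxD; first exact: measurable_mx_cst.
  apply: measurable_mx_sum_nat => i /ik ij.
  have mf := measurable_feat (ik' _ ij) (measurable_acc_pred (ik' _ ij)) hH (mst ij hH').
  by apply: measurable_mxM => //; exact: measurable_mx_tr.
apply: measurable_mx_sum_nat => i /ik ij.
exact: (measurable_noise_increment (ik' _ ij) (measurable_acc_pred (ik' _ ij)) hH
  (mst ij hH') (mst ij hS)).
Qed.

Lemma measurable_mixture m (kap c : R) (M : T -> 'M[R]_m) (z : T -> 'cV[R]_m) :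
  measurable_mx M -> measurable_mx z ->
  measurable_fun setT (fun t => mixture kap c (M t) (z t)).
Proof.
move=> mM mz; apply: measurable_funM.
  apply: measurable_sqrtr; apply: measurable_funM => //.
  by apply: measurable_funV; exact: measurable_det.
apply: measurableT_comp; first exact: measurable_expR.
by apply: measurable_funM => //; apply: measurable_qf => //; exact: measurable_invmx.
Qed.

Lemma measurable_mix n h : (n < k)%N -> (1 <= h <= H)%N ->
  measurable_fun setT (fun t => at_t (mix mu phi H r w lam beta a0) t n h).
Proof.
by move=> nk hH; have [m1 m2] := measurable_feat_gram_noise nk hH; exact: measurable_mixture.
Qed.

End TrajectoryMeasurability.

Lemma integral_probability_one dO (Omega : measurableType dO) (R : realType)
    (P : probability Omega R) : (\int[P]_o (cst 1 o) = 1)%E.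
Proof.
transitivity (1%:E * P setT)%E; first exact: integral_cst.
by rewrite probability_setT mule1.
Qed.

(** One logarithm absorbs all others: [y = H K / p] dominates both [K] and [1 / p], and
    [1 + ln y = ln (e y)] leaves room for the numerical factors. Since it is at least 1, its square
    root is bounded by itself. *)
Lemma regret_bound_arith (R : realType) (d H K : nat) (p b : R) :
  (0 < H)%N -> (0 < K)%N -> 0 < p < 1 -> 0 <= b ->
  2 * b * (H%:R * Num.sqrt (K%:R * (2 * (d%:R * ln (1 + K%:R))))) +
    Num.sqrt (8 * H%:R ^+ 3 * K%:R * ln (3 / p)) <=
  4%:R * (1 + ln (H%:R * K%:R / p)) ^+ 1 *
    (H%:R * Num.sqrt d%:R * b + H%:R * Num.sqrt H%:R) * Num.sqrt K%:R.
Proof.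
move=> H0 K0 /andP[p0 p1] b0; rewrite expr1.
have h1 : 1 <= H%:R :> R by rewrite ler1n.
have k1 : 1 <= K%:R :> R by rewrite ler1n.
have hp : 0 < H%:R :> R by rewrite ltr0n.
have kp : 0 < K%:R :> R by rewrite ltr0n.
pose y : R := H%:R * K%:R / p.
have hk1 : 1 <= H%:R * K%:R :> R by rewrite mulr_ege1.
have yK : K%:R <= y.
  rewrite /y ler_pdivlMr//; apply: (@le_trans _ _ K%:R); first by rewrite ler_piMr ?ltW.
  by rewrite ler_peMl ?(ltW kp).
have yp : p^-1 <= y by rewrite /y ler_peMl// invr_ge0 ltW.
have y1 : 1 <= y by exact: le_trans yK.
have y0 : 0 < y by exact: lt_le_trans y1.
pose l := 1 + ln y; have l1 : 1 <= l by rewrite /l lerDl ln_ge0.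
have e2 : 2 <= expR 1 :> R by apply: le_trans (expR_ge1Dx 1).
have lE : l = ln (expR 1 * y) by rewrite lnM ?posrE ?expR_gt0// expRK.
have e0 : 0 < expR 1 * y by exact: mulr_gt0 (expR_gt0 1) y0.
have k2 : 0 < 1 + K%:R :> R by exact: addr_gt0.
have lnKl : ln (1 + K%:R) <= l.
  rewrite lE ler_ln ?posrE//.
  apply: (@le_trans _ _ (2 * y)); last by rewrite ler_pM2r.
  by rewrite [2 * y]mulr_natl mulr2n; exact: lerD.
have lnK0 : 0 <= ln (1 + K%:R) :> R by rewrite ln_ge0// lerDl ltW.
(* Through [3 / p <= 4 y <= (2 y)^2 <= (e y)^2]. *)
have lnp : ln (3 / p) <= 2 * l.
  have -> : 2 * l = ln ((expR 1 * y) ^+ 2).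
    by rewrite lE lnXn ?e0//= ?mulr_natl.
  have p3 : 0 < 3 / p by exact: divr_gt0.
  rewrite ler_ln ?posrE ?(exprn_gt0 2 e0)//.
  apply: (@le_trans _ _ ((2 * y) ^+ 2)).
    rewrite exprMn; apply: (@le_trans _ _ (2 ^+ 2 * y)).
      apply: ler_pM => //; first by rewrite invr_ge0 ltW.
      by rewrite -natrX ler_nat.
    by apply: ler_wpM2l; [exact: sqr_ge0|rewrite expr2 ler_peMl// ltW].
  have y2 : 0 <= 2 * y by rewrite mulr_ge0// ltW.
  have y3 : 2 * y <= expR 1 * y by rewrite ler_pM2r.
  by rewrite !expr2; apply: ler_pM.
have lp : 0 <= l by exact: le_trans l1.
have sl (z : R) : 1 <= z -> Num.sqrt z <= z.
  move=> z1; have z0 : 0 <= z by exact: le_trans z1.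
  by rewrite -{2}(sqr_sqrtr z0) expr2 ler_peMr ?sqrtr_ge0// -sqrtr1 ler_wsqrtr.
have A1 : Num.sqrt (K%:R * (2 * (d%:R * ln (1 + K%:R)))) <=
    Num.sqrt K%:R * (Num.sqrt d%:R * (2 * l)).
  have -> : K%:R * (2 * (d%:R * ln (1 + K%:R))) =
      K%:R * (d%:R * (2 * ln (1 + K%:R))) :> R by ring.
  rewrite sqrtrM ?ler0n// sqrtrM ?ler0n//.
  apply: ler_wpM2l; first exact: sqrtr_ge0.
  apply: ler_wpM2l; first exact: sqrtr_ge0.
  apply: (@le_trans _ _ (Num.sqrt (2 * l))); first by apply: ler_wsqrtr; rewrite ler_pM2l// lnKl.
  by apply: sl; rewrite mulr_ege1// ler1n.
have A2 : Num.sqrt (8 * H%:R ^+ 3 * K%:R * ln (3 / p)) <=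
    4 * l * (H%:R * Num.sqrt H%:R * Num.sqrt K%:R).
  apply: (@le_trans _ _ (Num.sqrt ((4 * H%:R) ^+ 2 * (H%:R * (K%:R * l))))).
    apply: ler_wsqrtr.
    have -> : (4 * H%:R) ^+ 2 * (H%:R * (K%:R * l)) =
      8 * H%:R ^+ 3 * K%:R * (2 * l) by ring.
    by apply: ler_wpM2l => //; rewrite !mulr_ge0// exprn_ge0.
  rewrite sqrtrM ?sqr_ge0// sqrtr_sqr ger0_norm ?mulr_ge0//.
  rewrite sqrtrM ?ler0n// sqrtrM ?ler0n//.
  have -> : 4 * l * (H%:R * Num.sqrt H%:R * Num.sqrt K%:R) =
     4 * H%:R * (Num.sqrt H%:R * (Num.sqrt K%:R * l)) by ring.
  apply: ler_wpM2l; first by rewrite mulr_ge0.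
  by rewrite !ler_wpM2l ?sqrtr_ge0// sl.
rewrite -/y -/l.
have -> : 4%:R * l * (H%:R * Num.sqrt d%:R * b + H%:R * Num.sqrt H%:R) * Num.sqrt K%:R =
  2 * b * (H%:R * (Num.sqrt K%:R * (Num.sqrt d%:R * (2 * l)))) +
  4 * l * (H%:R * Num.sqrt H%:R * Num.sqrt K%:R) by ring.
apply: lerD => //; apply: ler_wpM2l; first by rewrite mulr_ge0.
by apply: ler_wpM2l.
Qed.

(** * High-probability events *)

Section HighProbability.
Context {R : realType} {dS : measure_display} {S : measurableType dS}
  (mu : {measure set S -> \bar R}) {A : finType} {d : nat}.
Variables (phi : S -> A -> S -> 'cV[R]_d) (H K : nat) (r : nat -> S -> A -> R)
  (w : nat -> 'cV[R]_d) (beta : nat -> R) (a0 : A).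
Context {dO : measure_display} {Omega : measurableType dO} (P : probability Omega R).
Variables (s : nat -> nat -> Omega -> S)
    (B1 B2 : nat -> nat -> Omega -> 'M[R]_d) (g1 g2 : nat -> nat -> Omega -> 'cV[R]_d).
Let lam : R := H%:R ^+ 2.
Hypothesis H0 : (0 < H)%N.
Hypothesis musf : sigma_finite setT mu.
Hypothesis r01 : forall h x a, 0 <= r h x a <= 1.
Hypothesis mr : forall h a, measurable_fun setT (fun x => r h x a).
Hypothesis mphi : forall a i, measurable_fun setT (fun x : S * S => phi x.1 a x.2 i 0).
Hypothesis dens0 : forall h x a x', (1 <= h <= H)%N -> 0 <= trans_dens phi (w h) x a x'.
Hypothesis dens1 : forall h x a, (1 <= h <= H)%N ->
  (\int[mu]_(x' in setT) (trans_dens phi (w h) x a x')%:E = 1)%E.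
Hypothesis ms : forall k h, measurable_fun setT (s k h).
Hypothesis mBg : forall k h (x y : 'I_d),
     measurable_fun setT (fun o => B1 k h o x y) /\
     measurable_fun setT (fun o => B2 k h o x y) /\
     measurable_fun setT (fun o => g1 k h o x 0) /\
     measurable_fun setT (fun o => g2 k h o x 0).

Notation at_o F o := (F (fun i j => s i j o) (fun i j => B1 i j o) (fun i j => B2 i j o)
  (fun i j => g1 i j o) (fun i j => g2 i j o)).
Notation acto o := (at_o (act mu phi H r lam beta a0) o).
Notation Vpo o := (at_o (Vplus mu phi H r lam beta a0) o).
Notation feato o := (at_o (feat mu phi H r lam beta a0) o).
Notation gapo o := (at_o (gap_diff mu phi H r w lam beta a0) o).
Notation mixo o := (at_o (mix mu phi H r w lam beta a0) o).
Notation valgapo o := (at_o (value_gap mu phi H r w lam beta a0) o).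
Notation nexto o := (at_o (next_mean mu phi H r w lam beta a0) o).

Hypothesis transition : forall k h, (1 <= k <= K)%N -> (1 <= h <= H)%N ->
  forall E, <<s history H s B1 B2 g1 g2 k h >> E ->
  forall Bs : set S, measurable Bs ->
  P (E `&` s k h.+1 @^-1` Bs) =
  (\int[P]_(o in E) trans_prob mu phi (w h) (s k h o) (acto o k h) Bs)%E.

Notation F k h := (g_sigma_algebraType (history H s B1 B2 g1 g2 k h)).

Lemma history_measurable k h : history H s B1 B2 g1 g2 k h `<=` measurable.
Proof.
move=> E [[|]|].
- by move=> [i [j [Bs [mBs [_ [_ [_ ->]]]]]]]; rewrite -[X in measurable X]setTI; exact: ms.
- move=> [i [j [x [y [Br [mBr [_ [_ [->|->]]]]]]]]]; rewrite -[X in measurable X]setTI;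
    by have [m1 [m2 _]] := mBg i j x y; first [exact: m1|exact: m2].
- move=> [i [j [x [Br [mBr [_ [_ [->|->]]]]]]]]; rewrite -[X in measurable X]setTI;
    by have [_ [_ [m1 m2]]] := mBg i j x x; first [exact: m1|exact: m2].
Qed.

Lemma measurable_to_history k h : measurable_fun setT (fun o : Omega => (o : F k h)).
Proof.
move=> _ E mE; rewrite setTI preimage_id.
exact: (smallest_sub (@sigma_algebra_measurable _ Omega) (@history_measurable k h) mE).
Qed.

Lemma measurable_history_state k h i j : (1 <= i)%N -> (1 <= j <= H.+1)%N ->
  (i < k)%N \/ (i = k /\ (j <= h)%N) ->
  measurable_fun setT (s i j : F k h -> S).
Proof.
move=> i1 jH ij _ B mB; rewrite setTI; apply: sub_sigma_algebra; left; left.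
by exists i, j, B.
Qed.

Lemma measurable_history_past k h i j : (1 <= i < k)%N -> (1 <= j <= H.+1)%N ->
  measurable_fun setT (s i j : F k h -> S).
Proof. by move=> /andP[i1 ik] jH; apply: measurable_history_state => //; left. Qed.

Lemma measurable_history_noise k h i j : (1 <= i < k)%N -> (1 <= j <= H)%N ->
  [/\ @measurable_mx R _ (F k h) _ _ (B1 i j), @measurable_mx R _ (F k h) _ _ (B2 i j),
      @measurable_mx R _ (F k h) _ _ (g1 i j) & @measurable_mx R _ (F k h) _ _ (g2 i j)].
Proof.
move=> ik jH; split => x y _ B mB; rewrite setTI; apply: sub_sigma_algebra.
- by left; right; exists i, j, x, y, B; do 3 (split => //); left.
- by left; right; exists i, j, x, y, B; do 3 (split => //); right.
- by right; exists i, j, x, B; do 3 (split => //); left; rewrite (ord1 y).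
- by right; exists i, j, x, B; do 3 (split => //); right; rewrite (ord1 y).
Qed.

(** The conditioning variable is the identity from [Omega] to [F k h], so [E] ranges over the
    history events and [transition] is exactly the required conditional law. *)
Lemma history_step k h (E : set (F k h)) (f : F k h * S -> R) (g : F k h -> R) :
  (1 <= k <= K)%N -> (1 <= h <= H)%N ->
  measurable E -> measurable_fun setT f -> (forall z, 0 <= f z) -> measurable_fun setT g ->
  (forall t, (\int[mu]_x (f (t, x) *
      trans_dens phi (w h) (s k h t) (acto t k h) x)%:E <= (g t)%:E)%E) ->
  (\int[P]_(o in E) (f (o, s k h.+1 o))%:E <= \int[P]_(o in E) (g o)%:E)%E.
Proof.
move=> kK hH mE mf f0 mg fg.
have kk : (1 <= k <= k)%N by rewrite leqnn andbT; case/andP: kK.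
have hH' : (1 <= h <= H.+1)%N by case/andP: hH => -> /leqW.
have msk : measurable_fun setT (s k h : F k h -> S).
  by apply: measurable_history_state => //; [case/andP: kK|right].
have mrho : measurable_fun setT (fun z : F k h * S =>
    trans_dens phi (w h) (s k h z.1) (acto z.1 k h) z.2).
  exact: (@measurable_rho_act R dS S mu musf A d phi H r w lam beta a0 mr mphi _ (F k h)
    s B1 B2 g1 g2 k (@measurable_history_noise k h) k kk
    (measurable_acc_pred musf lam beta a0 mr mphi (@measurable_history_past k h)
      (@measurable_history_noise k h) kk) h hH msk).
have := @supermartingale_step dO Omega R P _ (F k h) dS S mu musf (fun o => o) (s k h.+1)
  (fun z => trans_dens phi (w h) (s k h z.1) (acto z.1 k h) z.2)
  (@measurable_to_history k h) (ms k h.+1) mrho _ _ E f g mE mf f0 mg fg.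
apply; first by move=> z; exact: dens0.
move=> E' B mE' mB; rewrite preimage_id.
exact: transition.
Qed.

(** For a fixed stage the process moves once per episode: [mix n] is known under [F n.+1 h], and the
    only fresh variable in [mix n.+1] is the next state. Truncation puts the values in [[0, H]] on
    every outcome, so the one-step bound holds without any good event. *)
Lemma noise_bound_step (a : R) n h : (n.+1 < K)%N -> (1 <= h <= H)%N ->
  (\int[P]_(o in below (fun n o => mixo o n h) a n) (mixo o n.+1 h)%:E <=
   \int[P]_(o in below (fun n o => mixo o n h) a n) (mixo o n h)%:E)%E.
Proof.
move=> nK hH; pose k := n.+1.
have kK : (1 <= k <= K)%N by exact: ltnW.
have kk : (1 <= k <= k)%N by rewrite leqnn.
have hS : (1 <= h.+1 <= H.+1)%N by rewrite /= ltnS; case/andP: hH.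
have hH' : (1 <= h <= H.+1)%N by case/andP: hH => -> /leqW.
have msk : measurable_fun setT (s k h : F k h -> S).
  by apply: measurable_history_state => //; right.
have mst := @measurable_history_past k h.
have mB := @measurable_history_noise k h.
have macc := measurable_acc_pred musf lam beta a0 mr mphi mst mB kk.
have mE : measurable (below (fun n (t : F k h) => mixo t n h) a n).
  apply: (@measurable_below _ (F k h) R n (fun n (t : F k h) => mixo t n h) a _ n (leqnn n)).
  by move=> j jn; apply: (measurable_mix musf w lam beta a0 mr mphi mst mB _ hH); rewrite ltnS.
have [mG mN] := measurable_feat_gram_noise musf w lam beta a0 mr mphi mst mB (leqnn k) hH.
have mX : measurable_mx (fun t : F k h => feato t k h).
  exact: (measurable_feat musf mr mphi mB kk macc hH msk).
have mV : jointly_measurable (fun t : F k h => Vpo t k h.+1).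
  exact: (jointly_measurable_Vplus musf mr mphi mB kk macc hS).
have mm : measurable_fun setT (fun t : F k h => nexto t k h (Vpo t k h.+1)).
  exact: (measurable_next_mean musf w mr mphi mB kk macc hH msk mV).
pose f (z : F k h * S) := mixture (lam ^+ d) H%:R
  (at_o (feat_gram mu phi H r lam beta a0) z.1 n h + feato z.1 k h *m (feato z.1 k h)^T)
  (at_o (noise mu phi H r w lam beta a0) z.1 n h +
    (Vpo z.1 k h.+1 z.2 - nexto z.1 k h (Vpo z.1 k h.+1)) *: feato z.1 k h).
have mf : measurable_fun setT f.
  have mX1 := measurable_mx_comp (@measurable_fst _ _ (F k h) S) mX.
  apply: measurable_mixture.
    apply: measurable_mxD; first exact: (measurable_mx_comp measurable_fst mG).
    by apply: measurable_mxM => //; exact: measurable_mx_tr.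
  apply: measurable_mxD; first exact: (measurable_mx_comp measurable_fst mN).
  apply: measurable_mxZ => //; apply: measurable_funB => //.
  exact: (measurableT_comp mm measurable_fst).
have f0 z : 0 <= f z by rewrite /f /mixture mulr_ge0 ?sqrtr_ge0 ?expR_ge0.
have mg : measurable_fun setT (fun t : F k h => mixo t n h).
  exact: (measurable_mix musf w lam beta a0 mr mphi mst mB (leqnn k) hH).
have lam0 : 0 < lam by rewrite exprn_gt0// ltr0n.
have fE o : mixo o n.+1 h = f (o, s k h.+1 o).
  rewrite /f /mix; congr (mixture _ _ _ _); first by rewrite /feat_gram gramS.
  by rewrite /noise big_nat_recr.
have fg t : (\int[mu]_x (f (t, x) *
      trans_dens phi (w h) (s k h t) (acto t k h) x)%:E <= (mixo t n h)%:E)%E.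
  have gp := gram_posdef ((at_o (feat mu phi H r lam beta a0) t)^~ h) n lam0.
  have hbn y : 0 <= Vpo t k h.+1 y <= 0 + H%:R by rewrite add0r; exact: Vplus_bounds.
  have hp : 0 < H%:R :> R by rewrite ltr0n.
  have gd : 0 < \det (at_o (feat_gram mu phi H r lam beta a0) t n h).
    exact: det_posdef_gt0.
  have mVt : measurable_fun setT (Vpo t k h.+1) := jointly_measurable_section t mV.
  have Q := @mixture_supermartingale R dS S mu (trans_dens phi (w h) (s k h t) (acto t k h))
    (measurable_rho mphi (w h) _ _) (fun y => dens0 _ _ y hH) (dens1 _ _ hH) d (lam ^+ d) 0 H%:R
    (at_o (feat_gram mu phi H r lam beta a0) t n h) (feato t k h)
    (at_o (noise mu phi H r w lam beta a0) t n h) (Vpo t k h.+1)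
    (exprn_gt0 _ lam0) hp gp gd mVt hbn.
  exact Q.
have := history_step kK hH mE mf f0 mg fg.
by under [X in (X <= _)%E -> _]eq_integral do rewrite -fE.
Qed.

(** The time index stops at [K.-1] because episode [k] uses the data of the [k - 1] episodes before
    it. *)
Lemma noise_event (a : R) h : (0 < K)%N -> (1 <= h <= H)%N -> 0 < a ->
  measurable (below (fun n o => mixo o n h) a K.-1) /\
  (a%:E * P (~` below (fun n o => mixo o n h) a K.-1) <= 1)%E.
Proof.
move=> K0 hH ap.
have mM n : (n <= K.-1)%N -> measurable_fun setT (fun o => mixo o n h).
  move=> nK.
  have mB i j : (1 <= i < K)%N -> (1 <= j <= H)%N ->
      [/\ measurable_mx (B1 i j), measurable_mx (B2 i j),
      measurable_mx (g1 i j) & measurable_mx (g2 i j)].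
    move=> _ _; split => x y; rewrite ?(ord1 y).
    - by have [] := mBg i j x y.
    - by have [_ []] := mBg i j x y.
    - by have [_ [_ []]] := mBg i j x x.
    - by have [_ [_ []]] := mBg i j x x.
  apply: (measurable_mix musf w lam beta a0 mr mphi (k := K) _ mB _ hH) => //.
  by rewrite -(prednK K0) ltnS.
split.
  exact: (@measurable_below _ Omega R K.-1 (fun n o => mixo o n h) a mM K.-1 (leqnn _)).
have M0 n o : 0 <= mixo o n h.
  by rewrite /mix /mixture; apply: mulr_ge0; [exact: sqrtr_ge0|exact: expR_ge0].
have step n : (n < K.-1)%N ->
    (\int[P]_(o in below (fun n o => mixo o n h) a n) (mixo o n.+1 h)%:E <=
     \int[P]_(o in below (fun n o => mixo o n h) a n) (mixo o n h)%:E)%E.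
  by move=> nK; apply: noise_bound_step; [rewrite -(prednK K0) ltnS|exact: hH].
have init : (\int[P]_o (mixo o 0 h)%:E <= 1)%E.
  rewrite -(integral_probability_one P).
  have E1 o : mixo o 0 h = 1.
    rewrite /mix /mixture /feat_gram gram0 /noise big_geq// det_scalar divff; last first.
      by rewrite gt_eqF// !exprn_gt0// ltr0n.
    by rewrite sqrtr1 /qf mulmx0 /dotv mulmx0 mxE mul0r expR0 mulr1.
  by under eq_integral do rewrite E1.
exact: (@Ville_ineq _ Omega R P K.-1 (fun n o => mixo o n h) a mM M0 ap step init).
Qed.

Lemma measurable_sum_nat dT (T : measurableType dT) (G : nat -> T -> R) a b :
  (forall i, (a <= i < b)%N -> measurable_fun setT (G i)) ->
  measurable_fun setT (fun t => \sum_(a <= i < b) G i t).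
Proof.
move=> mG.
have -> : (fun t => \sum_(a <= i < b) G i t) =
    (fun t => \sum_(a <= i < b) (if (a <= i < b)%N then G i t else 0)).
  by apply/funext => t; rewrite !big_nat; apply: eq_bigr => i ->.
apply: (@measurable_sum _ _ _ _ _ _ (fun i t => if (a <= i < b)%N then G i t else 0)) => i /=.
have [ib|ib] := boolP (a <= i < b)%N; first exact: mG.
exact: measurable_cst.
Qed.

(** Partial sums in the order of the transitions: [k] complete episodes, then [h] stages of episode
    [k + 1], in all [k * H + h] differences. *)
Definition gap_sum k h (o : Omega) : R :=
  \sum_(1 <= i < k.+1) \sum_(1 <= j < H.+1) gapo o i j + \sum_(1 <= j < h.+1) gapo o k.+1 j.

Lemma gap_sum_step (th : R) k h : (k < K)%N -> (h < H)%N ->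
  let c := th ^+ 2 * (H%:R + H%:R) ^+ 2 / 2 in
  (\int[P]_o (expR (th * gap_sum k h o))%:E <= (expR (c * (k * H + h)%:R))%:E)%E ->
  (\int[P]_o (expR (th * gap_sum k h.+1 o))%:E <= (expR (c * (k * H + h.+1)%:R))%:E)%E.
Proof.
move=> kK hH c IH; pose k1 := k.+1; pose h1 := h.+1.
have kK1 : (1 <= k1 <= K)%N by [].
have kk : (1 <= k1 <= k1)%N by rewrite leqnn.
have hH1 : (1 <= h1 <= H)%N by [].
have msk j : (1 <= j <= h1)%N -> measurable_fun setT (s k1 j : F k1 h1 -> S).
  move=> /andP[j1 jh]; apply: measurable_history_state => //; last by right.
  by rewrite j1 leqW// (leq_trans jh).
have mst := @measurable_history_past k1 h1.
have mB := @measurable_history_noise k1 h1.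
have macc := measurable_acc_pred musf lam beta a0 mr mphi mst mB kk.
have mS : measurable_fun setT (gap_sum k h : F k1 h1 -> R).
  apply: measurable_funD.
    apply: measurable_sum_nat => i /andP[i1 ik]; apply: measurable_sum_nat => j /andP[j1 jH].
    apply: (measurable_gap_diff musf w lam beta a0 mr mphi mst mB).
    - by rewrite i1 ltnW.
    - by rewrite j1.
    - by apply: mst; rewrite ?i1 ?j1// leqW.
    - by apply: mst; rewrite ?i1.
  apply: measurable_sum_nat => j /andP[j1 jh].
  apply: (measurable_gap_diff musf w lam beta a0 mr mphi mst mB kk).
  - by rewrite j1 (leq_trans _ hH)// ltnW.
  - by apply: msk; rewrite j1 ltnW.
  - by apply: msk.
have mD : jointly_measurable (fun t : F k1 h1 => valgapo t k1 h1.+1).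
  exact: (jointly_measurable_value_gap musf w mr mphi mB kk macc hH1).
have mm : measurable_fun setT (fun t : F k1 h1 => nexto t k1 h1 (valgapo t k1 h1.+1)).
  exact: (measurable_next_mean musf w mr mphi mB kk macc hH1 (msk h1 (leqnn _)) mD).
have mE : measurable_fun setT (fun t : F k1 h1 => expR (th * gap_sum k h t)).
  apply: measurableT_comp; first exact: measurable_expR.
  exact: measurable_funM.
(* The new difference is minus the centred gap, whence the parameter [- th]. *)
pose f (z : F k1 h1 * S) := expR (th * gap_sum k h z.1) *
  expR (- th * (valgapo z.1 k1 h1.+1 z.2 - nexto z.1 k1 h1 (valgapo z.1 k1 h1.+1))).
have mf : measurable_fun setT f.
  apply: measurable_funM; first exact: (measurableT_comp mE measurable_fst).
  apply: measurableT_comp; first exact: measurable_expR.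
  apply: measurable_funM => //; apply: measurable_funB => //.
  exact: (measurableT_comp mm measurable_fst).
have f0 z : 0 <= f z by rewrite mulr_ge0 ?expR_ge0.
pose g (t : F k1 h1) := expR (th * gap_sum k h t) * expR c.
have mg : measurable_fun setT g by exact: measurable_funM.
have fE o : expR (th * gap_sum k h.+1 o) = f (o, s k1 h1.+1 o).
  have -> : gap_sum k h.+1 o = gap_sum k h o + gapo o k1 h1.
    by rewrite /gap_sum [X in _ + X = _]big_nat_recr//= addrA.
  rewrite mulrDr expRD; congr (_ * expR _).
  by rewrite mulNr -mulrN opprB.
have fg t : (\int[mu]_x (f (t, x) *
      trans_dens phi (w h1) (s k1 h1 t) (acto t k1 h1) x)%:E <= (g t)%:E)%E.
  set v := valgapo t k1 h1.+1.
  have [mVpi bVpi] := @Vpi_pol_facts R dS S mu A d phi H r w lam beta a0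
    (fun i j => s i j t) (fun i j => B1 i j t) (fun i j => B2 i j t)
    (fun i j => g1 i j t) (fun i j => g2 i j t) musf r01 mr mphi dens0 dens1 k1 h1.+1 hH.
  have mv : measurable_fun setT v by exact: (jointly_measurable_section t mD).
  have bv y : - H%:R <= v y <= - H%:R + (H%:R + H%:R).
    have /andP[b1 b2] := bVpi y.
    have /andP[b3 b4] := Vplus_bounds mu phi H r lam beta a0 (fun i j => s i j t)
      (fun i j => B1 i j t) (fun i j => B2 i j t)
      (fun i j => g1 i j t) (fun i j => g2 i j t) k1 h1.+1 y.
    rewrite addKr; apply/andP; split.
      by rewrite lerNl opprB lerBlDr; apply: le_trans b2 _; rewrite lerDl.
    by rewrite lerBlDr; apply: le_trans b4 _; rewrite lerDl.
  have HH : 0 < H%:R + H%:R :> R by rewrite addr_gt0// ltr0n.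
  have := @subgaussian R dS S mu _ (measurable_rho mphi (w h1) (s k1 h1 t) (acto t k1 h1))
    (fun y => dens0 _ _ y hH1) (dens1 _ _ hH1) v _ _ (- th) mv HH bv.
  rewrite sqrrN -/c => sg.
  have E1 : (\int[mu]_x (f (t, x) * trans_dens phi (w h1) (s k1 h1 t) (acto t k1 h1) x)%:E =
     \int[mu]_x ((expR (th * gap_sum k h t))%:E * (expR (- th * (v x -
       mean mu (trans_dens phi (w h1) (s k1 h1 t) (acto t k1 h1)) v)) *
       trans_dens phi (w h1) (s k1 h1 t) (acto t k1 h1) x)%:E))%E.
    by apply: eq_integral => x _; rewrite -EFinM /f mulrA.
  rewrite E1 ge0_integralZl//; last 2 first.
  - apply/measurable_EFinP; apply: measurable_funM; last exact: measurable_rho.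
    apply: measurableT_comp; first exact: measurable_expR.
    by apply: measurable_funM => //; exact: measurable_funB.
  - by move=> x _; rewrite lee_fin mulr_ge0 ?expR_ge0// dens0.
  by rewrite /g EFinM; apply: lee_wpmul2l => //; rewrite lee_fin expR_ge0.
have := history_step kK1 hH1 measurableT mf f0 mg fg.
under [X in (X <= _)%E -> _]eq_integral do rewrite -fE.
move/le_trans; apply.
have mEO : measurable_fun setT (fun o : Omega => expR (th * gap_sum k h o)).
  exact: (measurableT_comp mE (@measurable_to_history k1 h1)).
rewrite /g.
under eq_integral do rewrite EFinM muleC.
have mEOe : measurable_fun setT (fun o : Omega => (expR (th * gap_sum k h o))%:E).
  exact/measurable_EFinP.
rewrite ge0_integralZl//.
apply: le_trans (lee_wpmul2l _ IH) _; first by rewrite lee_fin expR_ge0.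
by rewrite -EFinM lee_fin -expRD ler_expR addnS -natr1 mulrDr mulr1 addrC.
Qed.

Lemma gap_sum_expectation (th : R) k h : (k < K)%N -> (h <= H)%N ->
  (\int[P]_o (expR (th * gap_sum k h o))%:E <=
    (expR (th ^+ 2 * (H%:R + H%:R) ^+ 2 / 2 * (k * H + h)%:R))%:E)%E.
Proof.
set c := _ / 2.
elim: k h => [|k IHk]; elim=> [|h IHh] kK hH.
- have -> : (\int[P]_o (expR (th * gap_sum 0 0 o))%:E = \int[P]_o (cst 1 o))%E.
    by apply: eq_integral => o _; rewrite /gap_sum !big_geq// addr0 mulr0 expR0.
  by rewrite integral_probability_one mulr0 expR0.
- by apply: gap_sum_step => //; apply: IHh => //; exact: ltnW.
(* At an episode boundary nothing is added: the end of episode [k + 1] and the start of the next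
   have the same sum and the same count. *)
- have -> : (\int[P]_o (expR (th * gap_sum k.+1 0 o))%:E =
      \int[P]_o (expR (th * gap_sum k H o))%:E)%E.
    apply: eq_integral => o _; rewrite /gap_sum big_nat_recr//= [X in _ + X]big_geq//.
    by rewrite addr0.
  apply: le_trans (IHk H (ltnW kK) (leqnn H)) _.
  by rewrite mulSn addn0 addnC.
- by apply: gap_sum_step => //; apply: IHh => //; exact: ltnW.
Qed.

Lemma measurable_gap_sum : (0 < K)%N -> measurable_fun setT (gap_sum K.-1 H).
Proof.
move=> K0.
have mst i j : (1 <= i < K.+1)%N -> (1 <= j <= H.+1)%N -> measurable_fun setT (s i j).
  by move=> _ _; exact: ms.
have mB i j : (1 <= i < K.+1)%N -> (1 <= j <= H)%N ->
    [/\ measurable_mx (B1 i j), measurable_mx (B2 i j),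
    measurable_mx (g1 i j) & measurable_mx (g2 i j)].
  move=> _ _; split => x y; rewrite ?(ord1 y).
  - by have [] := mBg i j x y.
  - by have [_ []] := mBg i j x y.
  - by have [_ [_ []]] := mBg i j x x.
  - by have [_ [_ []]] := mBg i j x x.
have mgap i j : (1 <= i <= K)%N -> (1 <= j <= H)%N -> measurable_fun setT (fun o => gapo o i j).
  move=> /andP[i1 iK] jH.
  apply: (measurable_gap_diff musf w lam beta a0 mr mphi mst mB) => //.
  by rewrite i1 leqW.
apply: measurable_funD.
  apply: measurable_sum_nat => i /andP[i1 iK]; apply: measurable_sum_nat => j /andP[j1 jH].
  apply: mgap; last by rewrite j1.
  by rewrite i1 /= -(prednK K0) ltnW.
apply: measurable_sum_nat => j /andP[j1 jH]; apply: mgap; last by rewrite j1.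
by rewrite prednK// leqnn K0.
Qed.

Lemma gap_event (p : R) : (0 < K)%N -> 0 < p < 1 ->
  exists2 G : set Omega, measurable G /\ ((3 / p)%:E * P (~` G) <= 1)%E &
  forall o, G o -> \sum_(1 <= k < K.+1) \sum_(1 <= h < H.+1) gapo o k h <=
    Num.sqrt (8 * H%:R ^+ 3 * K%:R * ln (3 / p)).
Proof.
move=> K0 /andP[p0 p1].
have Hp : 0 < H%:R :> R by rewrite ltr0n.
have Kp : 0 < K%:R :> R by rewrite ltr0n.
have p3 : 0 < 3 / p by exact: divr_gt0.
pose L := ln (3 / p); pose y := Num.sqrt (8 * H%:R ^+ 3 * K%:R * L).
have L0 : 0 < L.
  by rewrite ln_gt0// ltr_pdivlMr// mul1r (lt_trans p1)// ltr1n.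
have y0 : 0 < y by rewrite sqrtr_gt0 !mulr_gt0// exprn_gt0.
have y2 : y ^+ 2 = 8 * H%:R ^+ 3 * K%:R * L.
  by rewrite sqr_sqrtr// ltW// !mulr_gt0// exprn_gt0.
(* Chernoff's choice: [K H] differences of width [2 H] give the exponent [2 H^3 K th^2 - th y],
   minimal here with value [- y^2 / (8 H^3 K) = - L]. *)
pose th := y / (4 * H%:R ^+ 3 * K%:R).
have th0 : 0 < th by rewrite divr_gt0// !mulr_gt0// exprn_gt0.
have thy : th * y = 2 * L.
  have -> : th * y = y ^+ 2 / (4 * H%:R ^+ 3 * K%:R) by rewrite /th; ring.
  by rewrite y2; field; rewrite !gt_eqF.
have thc : th ^+ 2 * (H%:R + H%:R) ^+ 2 / 2 * (K.-1 * H + H)%:R = L.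
  have -> : (K.-1 * H + H = K * H)%N by rewrite addnC -mulSn prednK.
  have -> : th ^+ 2 = y ^+ 2 / (4 * H%:R ^+ 3 * K%:R) ^+ 2 by rewrite /th exprMn exprVn.
  by rewrite y2 natrM; field; rewrite !gt_eqF.
(* Ville's inequality at horizon 0 is Markov's inequality, so a constant process suffices; the
   factor [exp (- L)] normalises its mean to at most 1. *)
pose M (n : nat) o := expR (- L) * expR (th * gap_sum K.-1 H o).
have mE : measurable_fun setT (fun o => expR (th * gap_sum K.-1 H o)).
  apply: measurableT_comp; first exact: measurable_expR.
  by apply: measurable_funM => //; exact: measurable_gap_sum.
have mM n : (n <= 0)%N -> measurable_fun setT (M n).
  by move=> _; exact: measurable_funM.
have M0 n o : 0 <= M n o by apply: mulr_ge0; exact: expR_ge0.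
have init : (\int[P]_o (M 0%N o)%:E <= 1)%E.
  have mEe : measurable_fun setT (fun o => (expR (th * gap_sum K.-1 H o))%:E).
    exact/measurable_EFinP.
  under eq_integral do rewrite /M EFinM.
  rewrite ge0_integralZl//.
  have KK : (K.-1 < K)%N by rewrite prednK.
  apply: le_trans (lee_wpmul2l _ (gap_sum_expectation th KK (leqnn H))) _.
    by rewrite lee_fin expR_ge0.
  by rewrite thc -EFinM lee_fin -expRD addNr expR0.
have mL : measurable (below M (3 / p) 0).
  exact: (@measurable_below _ Omega R 0 M (3 / p) mM 0 (leqnn _)).
have V := @Ville_ineq _ Omega R P 0 M (3 / p) mM M0 p3 (fun n => _) init.
exists (below M (3 / p) 0).
  by split => //; apply: V.
have eL : 3 / p = expR L by rewrite /L lnK ?posrE.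
move=> o /(_ 0%N (leqnn _)); rewrite /M -expRD [in X in _ < X]eL ltr_expR => h.
have hS : gap_sum K.-1 H o = \sum_(1 <= k < K.+1) \sum_(1 <= h < H.+1) gapo o k h.
  by rewrite /gap_sum -[in RHS](prednK K0) [RHS]big_nat_recr.
rewrite -hS -/L -/y; apply: ltW; rewrite -(ltr_pM2l th0) thy.
have -> : 2 * L = L + L by ring.
by rewrite -ltrBlDl addrC.
Qed.

End HighProbability.

(** * Union bounds and assembly of the good event *)

Section UnionBound.
Local Open Scope ereal_scope.
Context dO (Omega : measurableType dO) (R : realType) (P : probability Omega R).
Implicit Types (G : set Omega) (a q : R).

Lemma probability_setC_le G q : measurable G ->
  (P (~` G) <= q%:E) <-> ((1 - q)%:E <= P G).
Proof.
move=> mG; rewrite probability_setC//.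
have -> : P G = (fine (P G))%:E by rewrite fineK// fin_num_measure.
rewrite -EFinB !lee_fin; split; lra.
Qed.

Lemma probability_le_inv G a : measurable G -> (0 < a)%R -> a%:E * P G <= 1 ->
  P G <= (a^-1)%:E.
Proof.
move=> mG a0; have -> : P G = (fine (P G))%:E by rewrite fineK// fin_num_measure.
by rewrite -EFinM !lee_fin -ler_pdivlMl// mulr1.
Qed.

Lemma probability_setIC_le G1 G2 q1 q2 : measurable G1 -> measurable G2 ->
  P (~` G1) <= q1%:E -> P (~` G2) <= q2%:E -> P (~` (G1 `&` G2)) <= (q1 + q2)%:E.
Proof.
move=> m1 m2 h1 h2; rewrite setCI EFinD; apply: le_trans (leeD h1 h2).
by apply: measureU2; exact: measurableC.
Qed.

Lemma finite_union_bound (B : nat -> set Omega) q m :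
  (forall h, (1 <= h <= m)%N -> measurable (B h) /\ P (~` B h) <= q%:E) ->
  exists2 G, measurable G /\ P (~` G) <= (m%:R * q)%:E &
    forall o, G o -> forall h, (1 <= h <= m)%N -> B h o.
Proof.
elim: m => [|m IH] hB.
  exists setT; last by move=> o _ h /andP[h1]; rewrite leqNgt h1.
  by rewrite setCT measure0 mul0r.
have [h /andP[h1 hm]|G [mG PG] GB] := IH; first by apply: hB; rewrite h1 leqW.
have [mB PB] := hB m.+1 (leqnn _).
exists (G `&` B m.+1); first split; first exact: measurableI.
  rewrite -natr1 mulrDl mul1r; exact: probability_setIC_le.
move=> o [Go Bo] h /andP[h1]; rewrite leq_eqVlt => /orP[/eqP->//|hm].
by apply: GB; rewrite ?h1.
Qed.

End UnionBound.

Theorem theorem1 :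
  exists c m : nat,
  forall (R : realType) (dS : measure_display) (S : measurableType dS)
    (mu : {measure set S -> \bar R}) (A : finType) (a0 : A)
    (d H K : nat) (Cw p : R)
    (r : nat -> S -> A -> R) (phi : S -> A -> S -> 'cV[R]_d)
    (w : nat -> 'cV[R]_d) (beta : nat -> R)
    (dO : measure_display) (Omega : measurableType dO) (P : probability Omega R)
    (s : nat -> nat -> Omega -> S)
    (B1 B2 : nat -> nat -> Omega -> 'M[R]_d)
    (g1 g2 : nat -> nat -> Omega -> 'cV[R]_d),
  let lam : R := H%:R ^+ 2 in
  (* the algorithm run on the realisation o *)
  let act o := action mu phi H r lam beta a0 (fun i j => s i j o)
                 (fun i j => B1 i j o) (fun i j => B2 i j o)
                 (fun i j => g1 i j o) (fun i j => g2 i j o) in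
  (* ---- the MDP ---- *)
  (0 < H)%N ->
  sigma_finite setT mu ->
  (forall h x a, 0 <= r h x a <= 1) ->
  (forall h a, measurable_fun setT (fun x => r h x a)) ->
  (forall a i, measurable_fun setT (fun x : S * S => phi x.1 a x.2 i 0)) ->
  (forall x a i, mu.-integrable setT (fun x' => (phi x a x' i 0)%:E)) ->
  (forall v : S -> R, measurable_fun setT v -> (forall x, 0 <= v x <= 1) ->
     forall x a, norm2 (phi_v mu phi v x a) <= 1) ->
  (forall h, (1 <= h <= H)%N -> norm2 (w h) <= Cw) ->
  (forall h x a x', (1 <= h <= H)%N -> 0 <= trans_dens phi (w h) x a x') ->
  (forall h x a, (1 <= h <= H)%N ->
     (\int[mu]_(x' in setT) (trans_dens phi (w h) x a x')%:E = 1)%E) ->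
  (* ---- the random process ---- *)
  (forall k h, measurable_fun setT (s k h)) ->
  (forall k h (x y : 'I_d),
     measurable_fun setT (fun o => B1 k h o x y) /\
     measurable_fun setT (fun o => B2 k h o x y) /\
     measurable_fun setT (fun o => g1 k h o x 0) /\
     measurable_fun setT (fun o => g2 k h o x 0)) ->
  (forall k h o, (B1 k h o)^T = B1 k h o /\ (B2 k h o)^T = B2 k h o) ->
  (* given the history, s^k_{h+1} ~ p_h( . | s^k_h, a^k_h) *)
  (forall k h, (1 <= k <= K)%N -> (1 <= h <= H)%N ->
     forall E, <<s history H s B1 B2 g1 g2 k h >> E ->
     forall Bs : set S, measurable Bs ->
     P (E `&` s k h.+1 @^-1` Bs) =
     (\int[P]_(o in E) trans_prob mu phi (w h) (s k h o) (act o k h) Bs)%E) ->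
  (* ---- failure parameter and conditions (1)-(3) ---- *)
  0 < p < 1 ->
  (exists E : set Omega, measurable E /\ ((1 - p / 3)%:E <= P E)%E /\
     forall o, E o ->
     exists Ulow Uhigh C : nat -> R,
       (forall k, 0 <= Ulow k /\ 0 <= Uhigh k /\ 0 <= C k) /\
       (forall k h, (1 <= k <= K)%N -> (1 <= h <= H)%N ->
          forall e, eigenvalue (Bpert (fun i j => B1 i j o) (fun i j => B2 i j o) k h) e ->
          Ulow k <= e <= Uhigh k) /\
       (forall k h, (1 <= k <= K)%N -> (1 <= h <= H)%N ->
          norm2 (gpert (fun i j => g1 i j o) (fun i j => g2 i j o) k h) <= C k) /\
       (forall k1 k2, (1 <= k1)%N -> (k1 <= k2 <= K)%N -> beta k1 <= beta k2) /\
       (forall k, (1 <= k <= K)%N ->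
          ((lam + Uhigh k) * Cw + C k) / Num.sqrt (lam + Ulow k)
          + Num.sqrt (2 * H%:R ^+ 2 *
               ln (3 * H%:R * Num.sqrt ((1 + K%:R * H%:R) ^+ d) / p))
          <= beta k)) ->
  (* ---- conclusion: with probability >= 1 - p, R(K) = O~(...) ---- *)
  exists E : set Omega, measurable E /\ ((1 - p)%:E <= P E)%E /\
    forall o, E o ->
      regret mu phi H r w lam beta a0 (fun i j => s i j o)
        (fun i j => B1 i j o) (fun i j => B2 i j o)
        (fun i j => g1 i j o) (fun i j => g2 i j o) K
      <= c%:R * (1 + ln (H%:R * K%:R / p)) ^+ m
         * (H%:R * Num.sqrt d%:R * beta K + H%:R * Num.sqrt H%:R)
         * Num.sqrt K%:R.
Proof.
exists 4%N, 1%N => R dS S mu A a0 d H K Cw p r phi w beta dO Omega P s B1 B2 g1 g2 lam act_o.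
move=> H0 musf r01 mr mphi iphi phi1 wC dens0 dens1 ms mBg Bsym transition p01.
move=> [E0 [mE0 [PE0 E0P]]].
have /andP[p0 p1] := p01.
(* Without episodes both sides vanish, and the whole space serves as the event. *)
have [K0|K0] := posnP K.
  exists setT; split => //; split.
    by rewrite probability_setT lee_fin gerBl ltW.
  by move=> o _; rewrite K0 /regret big_geq// sqrtr0 mulr0.
have Hp : 0 < H%:R :> R by rewrite ltr0n.
have a0p : 0 < 3 * H%:R / p by rewrite divr_gt0// mulr_gt0.
have p3 : 0 < 3 / p by rewrite divr_gt0.
have [G2 [mG2 PG2] G2P] := gap_event H0 musf r01 mr mphi dens0 dens1 ms mBg transition K0 p01.
have {}PG2 : (P (~` G2) <= (p / 3)%:E)%E.
  have := probability_le_inv (measurableC mG2) p3 PG2.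
  by rewrite invf_div.
have noiseB h : (1 <= h <= H)%N -> measurable (below (fun n o => mix mu phi H r w lam beta a0
    (fun i j => s i j o) (fun i j => B1 i j o) (fun i j => B2 i j o)
    (fun i j => g1 i j o) (fun i j => g2 i j o) n h) (3 * H%:R / p) K.-1) /\
  (P (~` below (fun n o => mix mu phi H r w lam beta a0
    (fun i j => s i j o) (fun i j => B1 i j o) (fun i j => B2 i j o)
    (fun i j => g1 i j o) (fun i j => g2 i j o) n h) (3 * H%:R / p) K.-1)
   <= (p / (3 * H%:R))%:E)%E.
  move=> hH.
  have [mb pb] := noise_event H0 musf mr mphi dens0 dens1 ms mBg transition K0 hH a0p.
  split=> //; have := probability_le_inv (measurableC mb) a0p pb.
  by rewrite invf_div.
have [G1 [mG1 PG1] G1P] := finite_union_bound noiseB.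
have {}PG1 : (P (~` G1) <= (p / 3)%:E)%E.
  (* Each of the [H] stages fails with probability at most [p / (3 H)], the inverse of Ville's
     level. *)
  have -> : p / 3 = H%:R * (p / (3 * H%:R)) by field; rewrite gt_eqF.
  exact: PG1.
have PE0' : (P (~` E0) <= (p / 3)%:E)%E by exact: (probability_setC_le P (p / 3) mE0).2.
exists (E0 `&` (G1 `&` G2)).
have mG12 : measurable (G1 `&` G2) by exact: measurableI.
have mG : measurable (E0 `&` (G1 `&` G2)) by exact: measurableI.
split=> //; split.
  apply: (probability_setC_le P p mG).1.
  have -> : p = p / 3 + (p / 3 + p / 3) by field.
  by apply: probability_setIC_le => //; exact: probability_setIC_le.
move=> o [E0o [G1o G2o]].
have [Ulow [Uhigh [C [UC [eigB [gC [bmono bge]]]]]]] := E0P o E0o.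
have mixlt n h : (n < K)%N -> (1 <= h <= H)%N -> mix mu phi H r w lam beta a0
    (fun i j => s i j o) (fun i j => B1 i j o) (fun i j => B2 i j o)
    (fun i j => g1 i j o) (fun i j => g2 i j o) n h < 3 * H%:R / p.
  by move=> nK hH; apply: (G1P o G1o h hH); rewrite -ltnS prednK.
have Bs k h : (B1 k h o)^T = B1 k h o /\ (B2 k h o)^T = B2 k h o by exact: Bsym.
have reg := @regret_trajectory R dS S mu A d phi H r w lam beta a0
  (fun i j => s i j o) (fun i j => B1 i j o) (fun i j => B2 i j o)
  (fun i j => g1 i j o) (fun i j => g2 i j o) musf H0 (erefl _) r01 mr mphi iphi phi1
  dens0 dens1 K Cw p Ulow Uhigh C p0 wC Bs UC eigB gC bmono bge mixlt.
have bK : 0 <= beta K.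
  have kK : (1 <= K <= K)%N by rewrite K0 leqnn.
  exact: (@beta_ge0 R d H w lam beta H0 (erefl _) K Cw p Ulow Uhigh C wC UC bge K kK).
apply: le_trans reg _; apply: le_trans _ (regret_bound_arith d H0 K0 p01 bK).
by rewrite lerD2l; exact: G2P.
Qed.
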